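(* Let $W$ be the affine Weyl group of type $\widetilde A_2$ and let $w\in W$ be an element not contained in a proper parabolic subgroup. Let $\pi_{proj}$ denote the projection of $\mathcal H$ onto the span of the KL basis elements $b_x$ with $x$ in the projective cell (along the span of the remaining KL basis elements). Then $$\nu(b_w^n)\;\sim\;\nu\bigl(\pi_{proj}(b_w^n)\bigr)\qquad(n\to\infty).$$
   Context: $W=\widetilde A_2=\langle 1,2,3\mid 121=212,\ 232=323,\ 131=313,\ 1^2=2^2=3^2=\mathrm{id}\rangle$. The Hecke algebra at $v=1$ is $\mathcal H=\mathbb R[W]$ with standard basis $\{\delta_w\}_{w\in W}$, $\delta_x\delta_y=\delta_{xy}$. $\{b_w\}_{w\in W}$ is the Kazhdan--Lusztig (KL) basis of the generic Hecke algebra, specialized at $v=1$; so $b_s=\delta_s+1$ for simple reflections $s$, and $b_w=\sum_{x\le w}P_{x,w}(1)\,\delta_x$ with $P_{x,w}$ the Kazhdan--Lusztig polynomials. The linear map $\nu:\mathcal H\to\mathbb R$ is $\nu(\sum_w c_wb_w)=\sum_w c_w$. The group $W$ has three two-sided Kazhdan--Lusztig cells: $\{\mathrm{id}\}$; the cyclic (wall) cell, consisting of the elements given by nonempty words in which consecutive letters follow the cyclic order $1\to2\to3\to1$ throughout, or the reverse cyclic order throughout (starting at any letter); and the projective cell (the lowest two-sided cell, containing $121$), consisting of all other elements. The notation $f\sim g$ means $f(n)/g(n)\to1$. *)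

(* Defs.v *)
From HB Require Import structures.
From mathcomp Require Import all_boot all_order all_algebra.
From mathcomp Require Import finmap monalg.
From mathcomp Require Import boolp classical_sets reals topology normedtype
  sequences.

Set Implicit Arguments.
Unset Strict Implicit.
Unset Printing Implicit Defensive.

Import GRing.Theory Num.Theory.
Import numFieldNormedType.Exports.

Local Open Scope ring_scope.
Local Open Scope quotient_scope.

(** * Group algebras *)

Definition groupAlg (S : nzRingType) (G : groupType) : Type := {malg S[G]}.

(* [{malg S[G]}] carries a ring structure in monalg only when [G] is a
   [monomType], a class that excludes groups. *)
Section GroupAlgebra.
Variables (S : nzRingType) (G : groupType).

HB.instance Definition _ := GRing.Lmodule.on (groupAlg S G).

Implicit Types g h : groupAlg S G.

Definition gdelta (x : G) : groupAlg S G := << x >>.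

Definition gmul g h : groupAlg S G :=
  \sum_(x <- msupp g) \sum_(y <- msupp h) << g@_x * h@_y *g (x * y)%g >>.

Lemma gmulw (d1 d2 : {fset G}) g h :
  (msupp g `<=` d1)%fset -> (msupp h `<=` d2)%fset ->
  gmul g h = \sum_(x <- d1) \sum_(y <- d2) << g@_x * h@_y *g (x * y)%g >>.
Proof.
move=> le1 le2; rewrite /gmul (big_fset_incl _ le1) /=.
  apply/eq_bigr=> x _; apply/big_fset_incl => // y _ /mcoeff_outdom ->.
  by rewrite mulr0 monalgU0.
move=> x _ /mcoeff_outdom gx.
by rewrite big1 // => y _; rewrite gx mul0r monalgU0.
Qed.

Lemma gmulDl : left_distributive gmul +%R.
Proof.
move=> g1 g2 h.
rewrite (gmulw (msuppD_le g1 g2) (fsubset_refl _)).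
rewrite (gmulw (fsubsetUl _ (msupp g2)) (fsubset_refl _)).
rewrite (gmulw (fsubsetUr (msupp g1) _) (fsubset_refl _)).
rewrite -big_split /=; apply/eq_bigr=> x _.
rewrite -big_split /=; apply/eq_bigr=> y _.
by rewrite mcoeffD mulrDl monalgUD.
Qed.

Lemma gmulDr : right_distributive gmul +%R.
Proof.
move=> h g1 g2.
rewrite (gmulw (fsubset_refl _) (msuppD_le g1 g2)).
rewrite (gmulw (fsubset_refl _) (fsubsetUl _ (msupp g2))).
rewrite (gmulw (fsubset_refl _) (fsubsetUr (msupp g1) _)).
rewrite -big_split /=; apply/eq_bigr=> x _.
rewrite -big_split /=; apply/eq_bigr=> y _.
by rewrite mcoeffD mulrDr monalgUD.
Qed.

Lemma gmul0g : left_zero (0 : groupAlg S G) gmul.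
Proof. by move=> g; rewrite /gmul msupp0 big_seq_fset0. Qed.

Lemma gmulg0 : right_zero (0 : groupAlg S G) gmul.
Proof.
by move=> g; rewrite /gmul big1 // => x _; rewrite msupp0 big_seq_fset0.
Qed.

Lemma gmulUU a b (x y : G) :
  gmul << a *g x >> << b *g y >> = << a * b *g (x * y)%g >>.
Proof. by rewrite (gmulw msuppU_le msuppU_le) !big_seq_fset1 !mcoeffUU. Qed.

Lemma gmul1g : left_id (gdelta 1%g) gmul.
Proof.
move=> g; rewrite (gmulw msuppU_le (fsubset_refl _)) big_seq_fset1.
rewrite [RHS]monalgE; apply/eq_bigr=> x _.
by rewrite mcoeffUU mul1r mul1g.
Qed.

Lemma gmulg1 : right_id (gdelta 1%g) gmul.
Proof.
move=> g; rewrite (gmulw (fsubset_refl _) msuppU_le) [RHS]monalgE.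
by apply/eq_bigr=> x _; rewrite big_seq_fset1 mcoeffUU mulr1 mulg1.
Qed.

Lemma gmul_suml I (r : seq I) (F : I -> groupAlg S G) h :
  gmul (\sum_(i <- r) F i) h = \sum_(i <- r) gmul (F i) h.
Proof. by apply: (big_morph (gmul^~ h) _ (gmul0g h)) => x y; apply: gmulDl. Qed.

Lemma gmul_sumr I (r : seq I) (F : I -> groupAlg S G) h :
  gmul h (\sum_(i <- r) F i) = \sum_(i <- r) gmul h (F i).
Proof. by apply: (big_morph (gmul h) _ (gmulg0 h)) => x y; apply: gmulDr. Qed.

Lemma gmulA : associative gmul.
Proof.
have E (g : groupAlg S G) : exists (r : seq G) (c : G -> S),
    g = \sum_(x <- r) << c x *g x >> :> groupAlg S G.
  by exists (enum_fset (msupp g)), (fun x => g@_x); apply: monalgE.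
move=> g1 g2 g3.
have [r1 [c1 ->]] := E g1; have [r2 [c2 ->]] := E g2.
have [r3 [c3 ->]] := E g3.
rewrite !(gmul_suml r1); apply: eq_bigr=> x _.
rewrite (gmul_suml r2) !(gmul_sumr r2) (gmul_suml r2); apply: eq_bigr=> y _.
rewrite !(gmul_sumr r3); apply: eq_bigr=> z _.
by rewrite !gmulUU mulrA mulgA.
Qed.

Lemma gdelta1_neq0 : gdelta 1%g != 0.
Proof. by apply/eqP/malgP=> /(_ 1%g) /eqP; rewrite !mcoeffsE oner_eq0. Qed.

HB.instance Definition _ := GRing.Zmodule_isNzRing.Build (groupAlg S G)
  gmulA gmul1g gmulg1 gmulDl gmulDr gdelta1_neq0.

Lemma groupAlg_scaleAl (a : S) g h : a *: (g * h) = a *: g * h.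
Proof.
have gZU c x : a *: (<< c *g x >> : groupAlg S G) = << a * c *g x >>.
  by apply/malgP=> k; rewrite mcoeffZ !mcoeffU mulrnAr.
rewrite [(g * h) in LHS](gmulw (fsubset_refl (msupp g)) (fsubset_refl _)).
rewrite [RHS](gmulw (msuppZ_le a g) (fsubset_refl _)).
rewrite scaler_sumr; apply: eq_bigr=> x _.
rewrite scaler_sumr; apply: eq_bigr=> y _.
by rewrite gZU mulrA; congr << _ * _ *g _ >>; rewrite mcoeffZ.
Qed.

HB.instance Definition _ :=
  GRing.Lmodule_isLalgebra.Build S (groupAlg S G) groupAlg_scaleAl.

End GroupAlgebra.

(** * The affine Weyl group of type A2~ *)

(* The generators 1, 2, 3 are the elements 0, 1, 2 of ['I_3].  As generators
   are involutions, the group with the given presentation is the monoid of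
   words modulo the congruence generated by the relations. *)
Inductive A2_rel : seq 'I_3 -> seq 'I_3 -> Prop :=
| A2_refl s : A2_rel s s
| A2_sym s t : A2_rel s t -> A2_rel t s
| A2_trans s t u : A2_rel s t -> A2_rel t u -> A2_rel s u
| A2_quad p q i : A2_rel (p ++ [:: i; i] ++ q) (p ++ q)
| A2_braid p q i j : A2_rel (p ++ [:: i; j; i] ++ q) (p ++ [:: j; i; j] ++ q).

Definition A2_relb : rel (seq 'I_3) := fun s t => `[< A2_rel s t >].

Lemma A2_relb_refl : reflexive A2_relb.
Proof. by move=> s; apply/asboolP; apply: A2_refl. Qed.

Lemma A2_relb_sym : symmetric A2_relb.
Proof. by move=> s t; apply/asboolP/asboolP => /A2_sym. Qed.

Lemma A2_relb_trans : transitive A2_relb.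
Proof.
by move=> t s u /asboolP st /asboolP tu; apply/asboolP; apply: A2_trans st tu.
Qed.

Canonical A2_equiv := EquivRel A2_relb A2_relb_refl A2_relb_sym A2_relb_trans.

Definition W : Type := {eq_quot A2_equiv}.
HB.instance Definition _ := Choice.on W.
HB.instance Definition _ := EqQuotient.on W.

Definition of_word (s : seq 'I_3) : W := \pi_W s.

Lemma of_wordP s t : reflect (A2_rel s t) (of_word s == of_word t).
Proof. by rewrite /of_word eqmodE; apply: asboolP. Qed.

Lemma of_word_repr (x : W) : of_word (repr x) = x.
Proof. exact: reprK. Qed.

Lemma repr_of_word s : A2_rel (repr (of_word s)) s.
Proof. by apply/of_wordP; rewrite of_word_repr. Qed.

Lemma A2_catl u s t : A2_rel s t -> A2_rel (u ++ s) (u ++ t).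
Proof.
elim=> [{}s|{}s {}t _|{}s {}t v _ IH1 _ IH2|p q i|p q i j].
- exact: A2_refl.
- exact: A2_sym.
- exact: A2_trans IH1 IH2.
- by rewrite !(catA u); apply: A2_quad.
- by rewrite !(catA u); apply: A2_braid.
Qed.

Lemma A2_catr u s t : A2_rel s t -> A2_rel (s ++ u) (t ++ u).
Proof.
elim=> [{}s|{}s {}t _|{}s {}t v _ IH1 _ IH2|p q i|p q i j].
- exact: A2_refl.
- exact: A2_sym.
- exact: A2_trans IH1 IH2.
- by rewrite -!catA; apply: A2_quad.
- by rewrite -!catA; apply: A2_braid.
Qed.

Lemma A2_cat_rev s : A2_rel (rev s ++ s) [::].
Proof.
elim: s => [|i s IH]; first exact: A2_refl.
rewrite rev_cons -cats1 -catA; apply: A2_trans IH.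
exact: (A2_quad (rev s) s i).
Qed.

Lemma A2_rev s t : A2_rel s t -> A2_rel (rev s) (rev t).
Proof.
elim=> [{}s|{}s {}t _|{}s {}t v _ IH1 _ IH2|p q i|p q i j].
- exact: A2_refl.
- exact: A2_sym.
- exact: A2_trans IH1 IH2.
- by rewrite !rev_cat -catA; apply: A2_quad.
- by rewrite !rev_cat -!catA; apply: A2_braid.
Qed.

Definition Wone : W := of_word [::].
Definition Wmul (x y : W) : W := of_word (repr x ++ repr y).
Definition Winv (x : W) : W := of_word (rev (repr x)).

Lemma Wmul_word s t : Wmul (of_word s) (of_word t) = of_word (s ++ t).
Proof.
apply/eqP/of_wordP; apply: (@A2_trans _ (s ++ repr (of_word t))).
  exact/A2_catr/repr_of_word.
exact/A2_catl/repr_of_word.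
Qed.

Lemma Winv_word s : Winv (of_word s) = of_word (rev s).
Proof. exact/eqP/of_wordP/A2_rev/repr_of_word. Qed.

Lemma WmulA : associative Wmul.
Proof.
move=> x y z; rewrite -(of_word_repr x) -(of_word_repr y) -(of_word_repr z).
by rewrite !Wmul_word catA.
Qed.

Lemma Wmul1 : left_id Wone Wmul.
Proof. by move=> x; rewrite -(of_word_repr x) Wmul_word. Qed.

Lemma W1mul : right_id Wone Wmul.
Proof. by move=> x; rewrite -(of_word_repr x) Wmul_word cats0. Qed.

Lemma WmulV : left_inverse Wone Winv Wmul.
Proof.
move=> x; rewrite -(of_word_repr x) Winv_word Wmul_word.
exact/eqP/of_wordP/A2_cat_rev.
Qed.

Lemma WVmul : right_inverse Wone Winv Wmul.
Proof.
move=> x; rewrite -(of_word_repr x) Winv_word Wmul_word.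
by apply/eqP/of_wordP; rewrite -{1}(revK (repr x)); apply: A2_cat_rev.
Qed.

HB.instance Definition _ := isGroup.Build W WmulA Wmul1 W1mul WmulV WVmul.

Definition gen (i : 'I_3) : W := of_word [:: i].

Lemma length_subproof (w : W) :
  exists n, [exists t : n.-tuple 'I_3, of_word t == w].
Proof.
exists (size (repr w)); apply/existsP; exists (in_tuple (repr w)).
by rewrite of_word_repr.
Qed.

Definition length (w : W) : nat := ex_minn (length_subproof w).

Lemma redword_subproof (w : W) :
  exists s : seq 'I_3, (size s == length w) && (of_word s == w).
Proof.
rewrite /length; case: ex_minnP => n /existsP[t tw] _.
by exists t; rewrite size_tuple eqxx.
Qed.

Definition redword (w : W) : seq 'I_3 := xchoose (redword_subproof w).

(* The standard parabolic subgroup generated by [I]; words suffice since the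
   generators are involutions. *)
Definition parabolic (I : {set 'I_3}) : set W :=
  [set w | exists s : seq 'I_3, all (mem I) s /\ of_word s = w].

(* ['I_3] is Z/3, so [j = i + 1] is the cyclic order 1 -> 2 -> 3 -> 1. *)
Definition cyclic_cell : set W :=
  [set w | exists i s, of_word (i :: s) = w /\
     (path (fun i j : 'I_3 => j == i + 1) i s \/
      path (fun i j : 'I_3 => i == j + 1) i s)].

Definition proj_cell : set W :=
  [set w | w <> 1%g /\ ~ cyclic_cell w].

(** * The generic Hecke algebra and its Kazhdan-Lusztig basis *)

(* The integers as an infinite cyclic group, written multiplicatively: [k]
   stands for the exponent of v^k. *)
Definition vexp : Type := int.
HB.instance Definition _ := Choice.on vexp.
HB.instance Definition _ :=
  isGroup.Build vexp (@addrA int) (@add0r int) (@addr0 int) (@addNr int)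
    (@addrN int).

Definition laurent : Type := groupAlg int vexp.
HB.instance Definition _ := GRing.NzRing.on laurent.

Definition vpow (k : int) : laurent := gdelta int (k : vexp).

Definition laurent_bar (a : laurent) : laurent :=
  \sum_(k <- msupp a) a@_k *: vpow (- (k : int)).

Definition laurent_at1 (a : laurent) : int := \sum_(k <- msupp a) a@_k.

(* The underlying free Z[v,v^-1]-module with standard basis [<< w >>], in the
   normalisation (delta_s - v^-1) (delta_s + v) = 0. *)
Definition genHecke : Type := {malg laurent[W]}.
HB.instance Definition _ := GRing.Lmodule.on genHecke.

Definition delta (w : W) : genHecke := << w >>.

(* Left multiplication by delta_s, respectively by its inverse
   delta_s + (v - v^-1). *)
Definition lmul_gen (i : 'I_3) (h : genHecke) : genHecke :=
  \sum_(w <- msupp h) h@_w *: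
    (if (length w < length (gen i * w)%g)%N then delta (gen i * w)%g
     else delta (gen i * w)%g + (vpow (-1) - vpow 1) *: delta w).

Definition lmul_genV (i : 'I_3) (h : genHecke) : genHecke :=
  lmul_gen i h + (vpow 1 - vpow (-1)) *: h.

(* The bar involution v |-> v^-1, delta_w |-> (delta_(w^-1))^-1, where
   (delta_(w^-1))^-1 is the product of the inverses of delta_s along a reduced
   word of w. *)
Definition bar_delta (w : W) : genHecke :=
  foldr lmul_genV (delta 1%g) (redword w).

Definition bar (h : genHecke) : genHecke :=
  \sum_(w <- msupp h) laurent_bar h@_w *: bar_delta w.

(* [B w] is the unique bar-invariant element of
   delta_w + sum_(x <> w) v Z[v] delta_x; in terms of the Kazhdan-Lusztig
   polynomials, the coefficient of delta_x is
   v^(length w - length x) P_(x,w)(v^-2). *)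
Definition is_KL_basis (B : W -> genHecke) : Prop :=
  forall w, [/\ bar (B w) = B w,
    (B w)@_w = 1 &
    forall x, x != w -> forall k : int, k <= 0 -> (B w)@_x@_(k : vexp) = 0].

(* The specialisation at v = 1 of the generic algebra is the group algebra. *)
Definition hecke (R : nzRingType) : Type := groupAlg R W.
HB.instance Definition _ (R : nzRingType) := GRing.Lalgebra.on (hecke R).

Definition specialize (R : nzRingType) (h : genHecke) : hecke R :=
  \sum_(w <- msupp h) (laurent_at1 h@_w)%:~R *: gdelta R w.

(* Main.v *)
(* The projective cell consists of the elements [w] with two left descents
   ([theta]) and of the elements [s w] where [s] is the remaining generator,
   and b_(s w) = c_s b_w with c_s = 1 + delta_s.  On this cell c_(s - d) c_s b_w
   is b_w plus the sum of at most three basis elements obtained from [w] by the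
   operators [u1], [u2], [u3] (orientation d = 1 or -1 in Z/3): the latter sum
   is multiplication by a fundamental character of SL_3, with b_w in the role
   of an irreducible character.

   For w in the projective cell, b_w is a Schur function of the operators
   applied to one of two smallest elements, which shows that multiplication by
   b_w maps nonempty sums of basis elements of the cell to nonempty sums.
   Hence nu(b_w^n) > 0, and pi_proj fixes b_w^n.

   For w in the cyclic cell, of length at least 3, let x_m be its suffix of
   length m.  Then b_(x_(m+1)) = c b_(x_m) - c' b_(x_(m-2)) + b_(x_(m-3)), a
   recursion whose solutions are again sums of basis elements.  This gives
   b_w b_y = C b_(y') + (a nonempty sum over the projective cell), with C <= 2,
   when y extends w cyclically, while multiplication by b_w multiplies the
   number of terms of a sum over the projective cell by at least 3.  So nu of
   the projective part of b_w^n is at least 3^(n-2), while the remaining part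
   contributes at most 2^(n-1). *)
Require Import Defs.
From mathcomp Require Import all_boot all_order all_algebra.
From mathcomp Require Import finmap monalg.
From mathcomp Require Import boolp classical_sets reals topology normedtype
  sequences.
From mathcomp Require Import zify lra.

Set Implicit Arguments.
Unset Strict Implicit.
Unset Printing Implicit Defensive.

Import Order.TTheory GRing.Theory Num.Theory.
Import numFieldNormedType.Exports.

Local Open Scope ring_scope.

(** * Linear identities in abelian groups, by reflection *)

(** The recursions have minus signs, while the conclusion needs solutions that are sums of basis
    elements. The operators are only partially defined and do not commute, but on elements with two
    left descents U2 U1, U3 U1 and U3 U2 are the three operators of the opposite direction -d (the
    dual character), and U3 U2 U1 is the identity. Hence 1 - e_1 + e_2 - e_3 factors as (1 - U3)(1 -
    U2)(1 - U1) in this order, and inverting it takes three geometric series, in which lists are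
    only concatenated. This is why the cell is handled through lists of group elements, and why each
    recursion is brought to this third-order form with its initial values put into a source term.

    The structure constants at v = 1 are read off from the coefficients mu(z, x) of v in the generic
    basis. No Kazhdan-Lusztig polynomial is computed: the coefficients either cancel or reduce to
    the case where some left descent of x is not one of z, and there mu is 0 or 1. *)

Inductive zexp :=
  | ZVar of nat | ZZero | ZAdd of zexp & zexp | ZOpp of zexp | ZMuln of zexp & nat.

Fixpoint zeval (V : zmodType) (env : seq V) (e : zexp) : V :=
  match e with
  | ZVar n => env`_n
  | ZZero => 0
  | ZAdd a b => zeval env a + zeval env b
  | ZOpp a => - zeval env a
  | ZMuln a n => zeval env a *+ n
  end.

Fixpoint zcoef (e : zexp) (i : nat) : int :=
  match e with
  | ZVar n => (n == i)%:Z
  | ZZero => 0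
  | ZAdd a b => zcoef a i + zcoef b i
  | ZOpp a => - zcoef a i
  | ZMuln a n => zcoef a i * n%:Z
  end.

Lemma zevalE (V : zmodType) (env : seq V) e :
  zeval env e = \sum_(i < size env) env`_i *~ zcoef e i.
Proof.
elim: e => [n||a IHa b IHb|a IHa|a IHa n] /=; rewrite ?IHa ?IHb.
- have [lt_n|le_n] := ltnP n (size env); last first.
    rewrite nth_default // big1 // => i _.
    by rewrite gtn_eqF ?mulr0z // (leq_trans (ltn_ord i)).
  rewrite (bigD1 (Ordinal lt_n)) //= eqxx mulr1z big1 ?addr0 // => i ni.
  by rewrite -(inj_eq val_inj) /= eq_sym in ni; rewrite (negbTE ni) mulr0z.
- by rewrite big1 // => i _; rewrite mulr0z.
- by rewrite -big_split /=; apply: eq_bigr => i _; rewrite mulrzDr.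
- by rewrite -sumrN; apply: eq_bigr => i _; rewrite mulrNz.
- by rewrite -sumrMnl; apply: eq_bigr => i _; rewrite mulrzA -pmulrn.
Qed.

Lemma zmod_eq (V : zmodType) (env : seq V) e1 e2 :
  all (fun i => zcoef e1 i == zcoef e2 i) (iota 0 (size env)) ->
  zeval env e1 = zeval env e2.
Proof.
move=> /allP E; rewrite !zevalE; apply: eq_bigr => i _.
by rewrite (eqP (E i _)) // mem_iota ltn_ord.
Qed.

Ltac zindex x l :=
  lazymatch l with
  | x :: _ => constr:(0%N)
  | _ :: ?t => let n := zindex x t in constr:(S n)
  end.

Ltac zinsert x l :=
  lazymatch l with
  | nil => constr:(x :: nil)
  | x :: _ => l
  | ?y :: ?t => let t' := zinsert x t in constr:(y :: t')
  end.

Ltac zatoms e l :=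
  lazymatch e with
  | ?a + ?b => let l := zatoms a l in zatoms b l
  | - ?a => zatoms a l
  | ?a *+ S _ => zatoms a l
  | 0 => l
  | _ => zinsert e l
  end.

Ltac zreify e l :=
  lazymatch e with
  | ?a + ?b => let a := zreify a l in let b := zreify b l in constr:(ZAdd a b)
  | - ?a => let a := zreify a l in constr:(ZOpp a)
  | ?a *+ S ?n => let a := zreify a l in constr:(ZMuln a (S n))
  | 0 => constr:(ZZero)
  | _ => let n := zindex e l in constr:(ZVar n)
  end.

Ltac zmod :=
  lazymatch goal with |- @eq ?T ?a ?b =>
    let l := zatoms a (@nil T) in let l := zatoms b l in
    let ea := zreify a l in let eb := zreify b l in
    exact: (@zmod_eq _ l ea eb isT)
  end.

(** * Windows of affine permutations *)

(* [(a, b, c)] is the window of values at positions 0, 1, 2 of a bijection f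
   of the integers with f(k + 3) = f(k) + 3; the generator [i] exchanges the
   values at positions i and i + 1. *)
Definition window : Type := (int * int * int)%type.

Definition wact (i : 'I_3) (f : window) : window :=
  let: (a, b, c) := f in
  match val i with
  | 0%N => (b, a, c)
  | 1%N => (a, c, b)
  | _ => (c - 3, b, a + 3)
  end.

Definition wdesc (i : 'I_3) (f : window) : bool :=
  let: (a, b, c) := f in
  match val i with
  | 0%N => b < a
  | 1%N => c < b
  | _ => a + 3 < c
  end.

(** Distinctness modulo 3 rules out equality in every comparison made by [wdesc]. *)
Definition wgood (f : window) : Prop :=
  let: (a, b, c) := f in
  ((a - b) %% 3)%Z <> 0 /\ ((b - c) %% 3)%Z <> 0 /\ ((a - c) %% 3)%Z <> 0.

Lemma ord3_ind (P : 'I_3 -> Prop) :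
  P (@Ordinal 3 0 isT) -> P (@Ordinal 3 1 isT) -> P (@Ordinal 3 2 isT) ->
  forall i, P i.
Proof.
move=> P0 P1 P2 [[|[|[|//]]] lt_i].
- by rewrite (bool_irrelevance lt_i isT).
- by rewrite (bool_irrelevance lt_i isT).
- by rewrite (bool_irrelevance lt_i isT).
Qed.

Lemma wact_good i f : wgood f -> wgood (wact i f).
Proof. by case: f => [[a b] c]; elim/ord3_ind: i; rewrite /wgood /=; lia. Qed.

Lemma wactK i f : wact i (wact i f) = f.
Proof.
case: f => [[a b] c]; elim/ord3_ind: i => //=.
by congr (_, _, _); lia.
Qed.

Lemma wact_braid i j f :
  wact i (wact j (wact i f)) = wact j (wact i (wact j f)).
Proof.
case: f => [[a b] c].
by elim/ord3_ind: i; elim/ord3_ind: j => //=; congr (_, _, _); lia.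
Qed.

Lemma wdesc_act i f : wgood f -> wdesc i (wact i f) = ~~ wdesc i f.
Proof. by case: f => [[a b] c]; elim/ord3_ind: i; rewrite /wgood /=; lia. Qed.

Definition wstart : window := (0, 1, 2).

(** A letter added on the left permutes positions, so this is the window of the inverse element;
    left descents of the word thereby become comparisons of neighbouring entries. *)
Definition win (s : seq 'I_3) : window := foldr wact wstart s.

Lemma win_good s : wgood (win s).
Proof. by elim: s => [|i s IH] //=; apply: wact_good. Qed.

Lemma win_rel s t : A2_rel s t -> win s = win t.
Proof.
elim=> [//|{}s {}t _ -> //|{}s {}t u _ -> _ -> //|p q i|p q i j].
  by rewrite /win !foldr_cat /= wactK.
by rewrite /win !foldr_cat /= wact_braid.
Qed.

Definition winW (w : W) : window := win (repr w).

Lemma winW_word s : winW (of_word s) = win s.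
Proof. exact/win_rel/repr_of_word. Qed.

Lemma winW_good w : wgood (winW w).
Proof. exact: win_good. Qed.

Lemma mul_of_word s t : (of_word s * of_word t)%g = of_word (s ++ t).
Proof. exact: Wmul_word. Qed.

Lemma gen_word i s : (gen i * of_word s)%g = of_word (i :: s).
Proof. exact: mul_of_word. Qed.

Lemma winW_gen i w : winW (gen i * w)%g = wact i (winW w).
Proof. by rewrite -(of_word_repr w) gen_word !winW_word. Qed.

(* [desc i w] says that [i] is a left descent of [w]. *)
Definition desc (i : 'I_3) (w : W) : bool := wdesc i (winW w).

Lemma genK i w : (gen i * (gen i * w))%g = w.
Proof.
rewrite -(of_word_repr w) !gen_word; apply/eqP/of_wordP.
exact: (A2_quad [::] (repr w) i).
Qed.

Lemma gen_braid i j w :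
  (gen i * (gen j * (gen i * w)) = gen j * (gen i * (gen j * w)))%g.
Proof.
rewrite -(of_word_repr w) !gen_word; apply/eqP/of_wordP.
exact: (A2_braid [::] (repr w) i j).
Qed.

Lemma desc_gen i w : desc i (gen i * w)%g = ~~ desc i w.
Proof. by rewrite /desc winW_gen wdesc_act //; apply: winW_good. Qed.

Ltac win_cases w :=
  rewrite /desc ?winW_gen; have := winW_good w; case: (winW w) => [[a b] c];
  rewrite /wgood.

(** Two descents put three consecutive entries of the window in decreasing order, so w is the top of
    its coset under the dihedral group on i and j. The claims are the descents met on the way
    down. *)
Lemma desc_pair i j w : i != j -> desc i w -> desc j w ->
  [/\ desc i (gen j * w)%g, desc j (gen i * (gen j * w))%g,
      ~~ desc i (gen j * (gen i * (gen j * w)))%g &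
      ~~ desc j (gen j * (gen i * (gen j * w)))%g].
Proof.
win_cases w.
by elim/ord3_ind: i; elim/ord3_ind: j => //= ? _ ? ?; split; lia.
Qed.

(** Three descents would mean a > b > c > a + 3. *)
Lemma desc_triple s t u w : s != t -> s != u -> t != u ->
  desc t w -> desc u w -> ~~ desc s w.
Proof.
win_cases w.
by elim/ord3_ind: s; elim/ord3_ind: t => //; elim/ord3_ind: u => //= *; lia.
Qed.

(** * Reduced words and length *)

(** Reducedness is defined from windows, not from [length], so that the exchange property can be
    proved first and the length deduced from it. *)
Fixpoint red (s : seq 'I_3) : bool :=
  if s is i :: t then ~~ desc i (of_word t) && red t else true.

Lemma of_word_rel s t : A2_rel s t -> of_word s = of_word t.
Proof. by move=> st; apply/eqP/of_wordP. Qed.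

Lemma desc1 i : ~~ desc i 1%g.
Proof.
by rewrite /desc (_ : 1%g = of_word [::]) // winW_word; elim/ord3_ind: i.
Qed.

(** If s = j s' with j != i, then i and j are both descents, hence i is one of s' and j one of what
    remains after exchanging i there. Two uses of the induction hypothesis give s = j i j u, and the
    braid relation moves i to the front. *)
Lemma red_exchange s i : red s -> desc i (of_word s) ->
  exists2 t, red t /\ size s = (size t).+1 & A2_rel s (i :: t).
Proof.
have [n le_sn] := ubnP (size s); elim: n => // n IHn in s le_sn i *.
case: s le_sn => [|j s] le_sn.
  by move=> _; have := negbTE (desc1 i); rewrite /desc winW_word => ->.
rewrite -gen_word /= => /andP[js red_s] is0.
have [->|neq_ij] := eqVneq i j; first by exists s; [split|exact: A2_refl].
have js0 : desc j (gen j * of_word s)%g by rewrite desc_gen.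
have [di dj ni nj] := desc_pair neq_ij is0 js0.
have neq_ji : j != i by rewrite eq_sym.
have [dj' _ _ _] := desc_pair neq_ji js0 is0.
rewrite genK in di dj ni nj.
have [t [red_t szt] st] := IHn s le_sn i red_s di.
have tE : of_word t = (gen i * of_word s)%g.
  by rewrite (of_word_rel st) -gen_word genK.
have [||u [red_u szu] tu] := IHn t _ j red_t; rewrite ?tE //.
  by move: le_sn; rewrite /= szt; lia.
have uE : of_word u = (gen j * (gen i * of_word s))%g.
  by rewrite -tE (of_word_rel tu) -gen_word genK.
exists [:: j, i & u] => /=.
  rewrite red_u uE ni -gen_word uE !andbT szt szu; split=> //.
  by rewrite gen_braid desc_gen dj'.
apply: A2_trans (A2_trans (A2_catl [:: j] st) (A2_catl [:: j; i] tu)) _.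
exact: (A2_braid [::] u j i).
Qed.

Lemma red_word s : exists2 t, red t & A2_rel s t /\ (size t <= size s)%N.
Proof.
elim: s => [|i s [t red_t [st le_ts]]]; first by exists [::] => //; split=> //;
  apply: A2_refl.
have it := A2_catl [:: i] st.
have [di|ndi] := boolP (desc i (of_word t)); last first.
  by exists (i :: t); rewrite /= ?ndi.
have [u [red_u szt] tu] := red_exchange red_t di.
exists u => //=; split; last by rewrite szt in le_ts; lia.
apply: A2_trans it _; apply: A2_trans (A2_catl [:: i] tu) _.
exact: (A2_quad [::] u i).
Qed.

Lemma red_size s t : red s -> red t -> of_word s = of_word t ->
  size s = size t.
Proof.
elim: s t => [|i s IH] t.
  case: t => [|i t] //= _ /andP[nit _] E.
  have := desc1 i; rewrite (_ : 1%g = of_word (i :: t)); last by rewrite -E.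
  by rewrite -gen_word desc_gen nit.
rewrite /= => /andP[nis red_s] red_t E.
have di : desc i (of_word t) by rewrite -E -gen_word desc_gen.
have [u [red_u ->] tu] := red_exchange red_t di; congr _.+1.
apply: IH => //.
by rewrite -(genK i (of_word s)) gen_word E (of_word_rel tu) -gen_word genK.
Qed.

Lemma length_red s : red s -> length (of_word s) = size s.
Proof.
move=> red_s; rewrite /length; case: ex_minnP => n /existsP[t /eqP tE] minn.
have [u red_u [/of_word_rel tu le_ut]] := red_word t.
apply/eqP; rewrite eqn_leq; apply/andP; split.
  by apply: minn; apply/existsP; exists (in_tuple s).
by rewrite (@red_size s u) // -?tu // -(size_tuple t).
Qed.

Lemma red_of w : exists2 s, red s & of_word s = w.
Proof.
have [s red_s [sE _]] := red_word (repr w); exists s => //.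
by rewrite -(of_word_rel sE) of_word_repr.
Qed.

Lemma length1 : length 1%g = 0%N.
Proof. exact: (@length_red [::]). Qed.

Lemma length_up i w : ~~ desc i w -> length (gen i * w)%g = (length w).+1.
Proof.
have [s red_s <-] := red_of w => ndi.
by rewrite gen_word !length_red //= ndi.
Qed.

Lemma length_down i w : desc i w -> length w = (length (gen i * w)%g).+1.
Proof. by move=> di; rewrite -[in LHS](genK i w) length_up // desc_gen di. Qed.

Lemma length_gen i w : (length w < length (gen i * w)%g)%N = ~~ desc i w.
Proof.
have [/length_down ->|/length_up ->] := boolP (desc i w); lia.
Qed.

Lemma W_ind (P : W -> Prop) :
  P 1%g -> (forall i w, ~~ desc i w -> P w -> P (gen i * w)%g) -> forall w, P w.
Proof.
move=> P1 PS w; have [s red_s <-] := red_of w.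
elim: s red_s => //= i s IH /andP[ndi red_s].
by rewrite -gen_word; apply: PS => //; apply: IH.
Qed.

Lemma no_desc w : (forall i, ~~ desc i w) -> w = 1%g.
Proof.
by elim/W_ind: w => // i w ndi _ /(_ i); rewrite desc_gen ndi.
Qed.

Lemma size_redword w : size (redword w) = length w.
Proof. by rewrite /redword; case/andP: (xchooseP (redword_subproof w)) => /eqP. Qed.

Lemma of_word_redword w : of_word (redword w) = w.
Proof. by rewrite /redword; case/andP: (xchooseP (redword_subproof w)) => _ /eqP. Qed.

Lemma length_word s : (length (of_word s) <= size s)%N.
Proof.
have [t red_t [/of_word_rel -> le_ts]] := red_word s.
by rewrite length_red.
Qed.

Lemma red_minimal s : size s = length (of_word s) -> red s.
Proof.
elim: s => //= i s IH; rewrite -gen_word; have := length_word s.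
have [/length_down ->|ndi] := boolP (desc i (of_word s)); first lia.
by rewrite (length_up ndi) => _ [/IH].
Qed.

Lemma red_redword w : red (redword w).
Proof. by apply: red_minimal; rewrite of_word_redword size_redword. Qed.

(* Matsumoto's theorem: operators satisfying the braid relations compose along
   a reduced word to a map depending only on the element. *)
Lemma matsumoto T (op : 'I_3 -> T -> T) (x : T) s t :
  (forall i j y, op i (op j (op i y)) = op j (op i (op j y))) ->
  red s -> red t -> of_word s = of_word t -> foldr op x s = foldr op x t.
Proof.
move=> opB; have [n le_sn] := ubnP (size s).
elim: n => // n IHn in s t le_sn *; move=> red_s red_t E.
have := red_size red_s red_t E.
case: s t le_sn red_s red_t E => [|i s] [|j t] //= le_sn.
move=> /andP[nis red_s] /andP[njt red_t] E szE.
have [eq_ij|neq_ij] := eqVneq i j.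
  rewrite eq_ij; congr op; apply: IHn => //.
  by rewrite -(genK j (of_word s)) gen_word -eq_ij E eq_ij -gen_word genK.
have di : desc i (of_word (i :: s)) by rewrite -gen_word desc_gen.
have dj : desc j (of_word (i :: s)) by rewrite E -gen_word desc_gen.
have [d1 d2 n1 n2] := desc_pair neq_ij di dj.
have neq_ji : j != i by rewrite eq_sym.
have [d3 _ _ _] := desc_pair neq_ji dj di.
set w := of_word (i :: s) in di dj d1 d2 n1 n2 d3 *.
have [u red_u uE] := red_of (gen j * (gen i * (gen j * w)))%g.
have sE : of_word s = (gen i * w)%g by rewrite /w -gen_word genK.
have tE : of_word t = (gen j * w)%g by rewrite /w E -gen_word genK.
have redji : red [:: j, i & u].
  rewrite /= red_u uE n1 -gen_word uE !andbT.
  by rewrite gen_braid genK desc_gen d3.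
have redij : red [:: i, j & u].
  rewrite /= red_u uE n2 -gen_word uE !andbT genK.
  by rewrite desc_gen d1.
rewrite (IHn s [:: j, i & u]) //; last first.
  by rewrite -!gen_word uE sE (gen_braid j i w) !genK.
rewrite (IHn t [:: i, j & u]) //= ?opB //; first by rewrite -ltnS -szE.
by rewrite -!gen_word uE tE !genK.
Qed.

(** * The Kazhdan-Lusztig basis *)

Lemma sum_subset (V : nmodType) (r D : seq W) (F : W -> V) :
  uniq r -> uniq D -> {subset r <= D} -> (forall z, z \notin r -> F z = 0) ->
  \sum_(z <- r) F z = \sum_(z <- D) F z.
Proof.
move=> Ur UD sub F0; rewrite [RHS](bigID (mem r)) /= [X in _ + X]big1 ?addr0 //.
rewrite -[RHS]big_filter; apply: perm_big; apply: uniq_perm; rewrite ?filter_uniq //.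
by move=> z; rewrite mem_filter andb_idr // => /sub.
Qed.

Lemma sum_count (V : nmodType) (r D : seq W) (F : W -> V) :
  uniq D -> {subset r <= D} ->
  \sum_(z <- D) F z *+ count_mem z r = \sum_(a <- r) F a.
Proof.
move=> UD; elim: r => [|a r IH] sub.
  by rewrite big_nil big1 // => z _; rewrite mulr0n.
rewrite big_cons -IH; last by move=> z zr; apply: sub; rewrite inE zr orbT.
under eq_bigr do rewrite /= mulrnDr.
rewrite big_split /= (bigD1_seq a) ?sub ?mem_head //= eqxx mulr1n.
by rewrite big1 ?addr0 // => z nz; rewrite eq_sym (negbTE nz) mulr0n.
Qed.

Lemma desc_pair_length i j w : i != j -> desc i w -> desc j w -> (2 < length w)%N.
Proof.
move=> neq di dj; have [d1 d2 _ _] := desc_pair neq di dj.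
by rewrite (length_down dj) (length_down d1) (length_down d2).
Qed.

Lemma pair_other s t u w : s != t -> s != u -> t != u -> desc t w -> desc u w ->
  ~~ desc s (gen t * w)%g.
Proof.
win_cases w.
by elim/ord3_ind: s; elim/ord3_ind: t => //; elim/ord3_ind: u => //= *; lia.
Qed.

Lemma pair_up s t u w : s != t -> s != u -> t != u -> desc t w -> desc u w ->
  ~~ desc t (gen s * w)%g.
Proof.
win_cases w.
by elim/ord3_ind: s; elim/ord3_ind: t => //; elim/ord3_ind: u => //= *; lia.
Qed.

Lemma pair_up2 s t u w : s != t -> s != u -> t != u -> desc t w -> desc u w ->
  desc s (gen t * (gen s * w))%g.
Proof.
win_cases w.
by elim/ord3_ind: s; elim/ord3_ind: t => //; elim/ord3_ind: u => //= *; lia.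
Qed.

Lemma pair_up3 i j w : i != j -> ~~ desc i w -> desc j w ->
  ~~ desc j (gen i * w)%g -> desc i (gen j * (gen i * w))%g.
Proof.
win_cases w.
by elim/ord3_ind: i; elim/ord3_ind: j => //= *; lia.
Qed.

(** * Kazhdan-Lusztig theory through the integer coefficients of v^k delta_w *)

Section KazhdanLusztig.
Variables (M : zmodType) (cf : M -> W -> int -> int) (supp : M -> seq W).
Variables (cmul : 'I_3 -> M -> M) (bar : M -> M).
Hypothesis cfP : forall g h, (forall w k, cf g w k = cf h w k) -> g = h.
Hypothesis cfD : forall g h w k, cf (g + h) w k = cf g w k + cf h w k.
Hypothesis supp_uniq : forall h, uniq (supp h).
Hypothesis supp_cf : forall h w k, cf h w k != 0 -> w \in supp h.
Hypothesis cf_cmul : forall i h y k, cf (cmul i h) y k =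
  cf h (gen i * y)%g k + cf h y (if desc i y then k + 1 else k - 1).
Hypothesis barD : forall g h, bar (g + h) = bar g + bar h.
Hypothesis bar_cmul : forall i h, bar (cmul i h) = cmul i (bar h).
Hypothesis bar_lead : forall h w k,
  (forall y l, (length w < length y)%N -> cf h y l = 0) ->
  cf (bar h) w k = cf h w (- k).

Variable B : W -> M.
Hypothesis barB : forall w, bar (B w) = B w.
Hypothesis cfB1 : forall w k, cf (B w) w k = (k == 0)%:R.
Hypothesis cfB0 : forall w y k, y != w -> k <= 0 -> cf (B w) y k = 0.

Let cf0 w k : cf 0 w k = 0.
Proof. by apply: (addrI (cf 0 w k)); rewrite -cfD !addr0. Qed.

Let cfN h w k : cf (- h) w k = - cf h w k.
Proof. by apply: (addrI (cf h w k)); rewrite -cfD !subrr cf0. Qed.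

Let cfMz h n w k : cf (h *~ n) w k = cf h w k * n.
Proof.
have cfMn m : cf (h *+ m) w k = cf h w k * m%:Z.
  elim: m => [|m IH]; first by rewrite mulr0n cf0 mulr0.
  by rewrite mulrS cfD IH intS mulrDr mulr1.
by case: n => n; rewrite ?NegzE ?mulrNz ?cfN -pmulrn cfMn ?mulrN.
Qed.

Let cf_sum I (r : seq I) (P : pred I) (F : I -> M) w k :
  cf (\sum_(i <- r | P i) F i) w k = \sum_(i <- r | P i) cf (F i) w k.
Proof. by apply: (big_morph (fun h => cf h w k)) => [g h|]; rewrite ?cfD ?cf0. Qed.

Let bar0 : bar 0 = 0.
Proof. by apply: (addrI (bar 0)); rewrite -barD !addr0. Qed.

Let barN h : bar (- h) = - bar h.
Proof. by apply: (addrI (bar h)); rewrite -barD !subrr bar0. Qed.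

Let barMz h n : bar (h *~ n) = bar h *~ n.
Proof.
have barMn m : bar (h *+ m) = bar h *+ m.
  by elim: m => [|m IH]; rewrite ?mulr0n ?bar0 // !mulrS barD IH.
by case: n => n; rewrite ?NegzE ?mulrNz ?barN -!pmulrn barMn.
Qed.

Let bar_sum I (r : seq I) (P : pred I) (F : I -> M) :
  bar (\sum_(i <- r | P i) F i) = \sum_(i <- r | P i) bar (F i).
Proof. exact: (big_morph bar barD bar0). Qed.

(** Descending induction on length: at an element above which h vanishes, [bar_lead] makes the
    coefficient symmetric under k -> -k, so vanishing for k <= 0 is vanishing. The set [Q] lets one
    argument serve both the triangularity of [B w] and equalities of elements. *)
Lemma bar_invariant_eq0 h (Q : W -> Prop) : bar h = h ->
  (forall y z, Q y -> (length y < length z)%N -> Q z) ->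
  (forall y k, Q y -> k <= 0 -> cf h y k = 0) ->
  forall y k, Q y -> cf h y k = 0.
Proof.
move=> hh Qup hQ; pose N := \max_(w <- supp h) length w.
have leN w k : (N < length w)%N -> cf h w k = 0.
  move=> ltN; apply/eqP/negP => /negP/supp_cf wh; move: ltN.
  by rewrite ltnNge /N (@leq_bigmax_seq _ (supp h) predT length w).
suff H n y k : Q y -> (N.+1 - length y <= n)%N -> cf h y k = 0.
  by move=> y k Qy; apply: (H (N.+1 - length y)%N).
elim: n => [|n IH] in y k *; first by move=> _ le0; apply: leN; lia.
move=> Qy le_n; have [k_le0|k_gt0] := leP k 0; first exact: hQ.
rewrite -hh bar_lead; first by apply: hQ => //; lia.
by move=> z l ltz; apply: IH; [apply: Qup ltz | lia].
Qed.

Lemma B_supp w y k : cf (B w) y k != 0 -> y = w \/ (length y < length w)%N.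
Proof.
move=> nz; have [->|nyw] := eqVneq y w; [by left | right].
rewrite ltnNge; apply: contra nz => le_wy; apply/eqP.
apply: (bar_invariant_eq0 (Q := fun z => z != w /\ (length w <= length z)%N)) => //.
  move=> u z [_ le1] lt1; split; last by lia.
  by apply: contraTneq lt1 => ->; lia.
by move=> u l [nu _]; apply: cfB0.
Qed.

(** In this normalisation the coefficient of v is the coefficient of q^((l(x) - l(z) - 1)/2) in
    P_(z,x), the mu-function of Kazhdan and Lusztig. *)
Let mu z x := cf (B x) z 1.

(** The difference of the two sides is bar-invariant. Multiplication by b_s turns the coefficient of
    v at z into a constant term when i is a descent of z; the sum removes exactly these, so only
    positive powers remain. *)
Lemma cmul_up i x : ~~ desc i x -> cmul i (B x) =
  B (gen i * x)%g + \sum_(z <- supp (B x) | desc i z) B z *~ mu z x.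
Proof.
move=> ndi; apply/eqP; rewrite -subr_eq0; apply/eqP; set D := _ - _.
apply: cfP => y k; rewrite cf0.
apply: (bar_invariant_eq0 (Q := fun _ => True)) => // [|{}y {}k _ k_le0].
  rewrite /D barD barN barD bar_cmul !barB bar_sum.
  by congr (_ - (_ + _)); apply: eq_bigr => z _; rewrite barMz barB.
rewrite /D cfD cfN cfD cf_cmul cf_sum.
have neqx z : desc i z -> z != x by apply: contraTneq => ->.
have giy : ((gen i * y)%g == x) = (y == (gen i * x)%g).
  by apply/eqP/eqP => [<-|->]; rewrite genK.
have cfBk w z : cf (B w) z k = ((z == w) && (k == 0))%:R.
  by have [->|ny] := eqVneq z w; rewrite ?cfB1 ?cfB0.
rewrite !cfBk giy opprD addrACA subrr add0r.
have -> : \sum_(z <- supp (B x) | desc i z) cf (B z *~ mu z x) y k =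
    if desc i y && (k == 0) then mu y x else 0.
  under eq_bigr do rewrite cfMz cfBk.
  have [k0|k0] := boolP (k == 0); last first.
    by rewrite andbF big1 // => z _; rewrite andbF mul0r.
  rewrite andbT big_mkcond /=.
  rewrite (@sum_subset _ _ (undup (y :: supp (B x)))) ?undup_uniq //; last first.
  - move=> z zx; have -> : mu z x = 0.
      by apply/eqP; apply: contraNT zx => /supp_cf.
    by rewrite mulr0 if_same.
  - by move=> z zx; rewrite mem_undup inE zx orbT.
  rewrite (bigD1_seq y) ?undup_uniq ?mem_undup ?mem_head //= eqxx mul1r.
  rewrite big1 ?addr0 // => z nz; case: ifP => // _.
  by rewrite eq_sym (negbTE nz) mul0r.
have [dy|ndy] /= := boolP (desc i y).
  have [->|k0] := eqVneq k 0; first by rewrite add0r subrr.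
  by rewrite subr0 cfB0 ?neqx //; lia.
rewrite subr0; have [->|ny] := eqVneq y x; first by rewrite cfB1; lia.
by rewrite cfB0 //; lia.
Qed.

(** Everything in the image of [cmul i] has this symmetry, and [B x] is such an image minus shorter
    [B z] that have i as a descent. *)
Lemma cf_desc i x y k : desc i x -> ~~ desc i y ->
  cf (B x) y k = cf (B x) (gen i * y)%g (k - 1).
Proof.
have [n] := ubnP (length x); elim: n => // n IH in x y k *.
rewrite ltnS => le_n dx ndy.
have ndix : ~~ desc i (gen i * x)%g by rewrite desc_gen dx.
have lt_ix := length_down dx.
have -> : B x = cmul i (B (gen i * x)%g) -
    \sum_(z <- supp (B (gen i * x)%g) | desc i z) B z *~ mu z (gen i * x)%g.
  by rewrite (cmul_up ndix) genK addrK.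
rewrite !cfD !cfN !cf_cmul genK desc_gen ndy (negbTE ndy) subrK !cf_sum.
rewrite [X in X - _]addrC; congr (_ - _); apply: eq_bigr => z dz.
rewrite !cfMz.
have [->|nz] := eqVneq (mu z (gen i * x)%g) 0; first by rewrite !mulr0.
congr (_ * _); apply: IH => //; have [zE|] := B_supp nz; last by lia.
by move: dz; rewrite zE desc_gen dx.
Qed.

(** By [cf_desc] the coefficient of v at z is the constant coefficient at t z, and x is the only
    place where [B x] has one. *)
Lemma mu_desc t z x : desc t x -> ~~ desc t z -> mu z x = ((gen t * z)%g == x)%:R.
Proof.
move=> dx ndz; rewrite /mu (cf_desc _ dx ndz) subrr.
by have [->|ne] := eqVneq (gen t * z)%g x; rewrite ?cfB1 ?cfB0.
Qed.

Lemma muN0 z x : mu z x != 0 -> z = x \/ (length z < length x)%N.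
Proof. exact: B_supp. Qed.

(* Specialisation at v = 1: [c i] stands for 1 + delta_i. *)
Variables (H : nzRingType) (c : 'I_3 -> H) (sp : M -> H).
Hypothesis c_sq : forall i, c i * c i = c i *+ 2.
Hypothesis spD : forall g h, sp (g + h) = sp g + sp h.
Hypothesis sp_cmul : forall i h, sp (cmul i h) = c i * sp h.

Let b x := sp (B x).

Let sp0 : sp 0 = 0.
Proof. by apply: (addrI (sp 0)); rewrite -spD !addr0. Qed.

Let spMz h n : sp (h *~ n) = sp h *~ n.
Proof.
have spN g : sp (- g) = - sp g.
  by apply: (addrI (sp g)); rewrite -spD !subrr sp0.
have spMn m : sp (h *+ m) = sp h *+ m.
  by elim: m => [|m IH]; rewrite ?mulr0n ?sp0 // !mulrS spD IH.
by case: n => n; rewrite ?NegzE ?mulrNz ?spN -!pmulrn spMn.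
Qed.

Let b_up i x : ~~ desc i x -> c i * b x =
  b (gen i * x)%g + \sum_(z <- supp (B x) | desc i z) b z *~ mu z x.
Proof.
move=> ndi; rewrite /b -sp_cmul cmul_up // spD; congr (_ + _).
by rewrite (big_morph sp spD sp0); apply: eq_bigr => z _; rewrite spMz.
Qed.

Lemma spB_desc i x : desc i x -> c i * b x = b x *+ 2.
Proof.
have [n] := ubnP (length x); elim: n => // n IH in x *; rewrite ltnS => le_n dx.
have ndix : ~~ desc i (gen i * x)%g by rewrite desc_gen dx.
have E : b x = c i * b (gen i * x)%g -
    \sum_(z <- supp (B (gen i * x)%g) | desc i z) b z *~ mu z (gen i * x)%g.
  by rewrite (b_up ndix) genK addrK.
rewrite [in LHS]E [in RHS]E mulrBr mulrA c_sq mulrnAl mulrnBl; congr (_ - _).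
rewrite mulr_sumr -sumrMnl; apply: eq_bigr => z dz.
have [->|nz] := eqVneq (mu z (gen i * x)%g) 0; first by rewrite !mulr0z mulr0 mul0rn.
rewrite mulrzAr IH ?mulrzAC -?pmulrn //; last first.
  have [zE|] := muN0 nz; first by move: dz; rewrite zE desc_gen dx.
  by rewrite (length_down dx) in le_n; lia.
by rewrite !pmulrn mulrzAC.
Qed.

Let b_up_seq i x (r : seq W) : ~~ desc i x -> all (desc i) r ->
  (forall z, desc i z -> mu z x = (count_mem z r)%:Z) ->
  c i * b x = b (gen i * x)%g + \sum_(a <- r) b a.
Proof.
move=> ndi /allP dr muE; rewrite b_up //; congr (_ + _).
have sub z : z \in r -> z \in supp (B x).
  move=> zr; apply: (@supp_cf _ _ 1); rewrite -/(mu z x) muE ?dr //.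
  by rewrite -has_pred1 has_count lt0n in zr; rewrite eqz_nat.
rewrite big_mkcond -(sum_count b (supp_uniq _) sub); apply: eq_bigr => z _.
case: ifPn => [/muE ->|ndz]; first by rewrite -pmulrn.
by rewrite (count_memPn _) // (contra (@dr z)).
Qed.

Let sum_mu p x : \sum_(a <- supp (B x)) (if a == p then mu a x else 0) = mu p x.
Proof.
have [px|px] := boolP (p \in supp (B x)).
  rewrite (bigD1_seq p) //= eqxx big1 ?addr0 // => a na.
  by rewrite (negbTE na).
rewrite big1_seq => [|a /andP[_ ax]].
  by apply/esym/eqP; apply: contraNT px => /supp_cf.
by case: eqP => // E; rewrite -E ax in px.
Qed.

(** There are no correction terms: a z with descent s lacks t or u, so by [mu_desc] it would be t w
    or u w, neither of which has the descent s. *)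
Lemma spB_theta s t u w : s != t -> s != u -> t != u -> desc t w -> desc u w ->
  c s * b w = b (gen s * w)%g.
Proof.
move=> st su tu dt du; have nds := desc_triple st su tu dt du.
have [ts us ut] : [/\ t != s, u != s & u != t].
  by rewrite ![_ == s]eq_sym [u == t]eq_sym.
rewrite (b_up_seq (r := [::]) nds) ?big_nil ?addr0 // => z dz /=.
have [dtz|ndtz] := boolP (desc t z); last first.
  rewrite (mu_desc dt ndtz); case: eqP => // E; move: dz; rewrite -(genK t z) E.
  by rewrite (negbTE (pair_other st su tu dt du)).
have ndu : ~~ desc u z by exact: desc_triple us ut st dz dtz.
rewrite (mu_desc du ndu); case: eqP => // E; move: dz; rewrite -(genK u z) E.
by rewrite (negbTE (pair_other su st ut du dt)).
Qed.

(** A correction z has the descent t. Without the descent s it must be w. With it, u is not a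
    descent of z, and the equation b_(s w) = b_s b_w, valid before specialisation, reduces the
    multiplicity to coefficients of [B w]. *)
Lemma spB_E s t u w : s != t -> s != u -> t != u -> desc t w -> desc u w ->
  c t * b (gen s * w)%g = b (gen t * (gen s * w))%g + b w +
    (if desc s (gen s * (gen u * w))%g && desc t (gen s * (gen u * w))%g
     then b (gen s * (gen u * w))%g else 0) +
    (if desc s (gen u * (gen t * w))%g && desc t (gen u * (gen t * w))%g
     then b (gen u * (gen t * w))%g else 0).
Proof.
move=> st su tu dt du; have nds := desc_triple st su tu dt du.
have [ts us ut] : [/\ t != s, u != s & u != t].
  by rewrite ![_ == s]eq_sym [u == t]eq_sym.
set z1 := (gen s * (gen u * w))%g; set z2 := (gen u * (gen t * w))%g.
pose r := w :: (if desc s z1 && desc t z1 then [:: z1] else [::]) ++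
               (if desc s z2 && desc t z2 then [:: z2] else [::]).
have bE : cmul s (B w) = B (gen s * w)%g.
  rewrite cmul_up // big_seq_cond big1 ?addr0 // => z /andP[_ dz].
  have [dtz|ndtz] := boolP (desc t z); last first.
    rewrite (mu_desc dt ndtz); case: eqP => // E; move: dz; rewrite -(genK t z) E.
    by rewrite (negbTE (pair_other st su tu dt du)).
  have ndu : ~~ desc u z by exact: desc_triple us ut st dz dtz.
  rewrite (mu_desc du ndu); case: eqP => // E; move: dz; rewrite -(genK u z) E.
  by rewrite (negbTE (pair_other su st ut du dt)).
rewrite (b_up_seq (r := r)).
- rewrite /r big_cons big_cat /= !addrA.
  by do 2![case: ifP => _; rewrite ?big_seq1 ?big_nil].
- exact: pair_up st su tu dt du.
- rewrite /r /= dt all_cat /=.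
  by apply/andP; split; case: ifPn => //= /andP[_ ->].
move=> z dz.
have cE (y : W) : count_mem z (if desc s y && desc t y then [:: y] else [::]) =
    (desc s z && (y == z)) :> nat.
  have [->|ny] := eqVneq y z; last by case: ifP; rewrite /= ?(negbTE ny) andbF.
  by rewrite dz !andbT; case: ifP; rewrite /= ?eqxx.
rewrite /r /= count_cat !cE.
have [dsz|ndsz] /= := boolP (desc s z); last first.
  have dsw : desc s (gen s * w)%g by rewrite desc_gen.
  rewrite (mu_desc dsw ndsz) addn0 natz; congr Posz; rewrite addn0.
  congr nat_of_bool.
  by rewrite eq_sym; apply/eqP/eqP => [E|->//]; rewrite -(genK s z) -E genK.
have nduz : ~~ desc u z by exact: desc_triple us ut st dsz dz.
have -> : (w == z) = false by apply: contraNF nds => /eqP ->.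
(* As s is a descent of z, the coefficient of v at z is that of v at s z plus that of v^2 at z, both
   in [B w]. The first detects z = s u w; the second, passed on to u z by [cf_desc], detects z = u t
   w. *)
rewrite /mu -bE cf_cmul dsz (_ : 1 + 1 = 2) //.
have nduz' : ~~ desc u (gen s * z)%g.
  exact: pair_other us ut st dsz dz.
rewrite -/(mu _ _) (mu_desc du nduz') (cf_desc _ du nduz) (_ : 2 - 1 = 1) //.
have ndtuz : ~~ desc t (gen u * z)%g.
  exact: pair_up ut us ts dz dsz.
rewrite -/(mu _ _) (mu_desc dt ndtuz) add0n.
have -> : ((gen u * (gen s * z))%g == w) = (z1 == z).
  by rewrite /z1; apply/eqP/eqP => [<-|<-]; rewrite !genK.
have -> : ((gen t * (gen u * z))%g == w) = (z2 == z).
  by rewrite /z2; apply/eqP/eqP => [<-|<-]; rewrite !genK.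
by rewrite PoszD; congr (_ + _); case: eqP.
Qed.

(** An element with two descents has length at least 3, so it is too long to be a correction; every
    other candidate lacks the descent j and is decided by [mu_desc]. *)
Lemma spB_short i j x : i != j -> ~~ desc i x -> desc j x -> (length x <= 3)%N ->
  c i * b x = b (gen i * x)%g +
    (if desc i (gen j * x)%g then b (gen j * x)%g else 0).
Proof.
move=> neq ndi dj le3.
rewrite (b_up_seq (r := if desc i (gen j * x)%g then [:: (gen j * x)%g] else [::])) //.
- by case: ifP; rewrite ?big_seq1 ?big_nil.
- by case: ifP => //= ->.
move=> z dz; have [djz|ndj] := boolP (desc j z).
  have lt2 := desc_pair_length neq dz djz.
  rewrite (_ : count_mem _ _ = 0%N); last first.
    apply/count_memPn; case: ifP => // d; rewrite inE; apply: contraL djz => /eqP->.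
    by rewrite desc_gen dj.
  apply/eqP/negP => /negP /muN0[zx|]; first by rewrite -zx dz in ndi.
  by lia.
rewrite (mu_desc dj ndj).
have -> : ((gen j * z)%g == x) = ((gen j * x)%g == z).
  by apply/eqP/eqP => [<-|<-]; rewrite genK.
have [E|ne] := eqVneq; first by rewrite E dz /= eqxx.
by case: ifP; rewrite //= (negbTE ne).
Qed.

Lemma spB_gen i : c i * b 1%g = b (gen i).
Proof.
rewrite (b_up_seq (r := [::]) (desc1 i)) // ?big_nil ?addr0 ?mulg1 // => z dz.
apply/eqP/negP => /negP/muN0[zE|]; last by rewrite length1.
by move: dz; rewrite zE; apply/negP/desc1.
Qed.

(** The corrections in c_i b_x have both descents i and j, and for these mu(z, x) = [z = j x2] +
    mu(z, x2), which is their multiplicity in c_j b_(x2). The only further term of c_j b_(x2) is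
    b_y. So the values mu(z, x2) need not be known. *)
Lemma spB_wall i j k y : i != j -> i != k -> j != k ->
  let x2 := (gen i * y)%g in let x1 := (gen k * x2)%g in
  let x := (gen j * x1)%g in
  ~~ desc i y -> desc j y -> ~~ desc k y ->
  ~~ desc j x2 -> ~~ desc k x2 -> ~~ desc i x1 -> ~~ desc j x1 -> ~~ desc i x ->
  c i * b x = b (gen i * x)%g + c j * b x2 - b y.
Proof.
move=> ij ik jk x2 x1 x niy djy nky nj2 nk2 ni1 nj1 nix.
have di2 : desc i x2 by rewrite desc_gen.
have dk1 : desc k x1 by rewrite desc_gen.
have djx : desc j x by rewrite desc_gen.
have ji : j != i by rewrite eq_sym.
have ki : k != i by rewrite eq_sym.
have kj : k != j by rewrite eq_sym.
have mu_jz z : desc j z -> ~~ desc i z -> mu z x2 = (z == y)%:R.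
  move=> djz niz; rewrite (mu_desc di2 niz); congr (nat_of_bool _)%:R.
  by apply/eqP/eqP => [E|->//]; rewrite -(genK i z) E genK.
have mu_iz z : desc i z -> ~~ desc j z -> mu z x = 0.
  move=> diz njz; rewrite (mu_desc djx njz); case: eqP => // E.
  by move: diz; rewrite -(genK j z) E genK (negbTE ni1).
have mu_ijz z : desc i z -> desc j z -> mu z x = (z == (gen j * x2)%g)%:R + mu z x2.
  move=> diz djz; have nkz := desc_triple ki kj ij diz djz.
  have nkjz : ~~ desc k (gen j * z)%g by apply: pair_other kj ki ji djz diz.
  have nikz : ~~ desc i (gen k * z)%g by apply: pair_up ki kj ij diz djz.
  have njkz : ~~ desc j (gen k * z)%g by apply: pair_up kj ki ji djz diz.
  have kikz : desc k (gen i * (gen k * z))%g by apply: pair_up2 ki kj ij diz djz.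
  have xE : B x = cmul j (B x1) - \sum_(a <- supp (B x1) | desc j a) B a *~ mu a x1.
    by rewrite cmul_up // addrK.
  have x1E : B x1 = cmul k (B x2) - \sum_(a <- supp (B x2) | desc k a) B a *~ mu a x2.
    by rewrite cmul_up // addrK.
  (* The corrections in [xE] vanish at z: such an a has the descent j, but a nonzero product forces
     a = k z if k is a descent of a, and a = x2 otherwise; neither has the descent j. *)
  rewrite {1}/mu xE cfD cfN cf_cmul djz cf_sum big1 ?subr0 => [|a da]; last first.
    rewrite cfMz -/(mu z a); have [dka|nka] := boolP (desc k a).
      rewrite (mu_desc dka nkz); case: eqP => [E|_]; last by rewrite mul0r.
      by move: da; rewrite -E (negbTE njkz).
    rewrite (mu_desc dk1 nka); case: eqP => [E|_]; last by rewrite mulr0.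
    by move: da; rewrite -(genK k a) E genK (negbTE nj2).
  rewrite -/(mu _ _) (mu_desc dk1 nkjz); congr (_ + _).
    congr (nat_of_bool _)%:R; apply/eqP/eqP => [E|->]; last by rewrite genK.
    by rewrite -(genK j z); congr (_ * _)%g; rewrite -(genK k (gen j * z)%g) E genK.
  rewrite (cf_desc _ dk1 nkz) x1E cfD cfN cf_cmul desc_gen nkz genK.
  rewrite (_ : (1 + 1 : int) - 1 = 1) // cf_sum.
  rewrite (cf_desc _ di2 nikz) (_ : (1 + 1 : int) - 1 = 1) // -addrA.
  rewrite -/(mu z x2) -/(mu (gen i * (gen k * z))%g x2).
  (* Beside mu(z, x2) there remain mu(i k z, x2) and the corrections of [x1E]; by [mu_desc] the only
     surviving correction is a = i k z, with the same value. *)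
  rewrite [X in _ + X](_ : _ = 0) ?addr0 //; apply/eqP; rewrite subr_eq0; apply/eqP.
  rewrite -sum_mu [RHS]big_mkcond /=; apply: eq_bigr => a _.
  have [dka|nka] := boolP (desc k a); last first.
    by case: eqP => // E; rewrite E kikz in nka.
  rewrite cfMz -/(mu _ a); have [->|nz] := eqVneq (mu a x2) 0.
    by rewrite mulr0 if_same.
  have dia : desc i a.
    apply: contraNT nz => nia; rewrite (mu_desc di2 nia).
    have [E|//] := eqVneq (gen i * a)%g x2.
    by move: dka; rewrite -(genK i a) E genK (negbTE nky).
  rewrite (mu_desc dia nikz) (eq_sym _ a).
  by case: (a == _); rewrite ?mul1r ?mul0r.
have mu0 z w : z \notin supp (B w) -> mu z w = 0.
  by move=> zw; apply/eqP; apply: contraNT zw => /supp_cf.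
pose D := undup (supp (B x) ++ supp (B x2) ++ [:: (gen j * x2)%g; y]).
have UD : uniq D by apply: undup_uniq.
have bD w : w \in D -> b w = \sum_(z <- D) b z *~ (z == w)%:R.
  move=> wD; rewrite (bigD1_seq w) //= eqxx big1 ?addr0 // => z nz.
  by rewrite (negbTE nz).
have niy' : desc i (gen j * x2)%g.
  by rewrite /x2; apply: pair_up3.
apply/eqP; rewrite eq_sym subr_eq eq_sym; apply/eqP.
rewrite (b_up nix) (b_up nj2) -!addrA; congr (_ + _).
rewrite (big_mkcond (desc i)) (big_mkcond (desc j)) /=.
rewrite (@sum_subset _ _ D) //; first last.
- by move=> z /mu0->; rewrite mulr0z if_same.
- by move=> z zx; rewrite mem_undup mem_cat zx.
rewrite (@sum_subset _ (supp (B x2)) D) //; first last.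
- by move=> z /mu0->; rewrite mulr0z if_same.
- by move=> z zx; rewrite mem_undup !mem_cat zx orbT.
rewrite (bD (gen j * x2)%g) ?mem_undup ?mem_cat ?inE ?eqxx ?orbT //.
rewrite (bD y) ?mem_undup ?mem_cat ?inE ?eqxx ?orbT //.
rewrite -!big_split /=; apply: eq_bigr => z _.
have [djz|njz] := boolP (desc j z); last first.
  have -> : (z == y) = false by apply: contraNF njz => /eqP->.
  have -> : (z == (gen j * x2)%g) = false.
    by apply: contraNF njz => /eqP->; rewrite desc_gen.
  rewrite !mulr0z !addr0; case: ifP => // diz; by rewrite mu_iz // mulr0z.
have [diz|niz] := boolP (desc i z).
  have -> : (z == y) = false by apply: contraNF niy => /eqP<-.
  by rewrite mulr0z addr0 mu_ijz // mulrzDr.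
have -> : (z == (gen j * x2)%g) = false by apply: contraNF niz => /eqP->.
by rewrite mu_jz // mulr0z !add0r.
Qed.

End KazhdanLusztig.

(** * The generic Hecke algebra *)

Section SupportSums.
Variables (G : choiceType) (S V : zmodType).
Variable F : G -> S -> V.
Hypothesis F0 : forall x, F x 0 = 0.
Hypothesis FD : forall x, {morph F x : a b / a + b}.

Lemma supp_sumw (d : {fset G}) (h : {malg S[G]}) : (msupp h `<=` d)%fset ->
  \sum_(x <- msupp h) F x h@_x = \sum_(x <- d) F x h@_x.
Proof.
by move=> le_hd; apply/big_fset_incl => // x _ /mcoeff_outdom ->.
Qed.

Lemma supp_sumD (g h : {malg S[G]}) :
  \sum_(x <- msupp (g + h)) F x (g + h)@_x =
  \sum_(x <- msupp g) F x g@_x + \sum_(x <- msupp h) F x h@_x.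
Proof.
rewrite (supp_sumw (msuppD_le g h)) (supp_sumw (fsubsetUl _ (msupp h))).
rewrite (supp_sumw (fsubsetUr (msupp g) _)) -big_split /=.
by apply: eq_bigr => x _; rewrite mcoeffD FD.
Qed.

Lemma supp_sumU (c : S) x : \sum_(y <- msupp << c *g x >>) F y << c *g x >>@_y = F x c.
Proof. by rewrite (supp_sumw msuppU_le) big_seq_fset1 mcoeffUU. Qed.

End SupportSums.

Lemma laurentUU (a b : int) (x y : vexp) :
  (<< a *g x >> : laurent) * (<< b *g y >> : laurent) = << a * b *g (x * y)%g >>.
Proof. exact: gmulUU. Qed.

Lemma vexpM (x y : int) : ((x : vexp) * (y : vexp))%g = x + y.
Proof. by []. Qed.

Lemma mcoeff_mulr_vpow (a : laurent) (j k : int) :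
  (a * vpow j)@_(k : vexp) = a@_(k - j : vexp).
Proof.
rewrite [in LHS](monalgE a) /vpow mulr_suml raddf_sum /=.
rewrite [in RHS](monalgE a) raddf_sum /=; apply: eq_bigr => x _.
rewrite laurentUU !mcoeffU mulr1; congr (_ *+ (_ : bool)).
rewrite vexpM; apply/eqP/eqP => [<-|->]; lia.
Qed.

Lemma mcoeff_mull_vpow (a : laurent) (j k : int) :
  (vpow j * a)@_(k : vexp) = a@_(k - j : vexp).
Proof.
rewrite [in LHS](monalgE a) /vpow mulr_sumr raddf_sum /=.
rewrite [in RHS](monalgE a) raddf_sum /=; apply: eq_bigr => x _.
rewrite laurentUU !mcoeffU mul1r; congr (_ *+ (_ : bool)).
rewrite vexpM; apply/eqP/eqP => [<-|->]; lia.
Qed.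

Lemma vpowC (a : laurent) (j : int) : vpow j * a = a * vpow j.
Proof.
by apply/malgP => k; rewrite (mcoeff_mulr_vpow a j k) (mcoeff_mull_vpow a j k).
Qed.

Lemma mcoeff_laurent_bar (a : laurent) (k : int) :
  (laurent_bar a)@_(k : vexp) = a@_(- k : vexp).
Proof.
rewrite /laurent_bar raddf_sum /= [in RHS](monalgE a) raddf_sum /=.
apply: eq_bigr => x _; rewrite mcoeffZ /vpow !mcoeffU mulrnAr mulr1; congr (_ *+ (_ : bool)).
by apply/eqP/eqP => [<-|->]; lia.
Qed.

Lemma laurent_barD (a b : laurent) :
  laurent_bar (a + b) = laurent_bar a + laurent_bar b.
Proof.
by apply/malgP => k; rewrite mcoeffD !(mcoeff_laurent_bar _ k) mcoeffD.
Qed.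

Lemma laurent_bar0 : laurent_bar 0 = 0.
Proof. by apply/malgP => k; rewrite (mcoeff_laurent_bar _ k) !mcoeff0. Qed.

Lemma laurent_barM (a : laurent) (j : int) :
  laurent_bar (a * vpow j) = laurent_bar a * vpow (- j).
Proof.
apply/malgP => k; rewrite (mcoeff_laurent_bar _ k) (mcoeff_mulr_vpow _ _ k).
rewrite (mcoeff_mulr_vpow _ _ (- k)) (mcoeff_laurent_bar _ (k - - j)).
by congr (_ @_ _); lia.
Qed.

Lemma vpow0 : vpow 0 = 1.
Proof. by []. Qed.

Definition cf (h : genHecke) (w : W) (k : int) : int := h@_w@_(k : vexp).

Lemma cfP (g h : genHecke) : (forall w k, cf g w k = cf h w k) -> g = h.
Proof. by move=> E; apply/malgP => w; apply/malgP => k; apply: E. Qed.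

Lemma cfD g h w k : cf (g + h) w k = cf g w k + cf h w k.
Proof. by rewrite /cf !mcoeffD. Qed.

Lemma cfN h w k : cf (- h) w k = - cf h w k.
Proof. by rewrite /cf !mcoeffN. Qed.

Lemma cf0 w k : cf 0 w k = 0.
Proof. by rewrite /cf !mcoeff0. Qed.

Lemma lmul_genE i (h : genHecke) y :
  (lmul_gen i h)@_y = h@_(gen i * y)%g +
    (if desc i y then h@_y * (vpow (-1) - vpow 1) else 0).
Proof.
have giP (w : W) : ((gen i * w)%g == y) = (w == (gen i * y)%g).
  by apply/eqP/eqP => [<-|->]; rewrite genK.
rewrite /lmul_gen raddf_sum /= [h in h@_(gen i * y)%g](monalgE h).
rewrite raddf_sum /=.
rewrite (_ : (if _ then _ else _) = \sum_(w <- msupp h)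
    (if desc i y then h@_w * (vpow (-1) - vpow 1) else 0) *+ (w == y)); last first.
  case: (desc i y); last by rewrite big1 // => w _; rewrite mul0rn.
  rewrite [h in h@_y](monalgE h) raddf_sum /= mulr_suml; apply: eq_bigr => w _.
  by rewrite mcoeffU mulrnAl.
rewrite -big_split /=; apply: eq_bigr => w _.
rewrite length_gen mcoeffZ mcoeffU -giP; case: ifPn => [nd|/negbNE d].
  rewrite /delta mcoeffU mulrnAr mulr1 -[LHS]addr0; congr (_ + _).
  by case: eqP => [<-|]; rewrite ?(negbTE nd) ?mul0rn // mulr0n.
rewrite /delta mcoeffD mcoeffZ !mcoeffU mulrDr !mulrnAr !mulr1.
by congr (_ + _); case: eqP => [<-|]; rewrite ?d // !mulr0n.
Qed.

Lemma cf_delta w y k : cf (delta w) y k = ((w == y) && (k == 0))%:R.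
Proof.
rewrite /cf /delta mcoeffU; case: eqP => _; last exact: mcoeff0.
by rewrite mulr1n -vpow0 /vpow /gdelta mcoeffU eq_sym.
Qed.

#[local] Opaque vpow.

Lemma cf_lmul i h y k : cf (lmul_gen i h) y k = cf h (gen i * y)%g k +
  (if desc i y then cf h y (k + 1) - cf h y (k - 1) else 0).
Proof.
rewrite /cf lmul_genE mcoeffD; congr (_ + _); case: (desc i y); last exact: mcoeff0.
rewrite mulrBr mcoeffB (mcoeff_mulr_vpow h@_y (-1) k).
by rewrite (mcoeff_mulr_vpow h@_y 1 k) opprK.
Qed.

(* Sealed: otherwise failing unifications unfold the Laurent monomials. *)
Fact vshift_key : unit. Proof. by []. Qed.
Definition vshift (j : int) (h : genHecke) : genHecke :=
  locked_with vshift_key (vpow j *: h).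

Lemma vshiftE j h : vshift j h = vpow j *: h.
Proof. by rewrite /vshift unlock. Qed.

Lemma cf_vshift j h w k : cf (vshift j h) w k = cf h w (k - j).
Proof. by rewrite vshiftE /cf mcoeffZ (mcoeff_mull_vpow _ j k). Qed.

Lemma lmul_genVE i h : lmul_genV i h = lmul_gen i h + (vshift 1 h - vshift (-1) h).
Proof. by rewrite /lmul_genV scalerBl !vshiftE. Qed.

(* Left multiplication by b_s = delta_s + v, where s is the generator [i]. *)
Definition cmul (i : 'I_3) (h : genHecke) : genHecke := lmul_gen i h + vshift 1 h.

Lemma cf_cmul i h y k : cf (cmul i h) y k =
  cf h (gen i * y)%g k + cf h y (if desc i y then k + 1 else k - 1).
Proof.
by rewrite /cmul cfD cf_lmul cf_vshift; case: (desc i y); rewrite ?addr0 // addrA subrK.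
Qed.

Lemma lmul_genV_cmul i h : lmul_genV i h = cmul i h - vshift (-1) h.
Proof. by rewrite lmul_genVE addrA. Qed.

Lemma cf_lmulV i h y k : cf (lmul_genV i h) y k = cf h (gen i * y)%g k +
  (if desc i y then 0 else cf h y (k - 1) - cf h y (k + 1)).
Proof.
rewrite lmul_genV_cmul cfD cfN cf_cmul cf_vshift opprK -addrA.
by case: (desc i y); rewrite ?subrr.
Qed.

Lemma desc_min i j y : i != j -> ~~ desc i y -> ~~ desc j y ->
  [/\ desc j (gen i * y)%g = false, desc i (gen j * (gen i * y))%g = false &
      desc j (gen i * (gen j * (gen i * y)))%g].
Proof.
win_cases y.
by elim/ord3_ind: i; elim/ord3_ind: j => //= ? _ ? ?; split; lia.
Qed.

Lemma coset_min i j y : exists y0, [/\ ~~ desc i y0, ~~ desc j y0 &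
  [\/ y = y0, y = (gen i * y0)%g, y = (gen j * y0)%g |
     [\/ y = (gen i * (gen j * y0))%g, y = (gen j * (gen i * y0))%g |
         y = (gen i * (gen j * (gen i * y0)))%g]]].
Proof.
have [n] := ubnP (length y); elim: n => // n IH in y *; rewrite ltnS => le_yn.
have [di|ni] := boolP (desc i y).
  have [|y0 [n1 n2 yE]] := IH (gen i * y)%g.
    by rewrite (length_down di) in le_yn.
  exists y0; split => //; rewrite -(genK i y).
  case: yE => [|||[||]] ->; rewrite ?genK.
  - by constructor 2.
  - by constructor 1.
  - by constructor 4; constructor 1.
  - by constructor 3.
  - by constructor 4; constructor 3.
  - by constructor 4; constructor 2.
have [dj|nj] := boolP (desc j y).
  have [|y0 [n1 n2 yE]] := IH (gen j * y)%g.
    by rewrite (length_down dj) in le_yn.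
  exists y0; split => //; rewrite -(genK j y).
  case: yE => [|||[||]] ->; rewrite ?genK.
  - by constructor 3.
  - by constructor 4; constructor 2.
  - by constructor 1.
  - by constructor 4; constructor 3; rewrite gen_braid.
  - by constructor 2.
  - by constructor 4; constructor 1; rewrite gen_braid genK.
by exists y; split => //; constructor 1.
Qed.

#[local] Opaque vpow vshift lmul_gen lmul_genV cf.
(** The inverse of delta_s acting on coefficient functions, so that its braid relation is an
    identity between integers. *)
Definition vop (i : 'I_3) (F : W -> int -> int) (y : W) (k : int) : int :=
  F (gen i * y)%g k + (if desc i y then 0 else F y (k - 1) - F y (k + 1)).

(** Both sides involve only the dihedral coset of y, whose six elements have known descents relative
    to the minimal one. *)
Lemma vop_braid i j F y k : vop i (vop j (vop i F)) y k = vop j (vop i (vop j F)) y k.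
Proof.
have [->//|neq] := eqVneq i j; have neq' : j != i by rewrite eq_sym.
have [y0 [n1 n2 yE]] := coset_min i j y.
have [d1 d2 d3] := desc_min neq n1 n2; have [d4 d5 d6] := desc_min neq' n2 n1.
rewrite gen_braid in d6.
have g4 : (gen j * (gen i * (gen j * (gen i * y0))) = gen i * (gen j * y0))%g.
  by rewrite gen_braid genK.
rewrite /vop.
case: yE => [|||[||]] {y}->; rewrite ?genK ?(gen_braid j i y0) ?genK ?g4 ?genK;
  rewrite ?(d1, d2, d3, d4, d5, d6) ?desc_gen;
  rewrite ?(d1, d2, d3, d4, d5, d6) ?(negbTE n1, negbTE n2) /= ?(addrK, subrK); lia.
Qed.

Lemma cf_lmulVE i h : cf (lmul_genV i h) = vop i (cf h).
Proof. by apply/funext => y; apply/funext => k; rewrite cf_lmulV. Qed.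

Lemma lmul_genV_braid i j h :
  lmul_genV i (lmul_genV j (lmul_genV i h)) =
  lmul_genV j (lmul_genV i (lmul_genV j h)).
Proof.
have E a b c : cf (lmul_genV a (lmul_genV b (lmul_genV c h))) =
    vop a (vop b (vop c (cf h))).
  by rewrite (cf_lmulVE a) (cf_lmulVE b) (cf_lmulVE c).
apply: cfP => y k; have := vop_braid i j (cf h) y k.
by rewrite -(E i j i) -(E j i j).
Qed.

Lemma foldr_lmulV s t : red s -> red t -> of_word s = of_word t ->
  foldr lmul_genV (delta 1%g) s = foldr lmul_genV (delta 1%g) t.
Proof. exact: (matsumoto _ lmul_genV_braid). Qed.

Lemma bar_delta_gen i w : ~~ desc i w ->
  bar_delta (gen i * w)%g = lmul_genV i (bar_delta w).
Proof.
move=> ndi; rewrite /bar_delta.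
rewrite -[RHS]/(foldr lmul_genV (delta 1%g) (i :: redword w)).
apply: foldr_lmulV; first exact: red_redword.
  by rewrite /= of_word_redword ndi red_redword.
by rewrite of_word_redword -gen_word of_word_redword.
Qed.

Lemma bar_delta1 : bar_delta 1%g = delta 1%g.
Proof.
rewrite /bar_delta; have := size_redword 1%g; rewrite length1.
by case: (redword 1%g).
Qed.

(** Triangularity with respect to length takes the place of the Bruhat order. *)
Lemma bar_delta_tri w : (forall k, cf (bar_delta w) w k = (k == 0)%:R) /\
  forall y k, (length w <= length y)%N -> y != w -> cf (bar_delta w) y k = 0.
Proof.
elim/W_ind: w => [|i w ndi [IH1 IH2]].
  rewrite bar_delta1; split=> [k|y k _ ny]; rewrite cf_delta.
    by rewrite eqxx.
  by rewrite eq_sym (negbTE ny).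
rewrite bar_delta_gen //; split=> [k|y k].
  by rewrite cf_lmulV genK desc_gen ndi /= addr0 IH1.
rewrite length_up // => le_wy ny.
have ny' : (gen i * y)%g != w.
  by apply: contraNneq ny => <-; rewrite genK.
have nyw : y != w by apply: contraTneq le_wy => ->; rewrite ltnn.
rewrite cf_lmulV (IH2 _ _ _ ny') ?add0r; last first.
  by have [/length_down|/length_up] := boolP (desc i y); lia.
by case: (desc i y) => //; rewrite !IH2 ?subr0 // ltnW.
Qed.

#[local] Transparent vpow vshift lmul_gen lmul_genV cf.

Lemma barD g h : bar (g + h) = bar g + bar h.
Proof.
apply: (supp_sumD (F := fun w (a : laurent) => laurent_bar a *: bar_delta w)).
  by move=> w; rewrite laurent_bar0 scale0r.
by move=> w a b; rewrite laurent_barD scalerDl.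
Qed.

Lemma barU (a : laurent) w : bar << a *g w >> = laurent_bar a *: bar_delta w.
Proof.
apply: (supp_sumU (F := fun w (a : laurent) => laurent_bar a *: bar_delta w)).
by move=> y; rewrite laurent_bar0 scale0r.
Qed.

Lemma genHecke_ind (P : genHecke -> Prop) : P 0 ->
  (forall g h, P g -> P h -> P (g + h)) -> (forall a w, P << a *g w >>) ->
  forall h, P h.
Proof.
move=> P0 PD PU h; rewrite (monalgE h).
by apply: (big_ind P) => // w _; apply: PU.
Qed.

Lemma bar0 : bar 0 = 0.
Proof. by apply: (addIr (bar 0)); rewrite -barD add0r [RHS]add0r. Qed.

Lemma vshiftD j g h : vshift j (g + h) = vshift j g + vshift j h.
Proof. by rewrite !vshiftE; exact: scalerDr. Qed.

Lemma vshiftZ j (a : laurent) h : vshift j (a *: h) = a *: vshift j h.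
Proof. by rewrite !vshiftE !scalerA vpowC. Qed.

Lemma vshiftU j (a : laurent) w : vshift j << a *g w >> = << vpow j * a *g w >>.
Proof. by rewrite vshiftE; apply/malgP => y; rewrite mcoeffZ !mcoeffU mulrnAr. Qed.

Lemma additive_ext (f g : genHecke -> genHecke) :
  {morph f : x y / x + y} -> {morph g : x y / x + y} ->
  (forall a w, f << a *g w >> = g << a *g w >>) -> f =1 g.
Proof.
move=> fD gD fg; elim/genHecke_ind => [|x y IHx IHy|a w]; last exact: fg.
  have f0 (q : genHecke -> genHecke) : {morph q : x y / x + y} -> q 0 = 0.
    by move=> qD; apply: (addIr (q 0)); rewrite -qD !add0r.
  by rewrite !f0.
by rewrite fD gD IHx IHy.
Qed.

Lemma barN h : bar (- h) = - bar h.
Proof.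
by apply: (addrI (bar h)); apply: etrans (esym (barD _ _)) _; rewrite !subrr bar0.
Qed.

Lemma bar_vshift j h : bar (vshift j h) = vshift (- j) (bar h).
Proof.
apply: (@additive_ext (fun h => bar (vshift j h)) (fun h => vshift (- j) (bar h))).
- by move=> x y; apply: etrans (congr1 bar (vshiftD j x y)) (barD _ _).
- by move=> x y; apply: etrans (congr1 _ (barD x y)) (vshiftD _ _ _).
move=> a w; apply: etrans (congr1 bar (vshiftU j a w)) _.
apply: etrans (barU _ _) _; apply: esym; apply: etrans (congr1 _ (barU a w)) _.
rewrite vshiftE; apply: etrans (scalerA _ _ _) _.
apply: (congr1 ( *:%R^~ (bar_delta w))).
apply: etrans (vpowC _ _) _; apply: esym.
by apply: etrans (congr1 _ (vpowC _ _)) _; apply: laurent_barM.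
Qed.

Definition lmul_delta i w : genHecke :=
  if (length w < length (gen i * w)%g)%N then delta (gen i * w)%g
  else delta (gen i * w)%g + (vpow (-1) - vpow 1) *: delta w.

Lemma lmul_genD i g h : lmul_gen i (g + h) = lmul_gen i g + lmul_gen i h.
Proof.
apply: (supp_sumD (F := fun w (a : laurent) => a *: lmul_delta i w)).
  by move=> w; apply: scale0r.
by move=> w a b; apply: scalerDl.
Qed.

Lemma lmul_genZ i (a : laurent) h : lmul_gen i (a *: h) = a *: lmul_gen i h.
Proof.
apply: etrans (supp_sumw (F := fun w (a : laurent) => a *: lmul_delta i w) _
  (msuppZ_le a h)) _.
  by move=> w; apply: scale0r.
apply: etrans _ (esym (scaler_sumr _ _ _ _)); apply: eq_bigr => w _.
apply: etrans _ (esym (scalerA _ _ _)).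
by apply: (congr1 (fun c => c *: lmul_delta i w)); apply: mcoeffZ.
Qed.

Lemma lmul_genVD i g h : lmul_genV i (g + h) = lmul_genV i g + lmul_genV i h.
Proof.
apply: etrans (congr2 +%R (lmul_genD i g h) (scalerDr _ _ _)) _.
exact: addrACA.
Qed.

Lemma lmul_genVZ i (a : laurent) h : lmul_genV i (a *: h) = a *: lmul_genV i h.
Proof.
have E := lmul_genVE i; apply: etrans (E _) _.
apply: etrans _ (esym (congr1 _ (E _))); apply: esym.
apply: etrans (scalerDr _ _ _) _; apply: esym; apply: (congr2 +%R) => //.
  exact: lmul_genZ.
apply: esym; apply: etrans (scalerBr _ _ _) _.
by apply: (congr2 (fun x y => x - y)); apply: esym; apply: vshiftZ.
Qed.

Lemma cmulD i g h : cmul i (g + h) = cmul i g + cmul i h.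
Proof.
by apply: etrans (congr2 +%R (lmul_genD i g h) (vshiftD _ _ _)) (addrACA _ _ _ _).
Qed.

Lemma cfU (a : laurent) w y k : cf << a *g w >> y k = if w == y then a@_(k : vexp) else 0.
Proof. by rewrite /cf mcoeffU; case: (w == y) => //; exact: mcoeff0. Qed.

Lemma bar_delta_self w : (bar_delta w)@_w = 1.
Proof.
apply/malgP => k; apply: etrans (proj1 (bar_delta_tri w) k) _.
by have := cf_delta w w k; rewrite eqxx /= /cf /delta mcoeffUU => ->.
Qed.

Lemma bar_delta_other w y : (length w <= length y)%N -> y != w ->
  (bar_delta w)@_y = 0.
Proof.
move=> le_wy ny; apply/malgP => k.
by rewrite [RHS]mcoeff0; apply: (proj2 (bar_delta_tri w) y k le_wy ny).
Qed.

Lemma bar_lead h w k :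
  (forall y l, (length w < length y)%N -> cf h y l = 0) ->
  cf (bar h) w k = cf h w (- k).
Proof.
move=> top; rewrite /cf /bar.
rewrite (_ : (\sum_(y <- msupp h) laurent_bar h@_y *: bar_delta y)@_w =
  laurent_bar h@_w); first exact: mcoeff_laurent_bar.
rewrite raddf_sum /=.
rewrite (_ : \sum_(y <- msupp h) _ = \sum_(y <- msupp h) (if y == w then laurent_bar h@_w else 0)).
  have [wh|wh] := boolP (w \in msupp h); last first.
    rewrite (mcoeff_outdom wh) laurent_bar0 big1_seq // => y _.
    by case: (y == w).
  rewrite (big_fsetD1 w wh) /= eqxx big1_seq ?addr0 // => y /andP[_].
  by rewrite in_fsetD1 => /andP[/negbTE-> _].
apply: eq_big_seq => y yh; apply: etrans (mcoeffZ _ _ _) _.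
have [->|ny] := eqVneq y w; first by rewrite bar_delta_self mulr1.
rewrite bar_delta_other ?mulr0 1?eq_sym // leqNgt; apply/negP => /top hy.
have : h@_y == 0 by apply/eqP/malgP => l; rewrite mcoeff0; apply: (hy l).
by rewrite mcoeff_eq0 yh.
Qed.

#[local] Opaque vpow vshift lmul_gen lmul_genV cf bar_delta bar.

Lemma cf_vshiftB h y k : cf (vshift (-1) h - vshift 1 h) y k =
  cf h y (k + 1) - cf h y (k - 1).
Proof.
apply: etrans (cfD _ _ _ _) _; apply: (congr2 +%R).
  by apply: etrans (cf_vshift _ _ _ _) _; rewrite opprK.
by apply: etrans (cfN _ _ _) (congr1 -%R (cf_vshift _ _ _ _)).
Qed.

Lemma lmul_genU i (a : laurent) w : lmul_gen i << a *g w >> =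
  << a *g (gen i * w)%g >> +
  (if desc i w then vshift (-1) << a *g w >> - vshift 1 << a *g w >> else 0).
Proof.
apply: cfP => y k; rewrite cf_lmul cfD !cfU.
have -> : (w == (gen i * y)%g) = ((gen i * w)%g == y).
  by apply/eqP/eqP => [->|<-]; rewrite genK.
congr (_ + _); have [-> |ne] := eqVneq w y.
  case: (desc i y); last exact: esym (cf0 _ _).
  apply: etrans _ (esym (cf_vshiftB _ _ _)).
  by rewrite (cfU a y y (k + 1)) (cfU a y y (k - 1)) eqxx.
rewrite [LHS](_ : _ = 0); last by case: (desc i y); rewrite ?subr0.
case: (desc i w); last exact: esym (cf0 _ _).
apply: etrans _ (esym (cf_vshiftB _ _ _)).
by rewrite (cfU a w y (k + 1)) (cfU a w y (k - 1)) (negbTE ne) subr0.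
Qed.

Lemma lmul_genVV i h : lmul_genV i (lmul_genV i h) =
  h + (vshift 1 (lmul_genV i h) - vshift (-1) (lmul_genV i h)).
Proof.
apply: cfP => y k; apply: etrans (cf_lmulV _ _ _ _) _.
apply: esym; apply: etrans (cfD _ _ _ _) _; apply: esym.
rewrite (_ : cf (_ - _) y k =
    cf (lmul_genV i h) y (k - 1) - cf (lmul_genV i h) y (k + 1)); last first.
  apply: etrans (cfD _ _ _ _) _; apply: (congr2 +%R (cf_vshift _ _ _ _)).
  by apply: etrans (cfN _ _ _) _; rewrite (cf_vshift (-1)) opprK.
rewrite (cf_lmulV i h (gen i * y)%g) (cf_lmulV i h y (k - 1)).
rewrite (cf_lmulV i h y (k + 1)) genK desc_gen.
by case: (desc i y) => /=; rewrite ?addrK ?subrK; lia.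
Qed.

(** On delta_w with i not a descent this is [bar_delta_gen]. If i is a descent, [bar_delta w] is
    itself an image of [lmul_genV i], and the quadratic relation [lmul_genVV] supplies the extra
    term. *)
Lemma bar_lmul i h : bar (lmul_gen i h) = lmul_genV i (bar h).
Proof.
apply: (@additive_ext (fun h => bar (lmul_gen i h)) (fun h => lmul_genV i (bar h))).
- by move=> x y; apply: etrans (congr1 bar (lmul_genD i x y)) (barD _ _).
- by move=> x y; apply: etrans (congr1 _ (barD x y)) (lmul_genVD _ _ _).
move=> a w; apply: etrans (congr1 bar (lmul_genU i a w)) _.
apply: esym; apply: etrans (congr1 _ (barU a w)) _.
apply: etrans (lmul_genVZ _ _ _) _; apply: esym; apply: etrans (barD _ _) _.
case: ifPn => [di|ndi]; last first.
  by rewrite bar0 addr0; apply: etrans (barU _ _) _; rewrite bar_delta_gen.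
have E : bar_delta w = lmul_genV i (bar_delta (gen i * w)%g).
  by rewrite -bar_delta_gen ?genK // desc_gen di.
have -> : lmul_genV i (bar_delta w) = bar_delta (gen i * w)%g +
    (vshift 1 (bar_delta w) - vshift (-1) (bar_delta w)).
  by have := lmul_genVV i (bar_delta (gen i * w)%g); rewrite -E.
apply: etrans _ (esym (scalerDr _ _ _)); apply: (congr2 +%R (barU _ _)).
apply: etrans (barD _ _) _; apply: etrans (congr2 +%R (bar_vshift _ _) (barN _)) _.
apply: etrans _ (esym (scalerBr _ _ _)); apply: (congr2 (fun x y => x - y)).
  by apply: etrans (congr1 _ (barU _ _)) (vshiftZ _ _ _).
apply: etrans (bar_vshift _ _) _.
by apply: etrans (congr1 _ (barU _ _)) (vshiftZ _ _ _).
Qed.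

Lemma bar_cmul i h : bar (cmul i h) = cmul i (bar h).
Proof.
apply: etrans (barD _ _) _.
apply: etrans (congr2 +%R (bar_lmul _ _) (bar_vshift _ _)) _.
by rewrite lmul_genV_cmul subrK.
Qed.

#[local] Transparent cf.

Lemma supp_cf h y k : cf h y k != 0 -> y \in msupp h.
Proof.
rewrite -mcoeff_neq0; apply: contra => /eqP hy; apply/eqP.
by rewrite /cf hy mcoeff0.
Qed.

#[local] Transparent vpow vshift lmul_gen lmul_genV bar_delta bar.

(** * Multisets of elements with two left descents *)

Definition theta (w : W) : bool := [exists s, [forall i, desc i w == (i != s)]].

(** The default never occurs, since no element has three descents. *)
Definition asc (w : W) : 'I_3 := odflt 0 [pick s | ~~ desc s w].

Lemma theta_desc w i : theta w -> desc i w = (i != asc w).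
Proof.
move=> /existsP[s /forallP sP]; rewrite /asc; case: pickP => [t|/(_ s)] /=.
  by rewrite (eqP (sP t)) negbK => /eqP->; apply/eqP.
by rewrite (eqP (sP s)) eqxx.
Qed.

Lemma thetaP s t u w : s != t -> s != u -> t != u -> desc t w -> desc u w ->
  theta w /\ asc w = s.
Proof.
move=> st su tu dt du; have nds := desc_triple st su tu dt du.
have thw : theta w.
  apply/existsP; exists s; apply/forallP => i; apply/eqP.
  have [->|nis] := eqVneq i s; first exact: negbTE.
  have [->//|nit] := eqVneq i t; have [->//|niu] := eqVneq i u.
  by move: st su tu nis nit niu; elim/ord3_ind: i; elim/ord3_ind: s {nds};
    elim/ord3_ind: t {dt}; elim/ord3_ind: u {du}.
by split => //; apply/eqP; have := nds; rewrite (theta_desc _ thw) negbK eq_sym.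
Qed.

Lemma dir_neq (d s : 'I_3) : d != 0 ->
  [/\ s != s - d, s != s + d & s - d != s + d].
Proof. by elim/ord3_ind: d; elim/ord3_ind: s. Qed.

Lemma dir_subK (d s : 'I_3) : (s + d - d = s) * (s - d + d = s) *
  (s - d - d = s + d) * (s + d + d = s - d).
Proof.
by do !split; apply/val_inj; elim/ord3_ind: d; elim/ord3_ind: s.
Qed.

Lemma dir_opp (d : 'I_3) : d != 0 -> - d != 0.
Proof. by elim/ord3_ind: d. Qed.

Section Operators.
Variable d : 'I_3.

(** If elements with two descents are viewed as dominant weights of SL_3, with fundamental weights p
    and q, then [u1], [u2], [u3] add p, q - p, -q, and [ok2], [ok3] test whether the result is still
    dominant. Direction -d exchanges p and q. *)
Definition u1 w := (gen (asc w - d) * (gen (asc w) * w))%g.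
Definition u2 w := (gen (asc w) * (gen (asc w + d) * w))%g.
Definition u3 w := (gen (asc w + d) * (gen (asc w - d) * w))%g.

Definition ok2 w := desc (asc w) (u2 w) && desc (asc w - d) (u2 w).
Definition ok3 w := desc (asc w) (u3 w) && desc (asc w - d) (u3 w).

Definition U1 (x : seq W) : seq W := map u1 x.
Definition U2 (x : seq W) : seq W := [seq u2 w | w <- x & ok2 w].
Definition U3 (x : seq W) : seq W := [seq u3 w | w <- x & ok3 w].

(* Multiplication by a fundamental character of SL_3 on the multiset. *)
Definition Ue (x : seq W) : seq W := U1 x ++ U2 x ++ U3 x.

Lemma U1_cat x y : U1 (x ++ y) = U1 x ++ U1 y.
Proof. exact: map_cat. Qed.

Lemma U2_cat x y : U2 (x ++ y) = U2 x ++ U2 y.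
Proof. by rewrite /U2 filter_cat map_cat. Qed.

Lemma U3_cat x y : U3 (x ++ y) = U3 x ++ U3 y.
Proof. by rewrite /U3 filter_cat map_cat. Qed.

(** The index moves by two because each operator applies two generators; even and odd lengths of
    cyclic words then share one sequence. *)
Fixpoint sig (N : nat -> seq W) (m : nat) : seq W :=
  N m ++ (if m is m'.+2 then U3 (sig N m') else [::]).

Fixpoint rho (N : nat -> seq W) (m : nat) : seq W :=
  sig N m ++ (if m is m'.+2 then U2 (rho N m') else [::]).

(* The solution of the recursion with characteristic polynomial
   (1 - U3 t^2)(1 - U2 t^2)(1 - U1 t^2) and source [N]. *)
Fixpoint alp (N : nat -> seq W) (m : nat) : seq W :=
  rho N m ++ (if m is m'.+2 then U1 (alp N m') else [::]).

End Operators.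

Definition ty (s : 'I_3) (x : seq W) : bool :=
  all (fun w => theta w && (asc w == s)) x.

Lemma ty_cat s x y : ty s (x ++ y) = ty s x && ty s y.
Proof. exact: all_cat. Qed.

Section OperatorTheory.
Variable d : 'I_3.
Hypothesis d0 : d != 0.

Lemma theta_cases w : theta w ->
  [/\ ~~ desc (asc w) w, desc (asc w - d) w & desc (asc w + d) w].
Proof.
move=> thw; have [n1 n2 n3] := dir_neq (asc w) d0.
by rewrite !theta_desc // eqxx -!(eq_sym (asc w)).
Qed.

Lemma ok_theta w z : desc (asc w) z && desc (asc w - d) z ->
  theta z /\ asc z = asc w + d.
Proof.
move=> /andP[d1 d2]; have [n1 n2 n3] := dir_neq (asc w) d0.
by apply: thetaP d1 d2; rewrite // eq_sym.
Qed.

Lemma u1P w : theta w -> theta (u1 d w) /\ asc (u1 d w) = asc w + d.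
Proof.
move=> thw; have [n1 n2 n3] := dir_neq (asc w) d0.
have [_ dt du] := theta_cases thw; apply: ok_theta.
by rewrite (pair_up2 n1 n2 n3 dt du) /u1 desc_gen (pair_up n1 n2 n3 dt du).
Qed.

Lemma ty_U1 s x : ty s x -> ty (s + d) (U1 d x).
Proof.
move=> /allP xP; apply/allP => _ /mapP[w /xP/andP[thw /eqP<-] ->].
by have [-> ->] := u1P thw; rewrite eqxx.
Qed.

Lemma ty_U2 s x : ty s x -> ty (s + d) (U2 d x).
Proof.
move=> /allP xP; apply/allP => _ /mapP[w + ->]; rewrite mem_filter.
by move=> /andP[/ok_theta[-> ->] /xP/andP[_ /eqP->]]; rewrite eqxx.
Qed.

Lemma ty_U3 s x : ty s x -> ty (s + d) (U3 d x).
Proof.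
move=> /allP xP; apply/allP => _ /mapP[w + ->]; rewrite mem_filter.
by move=> /andP[/ok_theta[-> ->] /xP/andP[_ /eqP->]]; rewrite eqxx.
Qed.

Lemma ty_Ue s x : ty s x -> ty (s + d) (Ue d x).
Proof. by move=> tx; rewrite /Ue !ty_cat ty_U1 ?ty_U2 ?ty_U3. Qed.

Lemma ty_alp (N : nat -> seq W) (s : nat -> 'I_3) :
  (forall m, s m.+2 = s m + d) -> (forall m, ty (s m) (N m)) ->
  forall m, ty (s m) (alp d N m).
Proof.
move=> sE tN.
have ind (P : nat -> Prop) : P 0%N -> P 1%N -> (forall m, P m -> P m.+2) ->
    forall m, P m.
  move=> P0 P1 PS m; suff: P m /\ P m.+1 by case.
  by elim: m => [|m [IH1 IH2]]; split => //; apply: PS.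
have tsig m : ty (s m) (sig d N m).
  elim/ind: m => [||m IH] /=; rewrite ty_cat ?tN //=.
  by rewrite sE; apply: ty_U3.
have trho m : ty (s m) (rho d N m).
  elim/ind: m => [||m IH]; rewrite /rho -/rho ty_cat tsig //=.
  by rewrite sE; apply: ty_U2.
elim/ind => [||m IH]; rewrite /alp -/alp ty_cat trho //=.
by rewrite sE; apply: ty_U1.
Qed.

(** In weights: adding q - p and adding -p are possible under the same condition, a positive
    coefficient of p. *)
Lemma okC w : theta w ->
  desc (asc w) (gen (asc w - d) * (gen (asc w + d) * w))%g &&
  desc (asc w + d) (gen (asc w - d) * (gen (asc w + d) * w))%g = ok2 d w.
Proof.
move=> thw; have [] := theta_cases thw; rewrite /ok2 /u2; set s := asc w.
have := d0; win_cases w.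
by elim/ord3_ind: s; elim/ord3_ind: (d) => //= *; lia.
Qed.

End OperatorTheory.

Lemma tyW s x : ty s x -> all theta x.
Proof. by apply: sub_all => w /andP[]. Qed.

(** * The operators compose as the weights of SL_3 *)

Section Composition.
Variable d : 'I_3.
Hypothesis d0 : d != 0.

Let dn0 : - d != 0.
Proof. exact: dir_opp. Qed.

Lemma U2U1 x : all theta x -> U2 d (U1 d x) = U1 (- d) x.
Proof.
elim: x => //= w x IH /andP[thw thx]; have [th1 as1] := u1P d0 thw.
have [th2 as2] := u1P dn0 thw; have [n1 n2 n3] := dir_neq (asc w) d0.
have E : u2 d (u1 d w) = u1 (- d) w.
  by rewrite /u2 as1 /u1 opprK !dir_subK genK.
have okw : ok2 d (u1 d w).
  rewrite /ok2 E as1 !(theta_desc _ th2) as2 !dir_subK.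
  by rewrite n1 eq_sym n3.
by rewrite /U2 /= okw /= E -IH.
Qed.

Lemma u3_u1 w : theta w -> u3 d (u1 d w) = u2 (- d) w.
Proof.
move=> thw; have [th1 as1] := u1P d0 thw.
by rewrite /u3 as1 /u1 /u2 !dir_subK gen_braid genK.
Qed.

Lemma ok3_u1 w : theta w -> ok3 d (u1 d w) = ok2 (- d) w.
Proof.
move=> thw; have [th1 as1] := u1P d0 thw.
by rewrite /ok3 u3_u1 // as1 /ok2 !opprK !dir_subK andbC.
Qed.

Lemma ok3N w : theta w -> ok3 (- d) w = ok2 d w.
Proof. by move=> thw; rewrite -(okC d0 thw) /ok3 /u3 opprK. Qed.

Lemma U3U1 x : all theta x -> U3 d (U1 d x) = U2 (- d) x.
Proof.
elim: x => //= w x IH /andP[thw thx].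
have E := u3_u1 thw; rewrite /U3 /U2 /= ok3_u1 //; case: (ok2 _ _) => /=;
  rewrite ?E; first congr (_ :: _).
  exact: IH.
exact: IH.
Qed.

Lemma U3U2 x : all theta x -> U3 d (U2 d x) = U3 (- d) x.
Proof.
elim: x => //= w x IH /andP[thw thx]; have okE := ok3N thw.
rewrite /U3 /U2 /= okE; case: ifPn => [ok|nok] /=; last exact: IH.
have [th1 as1] := ok_theta d0 ok.
have E : u3 d (u2 d w) = u3 (- d) w.
  by rewrite /u3 as1 /u2 opprK !dir_subK genK.
have okw : ok3 d (u2 d w).
  rewrite -okE in ok; rewrite /ok3 E as1 !dir_subK andbC; move: ok.
    by rewrite /ok3 opprK.
by rewrite okw /= E; congr (_ :: _); apply: IH.
Qed.

Lemma U3U1N x : all theta x -> U3 d (U1 (- d) x) = x.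
Proof.
elim: x => //= w x IH /andP[thw thx]; have [th2 as2] := u1P dn0 thw.
have [_ dt du] := theta_cases d0 thw.
have E : u3 d (u1 (- d) w) = w.
  by rewrite /u3 as2 /u1 opprK !dir_subK !genK.
have okw : ok3 d (u1 (- d) w) by rewrite /ok3 E as2 !dir_subK dt du.
by rewrite /U3 /= okw /= E; congr (_ :: _); apply: IH.
Qed.

Variable N : nat -> seq W.
Hypothesis thN : forall m, all theta (N m).

Let th_sig_rho_alp m : [/\ all theta (sig d N m), all theta (rho d N m) &
  all theta (alp d N m)].
Proof.
have aty x : all theta x -> forall w, w \in x -> theta w by move=> /allP.
have thU1 x : all theta x -> all theta (U1 d x).
  by move=> /allP xP; apply/allP => _ /mapP[w /xP/(u1P d0)[? _] ->].
have thU2 x : all theta (U2 d x).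
  by apply/allP => _ /mapP[w + ->]; rewrite mem_filter => /andP[/(ok_theta d0)[]].
have thU3 x : all theta (U3 d x).
  by apply/allP => _ /mapP[w + ->]; rewrite mem_filter => /andP[/(ok_theta d0)[]].
suff: (forall k, (k <= 1)%N -> [/\ all theta (sig d N (m + k)),
    all theta (rho d N (m + k)) & all theta (alp d N (m + k))]).
  by move=> /(_ 0%N isT); rewrite addn0.
elim: m => [|m IH] [|[|//]] _.
- by rewrite /= !cats0.
- by rewrite /= !cats0.
- by have := IH 1%N isT; rewrite addn1 addn0.
have [h1 h2 h3] := IH 0%N isT; rewrite addn0 in h1 h2 h3.
rewrite addn1 /sig -/(sig d N) /rho -/(rho d N) /alp -/(alp d N).
by rewrite !all_cat !thN !thU2 !thU3 thU1.
Qed.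

(** The expanded product (1 - U3 t^2)(1 - U2 t^2)(1 - U1 t^2), where e_1 is [Ue d], e_2 is
    [Ue (- d)] and e_3 is the identity. The lists agree only up to order, hence the sums of an
    arbitrary f; negative terms change sides, so no subtraction is used. *)
Lemma alp_rec (V : nmodType) (f : W -> V) m :
  \sum_(w <- alp d N m.+4.+2) f w + \sum_(w <- Ue (- d) (alp d N m.+2)) f w =
  \sum_(w <- N m.+4.+2) f w + \sum_(w <- Ue d (alp d N m.+4)) f w +
  \sum_(w <- alp d N m) f w.
Proof.
have [_ _ th0] := th_sig_rho_alp m.
have [_ th2r th2] := th_sig_rho_alp m.+2.
have thU : all theta (U1 (- d) (alp d N m)).
  by apply/allP => _ /mapP[w /(allP th0)/(u1P dn0)[? _] ->].
have e0 : alp d N m = U3 d (U2 d (U1 d (alp d N m))) by rewrite U2U1 // U3U1N.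
have a4 : alp d N m.+4 = rho d N m.+4 ++ U1 d (alp d N m.+2) by [].
have a6 : alp d N m.+4.+2 = (N m.+4.+2 ++ U3 d (sig d N m.+4)) ++
    U2 d (rho d N m.+4) ++ U1 d (alp d N m.+4) by rewrite catA.
rewrite a6 /Ue -U2U1 // -U3U1 // -U3U2 //.
rewrite [in U2 d (alp d N m.+4)]a4 [in U3 d (alp d N m.+4)]a4.
have r4 : U3 d (rho d N m.+4) = U3 d (sig d N m.+4) ++ U3 d (U2 d (rho d N m.+2)).
  exact: U3_cat.
have a2 : U3 d (U2 d (alp d N m.+2)) = U3 d (U2 d (rho d N m.+2)) ++ alp d N m.
  by rewrite [in RHS]e0; apply: etrans (congr1 _ (U2_cat _ _ _)) (U3_cat _ _ _).
rewrite (U2_cat d (rho d N m.+4)) (U3_cat d (rho d N m.+4)) r4 a2 !big_cat /=.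
by rewrite !addrA [LHS](ACl (1*4*3*5*2*7*6*8)).
Qed.

Lemma size_alp m : (size (alp d N m) + size (N m.+2) <= size (alp d N m.+2))%N.
Proof.
have -> : alp d N m.+2 = rho d N m.+2 ++ U1 d (alp d N m) by [].
rewrite size_cat size_map addnC leq_add2r.
have -> : rho d N m.+2 = sig d N m.+2 ++ U2 d (rho d N m) by [].
have -> : sig d N m.+2 = N m.+2 ++ U3 d (sig d N m) by [].
by rewrite !size_cat -addnA leq_addr.
Qed.

End Composition.

(** * Words in cyclic order *)

Fixpoint wall (d i : 'I_3) (m : nat) : W :=
  if m is m'.+1 then (gen i * wall d (i + d) m')%g else 1%g.

Lemma dir_cases (d s k : 'I_3) : d != 0 -> k != s -> k != s - d -> k = s + d.
Proof.
move=> d0 n1 n2; apply/eqP; move: d0 n1 n2.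
by elim/ord3_ind: d; elim/ord3_ind: s; elim/ord3_ind: k.
Qed.

Section Walls.
Variable d : 'I_3.
Hypothesis d0 : d != 0.

Lemma wall_desc i m k : desc k (wall d i m) = (0 < m)%N && (k == i).
Proof.
have [n] := ubnP m; elim: n => // n IHn in m i k *.
case: m => [|m] le_mn; first by rewrite /= (negbTE (desc1 k)).
have IH := IHn m _ _ le_mn.
have [n1 n2 n3] := dir_neq i d0; have dK := dir_subK d i.
set y := wall d (i + d) m.
have ndi : ~~ desc i y by rewrite IH (negbTE n2) andbF.
rewrite [wall _ _ _]/= -/y [RHS]/=.
have [->|nki] := eqVneq k i; first by rewrite desc_gen ndi.
have [->|nki2] := eqVneq k (i - d).
  have nd2 : ~~ desc (i - d) y by rewrite IH (negbTE n3) andbF.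
  by have [-> _ _] := desc_min n1 ndi nd2.
have -> : k = i + d.
  exact: dir_cases.
case: m le_mn @y IH ndi => [|m] le_mn y IH ndi.
  have nd1 : ~~ desc (i + d) y by apply: desc1.
  by have [-> _ _] := desc_min n2 ndi nd1.
have IH' := IHn m _ _ (ltnW le_mn).
have n2' : i + d != i by rewrite eq_sym.
have ndz : ~~ desc (i + d) (wall d (i + d + d) m).
  by rewrite IH' dK andbC eq_sym (negbTE n3).
have ndz2 : ~~ desc i (wall d (i + d + d) m).
  by rewrite IH' dK andbC (negbTE n1).
by have [_ -> _] := desc_min n2' ndz ndz2.
Qed.

Lemma wall_length i m : length (wall d i m) = m.
Proof.
elim: m i => [|m IH] i; first exact: length1.
have [_ n2 _] := dir_neq i d0.
by rewrite /= length_up ?IH // wall_desc (negbTE n2) andbF.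
Qed.

(* Its left descents are [i] and [i + d]. *)
Definition top (i : 'I_3) (m : nat) : W := (gen (i + d) * wall d i m)%g.

Lemma top_theta i m : (1 < m)%N -> theta (top i m) /\ asc (top i m) = i - d.
Proof.
case: m => [|[|m]] // _; have [n1 n2 n3] := dir_neq i d0.
apply: (@thetaP _ i (i + d)); rewrite // 1?eq_sym //; last first.
  by rewrite desc_gen wall_desc eq_sym (negbTE n2) andbF.
rewrite /top [wall d i m.+2]/=.
have nd1 : ~~ desc i (wall d (i + d) m.+1) by rewrite wall_desc (negbTE n2).
have nd2 : desc (i + d) (wall d (i + d) m.+1) by rewrite wall_desc eqxx.
apply: pair_up3 => //.
by have := wall_desc i m.+2 (i + d); rewrite /= => ->; rewrite eq_sym (negbTE n2).
Qed.

End Walls.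

(* What is used of the Kazhdan-Lusztig basis [b] of the group ring, with
   [c i] = 1 + delta_i. *)
Record klRing := KLRing {
  kl_ring :> nzRingType;
  kl_c : 'I_3 -> kl_ring;
  kl_b : W -> kl_ring;
  c_sq : forall i, kl_c i * kl_c i = kl_c i *+ 2;
  c_braid : forall i j, i != j ->
    kl_c i * kl_c j * kl_c i - kl_c i = kl_c j * kl_c i * kl_c j - kl_c j;
  kl_b1 : kl_b 1%g = 1;
  b_desc : forall i x, desc i x -> kl_c i * kl_b x = kl_b x *+ 2;
  b_gen : forall i, kl_c i * kl_b 1%g = kl_b (gen i);
  b_theta : forall s t u w, s != t -> s != u -> t != u ->
    desc t w -> desc u w -> kl_c s * kl_b w = kl_b (gen s * w)%g;
  b_E : forall s t u w, s != t -> s != u -> t != u ->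
    desc t w -> desc u w ->
    kl_c t * kl_b (gen s * w)%g = kl_b (gen t * (gen s * w))%g + kl_b w +
      (if desc s (gen s * (gen u * w))%g && desc t (gen s * (gen u * w))%g
       then kl_b (gen s * (gen u * w))%g else 0) +
      (if desc s (gen u * (gen t * w))%g && desc t (gen u * (gen t * w))%g
       then kl_b (gen u * (gen t * w))%g else 0);
  b_short : forall i j x, i != j -> ~~ desc i x -> desc j x ->
    (length x <= 3)%N ->
    kl_c i * kl_b x = kl_b (gen i * x)%g +
      (if desc i (gen j * x)%g then kl_b (gen j * x)%g else 0);
  b_wall : forall i j k y, i != j -> i != k -> j != k ->
    let x2 := (gen i * y)%g in let x1 := (gen k * x2)%g in
    let x := (gen j * x1)%g in
    ~~ desc i y -> desc j y -> ~~ desc k y ->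
    ~~ desc j x2 -> ~~ desc k x2 -> ~~ desc i x1 -> ~~ desc j x1 -> ~~ desc i x ->
    kl_c i * kl_b x = kl_b (gen i * x)%g + kl_c j * kl_b x2 - kl_b y
}.

Arguments c_sq {k0}.
Arguments c_braid {k0 i j}.
Arguments b_desc {k0 i x}.
Arguments b_gen {k0}.
Arguments b_theta {k0 s t u w}.
Arguments b_E {k0 s t u w}.
Arguments b_short {k0 i j x}.
Arguments b_wall {k0 i j k y}.

(** * Generators acting on sums of basis elements *)

Section Positivity.
Variable K : klRing.
Local Notation H := (kl_ring K).
Local Notation c := (@kl_c K).
Local Notation b := (@kl_b K).

Definition sumB (x : seq W) : H := \sum_(w <- x) b w.
Definition sumE (x : seq W) : H := \sum_(w <- x) (c (asc w) * b w).

Local Notation Phi := sumB.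
Local Notation PhiE := sumE.

Lemma Phi_cat x y : Phi (x ++ y) = Phi x + Phi y.
Proof. exact: big_cat. Qed.

Lemma PhiE_cat x y : PhiE (x ++ y) = PhiE x + PhiE y.
Proof. exact: big_cat. Qed.

Lemma Phi_nil : Phi [::] = 0.
Proof. exact: big_nil. Qed.

Lemma c_asc s x : ty s x -> c s * Phi x = PhiE x.
Proof.
move=> /allP tx; rewrite [LHS]mulr_sumr.
by apply: (@eq_big_seq H) => w /tx/andP[_ /eqP<-].
Qed.

Lemma c_des s i x : i != s -> ty s x -> c i * Phi x = Phi x *+ 2.
Proof.
move=> nis /allP tx; rewrite /sumB mulr_sumr -sumrMnl; apply: eq_big_seq => w.
by move=> /tx/andP[thw /eqP ws]; apply: b_desc; rewrite theta_desc // ws.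
Qed.

Lemma c_ascE s x : ty s x -> c s * PhiE x = PhiE x *+ 2.
Proof.
move=> /allP tx; rewrite /sumE mulr_sumr -sumrMnl; apply: eq_big_seq => w.
by move=> /tx/andP[_ /eqP->]; rewrite mulrA c_sq mulrnAl.
Qed.

Lemma b_asc w (d : 'I_3) : d != 0 -> theta w -> c (asc w) * b w = b (gen (asc w) * w)%g.
Proof.
move=> d0 thw; have [n1 n2 n3] := dir_neq (asc w) d0.
by have [_ dt du] := theta_cases d0 thw; apply: (b_theta n1 n2 n3 dt du).
Qed.

Lemma c_Ue1 (d : 'I_3) w : d != 0 -> theta w ->
  c (asc w - d) * (c (asc w) * b w) = b w + Phi (Ue d [:: w]).
Proof.
move=> d0 thw; have [n1 n2 n3] := dir_neq (asc w) d0.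
have [_ dt du] := theta_cases d0 thw; rewrite (b_asc d0 thw) (b_E n1 n2 n3 dt du).
have -> : Phi (Ue d [:: w]) = b (u1 d w) + (if ok2 d w then b (u2 d w) else 0) +
    (if ok3 d w then b (u3 d w) else 0).
  rewrite /Ue !Phi_cat /U1 /U2 /U3 /=.
  by case: (ok2 d w); case: (ok3 d w); rewrite /= /sumB ?big_seq1 ?big_nil; zmod.
rewrite /ok2 /ok3 -/(u1 d w) -/(u2 d w) -/(u3 d w); zmod.
Qed.

Lemma Phi_Ue_cat (d : 'I_3) x y :
  Phi (Ue d (x ++ y)) = Phi (Ue d x) + Phi (Ue d y).
Proof. by rewrite /Ue U1_cat U2_cat U3_cat !Phi_cat; zmod. Qed.

Lemma c_Ue (d s : 'I_3) x : d != 0 -> ty s x ->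
  c (s - d) * PhiE x = Phi x + Phi (Ue d x).
Proof.
move=> d0; elim: x => [|w x IH].
  by rewrite /sumE /sumB !big_nil mulr0 addr0.
rewrite -cat1s ty_cat => /andP[/allP/(_ w (mem_head _ _))/andP[thw /eqP ws] tx].
rewrite PhiE_cat Phi_cat Phi_Ue_cat mulrDr IH //.
have -> : PhiE [:: w] = c (asc w) * b w by apply: big_seq1.
have -> : Phi [:: w] = b w by apply: big_seq1.
by rewrite -ws c_Ue1 //; zmod.
Qed.

Section WallElements.
Variable d : 'I_3.
Hypothesis d0 : d != 0.

Lemma wall_up_short i m : (0 < m <= 3)%N ->
  c i * b (wall d (i + d) m) = b (wall d i m.+1).
Proof.
have [n1 n2 n3] := dir_neq i d0; move=> /andP[m_gt0 m_le3].
rewrite (b_short (j := i + d)) //; last by rewrite wall_length.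
- case: m m_gt0 {m_le3} => // m _.
  rewrite [wall d (i + d) m.+1]/= genK (_ : desc i _ = false) ?addr0 //.
  by rewrite wall_desc // dir_subK (negbTE n1) andbF.
- by rewrite wall_desc // (negbTE n2) andbF.
- by rewrite wall_desc // m_gt0 eqxx.
Qed.

Lemma wall_down_short i m : (1 < m <= 3)%N ->
  c (i + d) * b (wall d i m) = b (top d i m) + b (wall d (i + d) m.-1).
Proof.
have [n1 n2 n3] := dir_neq i d0; move=> /andP[m_gt1 m_le3].
rewrite (b_short (j := i)); last by rewrite wall_length.
- case: m m_gt1 {m_le3} => [|[|m]] // _.
  rewrite -/(top d i m.+2) [wall d i m.+2]/= genK -[X in desc _ X]/(wall d (i + d) m.+1).
  by rewrite wall_desc // eqxx.
- by rewrite eq_sym.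
- by rewrite wall_desc // eq_sym (negbTE n2) andbF.
- by rewrite wall_desc // eqxx ltnW.
Qed.

Lemma wall_up_long i m : (0 < m)%N ->
  c i * b (wall d (i + d) m.+3) = b (wall d i m.+4) +
    c (i + d) * b (wall d i m.+1) - b (wall d (i + d) m).
Proof.
have [n1 n2 n3] := dir_neq i d0; move=> m_gt0.
have n3' : i + d != i - d by rewrite eq_sym.
have x1E : wall d (i - d) m.+2 = (gen (i - d) * (gen i * wall d (i + d) m))%g.
  by rewrite [LHS]/= !dir_subK.
have xE : wall d (i + d) m.+3 =
    (gen (i + d) * (gen (i - d) * (gen i * wall d (i + d) m)))%g.
  by rewrite -x1E -(dir_subK d i).2.
have -> : wall d i m.+4 = (gen i * wall d (i + d) m.+3)%g by [].
have -> : wall d i m.+1 = (gen i * wall d (i + d) m)%g by [].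
rewrite xE; apply: (b_wall n2 n1 n3'); rewrite -/(wall d i m.+1) -?x1E -?xE.
- by rewrite wall_desc // (negbTE n2) andbF.
- by rewrite wall_desc // eqxx andbT.
- by rewrite wall_desc // (negbTE n3) andbF.
- by rewrite wall_desc // eq_sym (negbTE n2) andbF.
- by rewrite wall_desc // eq_sym (negbTE n1) andbF.
- by rewrite wall_desc // (negbTE n1) andbF.
- by rewrite wall_desc // eq_sym (negbTE n3) andbF.
- by rewrite x1E -xE wall_desc // (negbTE n2) andbF.
Qed.

Variable l0 : 'I_3.

(** Letters are numbered from the right end, so that all suffixes of one word use the same numbering
    and words grow on the left. *)
Definition letter (n : nat) : 'I_3 := l0 - d *+ n.
Local Notation lt := letter.

Lemma ltS n : lt n.+1 = lt n - d.
Proof. by rewrite /letter mulrS opprD addrCA addrC. Qed.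

Lemma ltSS n : lt n.+2 = lt n + d.
Proof. by rewrite !ltS dir_subK. Qed.

Lemma lt3 n : lt n.+3 = lt n.
Proof. by rewrite ltSS ltS dir_subK. Qed.

(** The projective remainders of [kappaP] at the bottom of the induction: indices 6 and 7 belong to
    shortening words of length 2 and 3, and index 8 arises from c_i c_j b_i = b_i + b_(i j i). *)
Definition Nkappa (n : nat) : seq W :=
  match n with
  | 6 => [:: top d (lt 2) 2] | 7 => [:: top d (lt 3) 3]
  | 8 => [:: top d (lt 4) 2] | _ => [::]
  end.

Let a := alp d Nkappa.

Let ty_top m i k : (1 < k)%N -> lt m = i - d -> ty (lt m) [:: top d i k].
Proof. by move=> k1 ->; have [h1 h2] := top_theta d0 i k1; rewrite /= h1 h2 eqxx. Qed.

Let ty_N m : ty (lt m) (Nkappa m).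
Proof.
case: m => [|[|[|[|[|[|[|[|[|m]]]]]]]]] //.
- by apply: ty_top; rewrite // lt3 ltS.
- by apply: ty_top; rewrite // lt3 ltS.
- by apply: ty_top; rewrite // lt3 ltS.
Qed.

Let ty_a m : ty (lt m) (a m).
Proof. by apply: ty_alp => // k; apply: ltSS. Qed.

Let a_rec m : Phi (a m.+4.+2) + Phi (Ue (- d) (a m.+2)) =
  Phi (Nkappa m.+4.+2) + Phi (Ue d (a m.+4)) + Phi (a m).
Proof. by apply: alp_rec => // k; apply: tyW (ty_N k). Qed.

Lemma ty_kappa m : ty (lt m) (alp d Nkappa m).
Proof. exact: ty_a. Qed.

Lemma size_kappa m : (0 < size (alp d Nkappa m.+4.+2))%N.
Proof.
have sa k := size_alp d Nkappa k.
elim/ltn_ind: m => -[|[|m]] IH.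
- by have := sa 4%N; rewrite [size (Nkappa _)]/=; lia.
- by have := sa 5%N; rewrite [size (Nkappa _)]/=; lia.
- by have := IH m (ltnW (ltnSn _)); have := sa m.+4.+2; lia.
Qed.

Let X m := b (wall d (lt m) m).

(** Of the two generators that are not descents of the word, one lengthens it and the other shortens
    it; the remainders are terms of one sequence, two steps apart. The proofs are joined:
    lengthening at m uses shortening at m - 2 through [wall_up_long], and shortening at m uses the
    braid relation. *)
Lemma kappaP m :
  ((0 < m)%N -> c (lt m - d) * X m = X m.+1 + Phi (a m.+2)) /\
  ((1 < m)%N -> c (lt m + d) * X m = X m.-1 + Phi (a m.+4)).
Proof.
have [n] := ubnP m; elim: n => // n IHn in m *; rewrite ltnS => le_mn.
have A k : (k < m)%N -> (0 < k)%N -> c (lt k - d) * X k = X k.+1 + Phi (a k.+2).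
  by move=> lt_k; apply: (IHn k (leq_trans lt_k le_mn)).1.
have C k : (k < m)%N -> (1 < k)%N -> c (lt k + d) * X k = X k.-1 + Phi (a k.+4).
  by move=> lt_k; apply: (IHn k (leq_trans lt_k le_mn)).2.
have AA : (0 < m)%N -> c (lt m - d) * X m = X m.+1 + Phi (a m.+2).
  have short k : (0 < k <= 3)%N -> c (lt k - d) * X k = X k.+1.
    move=> k3; rewrite /X ltS -(wall_up_short (lt k - d) k3).
    by rewrite (dir_subK d (lt k)).1.1.2.
  case: m le_mn A C => [|[|[|[|k]]]] // _ A C _; try by rewrite short // [Phi _]Phi_nil addr0.
  have e : lt k.+2 + d = lt k.+1 by rewrite ltS dir_subK.
  have := wall_up_long (lt k.+2) (ltn0Sn k).
  have := C k.+2 (leqnSn _) isT; rewrite e /X /= => -> E.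
  by rewrite (lt3 k.+1) (lt3 k.+2) -(ltS k.+1) E; zmod.
split=> // m_gt1.
case: m le_mn A C AA m_gt1 => [|[|[|[|n']]]] // _ A C AA _.
- rewrite /X (wall_down_short (lt 2) (m := 2)) //= -(_ : lt 1 = lt 2 + d).
    by rewrite addrC [Phi _]big_seq1.
  by rewrite (ltS 1) dir_subK.
- rewrite /X (wall_down_short (lt 3) (m := 3)) //= -(_ : lt 2 = lt 3 + d).
    by rewrite addrC [Phi _]big_seq1.
  by rewrite (ltS 2) dir_subK.
set q := n'.+3; set j := lt q; set i := j - d.
have jE : lt q.+1 + d = j by rewrite ltS dir_subK.
have iE : lt q.+1 = i by rewrite ltS.
have Aq : c i * X q = X q.+1 + Phi (a q.+2) by apply: A.
have Aq1 : c j * X q.-1 = X q + Phi (a q.+1).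
  by rewrite -[q in RHS]/(q.-1.+1) -(A q.-1) //= ?leqnSn // -ltS.
have Cq1 : c i * X q.-1 = X q.-2 + Phi (a q.+3).
  have := C q.-1 (leqnSn _) isT; rewrite /= => <-.
  by rewrite /i /j /q (ltSS n'.+1) (ltS n'.+1) !dir_subK.
have [n1 n2 n3] := dir_neq j d0.
have nij : i != j by rewrite eq_sym.
have nji : j != i by rewrite eq_sym.
have d1 : c j * Phi (a q.+2) = Phi (a q.+2) *+ 2.
  by apply: (c_des (s := lt q.+2)) => //; rewrite ltSS.
have d1' : c i * Phi (a q.+2) = Phi (a q.+2) *+ 2.
  by apply: (c_des (s := lt q.+2)) => //; rewrite ltSS.
have d2 : c j * (c i * Phi (a q.+1)) = Phi (a q.+1) + Phi (Ue (- d) (a q.+1)).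
  have ti : ty i (a q.+1) by rewrite -iE.
  rewrite (c_asc ti) -(c_Ue (dir_opp d0) ti) opprK /i.
  by rewrite (dir_subK d j).1.1.2.
have d3 : c i * (c j * Phi (a q.+3)) = Phi (a q.+3) + Phi (Ue d (a q.+3)).
  have tj : ty j (a q.+3) by rewrite /j -lt3.
  by rewrite (c_asc tj) (c_Ue d0 tj).
(* For q > 3 this is the induction hypothesis used twice. For q = 3 the factor [X 1] is b of a
   single generator, which cannot be shortened; the direct computation yields the source at index
   8. *)
have cij : c i * (c j * X q.-2) = X q.-2 + Phi (a q.-1) + Phi (a q.+2) *+ 2 +
    Phi (Nkappa q.+4.+1).
  case: n' @q @j @i A C {AA Aq Aq1 Cq1 d1 d2 d3} jE iE n1 n2 n3 nij nji d1'
    => [|n'] q j i A C jE iE n1 n2 n3 nij nji d1'.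
    rewrite [Phi (a q.-1)]Phi_nil ?[Phi (a q.+2)]Phi_nil mul0rn !addr0 /X /=.
    have -> : lt 1 = i by rewrite -iE lt3.
    rewrite (b_short (i := j) (j := i)) //; first last.
    - by rewrite (wall_length d0 i 1).
    - by rewrite (wall_desc d0 i 1) eqxx.
    - by rewrite (wall_desc d0 i 1) (negbTE nji).
    rewrite genK (negbTE (desc1 j)) addr0 (b_short (i := i) (j := j)) //; first last.
    - rewrite length_up ?(wall_length d0 i 1) //.
      by rewrite (wall_desc d0 i 1) (negbTE nji).
    - by rewrite desc_gen (wall_desc d0 i 1) (negbTE nji).
    - have ndi : ~~ desc i 1%g := desc1 i; have ndj : ~~ desc j 1%g := desc1 j.
      by have [_ -> _] := desc_min nij ndi ndj.
    rewrite genK (wall_desc d0 i 1) eqxx /= addrC; congr (_ + _).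
    by rewrite [RHS]big_seq1 /top -[lt 4]/(lt q.+1) jE iE /= -jE iE gen_braid.
  have -> : Phi (Nkappa q.+4.+1) = 0 by apply: Phi_nil.
  have eq2 : lt q.-2 + d = j by rewrite /j /q (ltS n'.+3) (ltS n'.+2) !dir_subK.
  have := C q.-2; rewrite eq2 /= => -> //; last by rewrite /q; lia.
  have eq3 : lt q.-2.-1 - d = i by rewrite /i /j /q lt3.
  have := A q.-2.-1; rewrite eq3 mulrDr /= => -> //; last by rewrite /q; lia.
  by rewrite d1'; zmod.
have rec := a_rec q.-1.
have B1 : X q.+1 = c i * X q - Phi (a q.+2) by rewrite Aq addrK.
have B2 : X q = c j * X q.-1 - Phi (a q.+1) by rewrite Aq1 addrK.
(* Expanding [X q.+1] downwards produces c_j c_i c_j X_(q-1); the braid relation exchanges it for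
   c_i c_j c_i X_(q-1), whose innermost product is [Cq1]. *)
have E1 : c j * (c i * (c j * X q.-1)) =
    c i * (c j * (c i * X q.-1)) - c i * X q.-1 + c j * X q.-1.
  rewrite !mulrA; have := c_braid (k0 := K) nij => /(congr1 (fun h => h * X q.-1)).
  by rewrite !mulrBl => ->; rewrite subrK.
rewrite jE B1 mulrBr d1 {1}B2 !mulrBr E1 d2 Cq1 !mulrDr cij d3 Aq1; change (q.+1.-1) with q.
have -> : Phi (a q.+4.+1) = Phi (Nkappa q.+4.+1) + Phi (Ue d (a q.+3)) + Phi (a q.-1) -
   Phi (Ue (- d) (a q.+1)).
  by rewrite -[Phi (Nkappa _) + _ + _]rec addrK.
zmod.
Qed.

End WallElements.

End Positivity.

Arguments Phi_cat {K}.
Arguments PhiE_cat {K}.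
Arguments Phi_nil {K}.
Arguments c_asc {K s x}.
Arguments c_des {K s i x}.
Arguments c_ascE {K s x}.
Arguments b_asc {K w d}.
Arguments Phi_Ue_cat {K}.
Arguments c_Ue {K d s x}.
Arguments wall_up_long {K d} _ i {m}.
Arguments wall_up_short {K d} _ i {m}.
Arguments wall_down_short {K d} _ i {m}.
Arguments kappaP {K d}.
Arguments ty_kappa {d} d0 l0 m.

(** * The fourth-order recursion along the suffixes of a cyclic word *)

Section WallSequence.
Variable K : klRing.
Local Notation H := (kl_ring K).
Local Notation c := (@kl_c K).
Local Notation b := (@kl_b K).
Local Notation Phi := (sumB K).
Local Notation PhiE := (sumE K).
Variable d : 'I_3.
Hypothesis d0 : d != 0.
Variable l0 : 'I_3.
Local Notation lt := (letter d l0).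
Variables (A0 B0 G0 e1 e2 e3 : seq W).
Hypothesis tA0 : ty (lt 1) A0.
Hypothesis tB0 : ty (lt 2) B0.
Hypothesis tG0 : ty (lt 0) G0.
Hypothesis te1 : ty (lt 2) e1.
Hypothesis te2 : ty (lt 3) e2.
Hypothesis te3 : ty (lt 4) e3.

(** Found from the form required in [wall_seqE]: entries 6 to 9 fit the values T 0 to T 3, and
    entries 10 and 11 stand for [wal] at -2 and -1, namely B0 and G0, in the third-order
    recursion. *)
Definition Nwall (n : nat) : seq W :=
  match n with
  | 6 => A0 | 7 => B0 ++ B0 ++ Ue d G0 ++ e1 | 8 => G0 ++ G0 ++ e2
  | 9 => A0 ++ A0 ++ e3 | 10 => B0 | 11 => G0 | _ => [::]
  end.

Definition wal n := alp d Nwall n.+4.+2.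
Definition wbe n := match n with 0 => B0 | 1 => G0 | n'.+2 => wal n' end.
Definition wga n := match n with 0 => G0 | n'.+1 => wal n' end.

Let ty_Nwall n : ty (lt n.+1) (Nwall n).
Proof.
have l8 : lt 8 = lt 2 by rewrite !lt3.
have l9 : lt 9 = lt 0 by rewrite !lt3.
have l10 : lt 10 = lt 1 by rewrite !lt3.
case: n => [|[|[|[|[|[|[|[|[|[|[|[|n]]]]]]]]]]]] //=.
- by rewrite !lt3.
- by rewrite l8 2!(ty_cat _ B0) ty_cat tB0 te1 (ltSS d l0 0) (ty_Ue d0).
- by rewrite l9 2!(ty_cat _ G0) tG0 -[lt 0]lt3.
- by rewrite l10 2!(ty_cat _ A0) tA0 -[lt 1]lt3.
- by rewrite !lt3.
- by rewrite !lt3.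
Qed.

Lemma ty_wal n : ty (lt n.+1) (wal n).
Proof.
have -> : lt n.+1 = lt n.+4.+3 by rewrite !lt3.
by apply: (ty_alp d0 (s := fun k => lt k.+1)) => // k; apply: (ltSS d l0).
Qed.

Lemma ty_wbe n : ty (lt n.+2) (wbe n).
Proof.
by case: n => [|[|n]] //=; rewrite !lt3 //; apply: ty_wal.
Qed.

Lemma ty_wga n : ty (lt n) (wga n).
Proof. by case: n => [|n] //=; apply: ty_wal. Qed.

Let rec m : Phi (alp d Nwall m.+4.+2) + Phi (Ue (- d) (alp d Nwall m.+2)) =
  Phi (Nwall m.+4.+2) + Phi (Ue d (alp d Nwall m.+4)) + Phi (alp d Nwall m).
Proof. by apply: alp_rec => // k; apply: tyW (ty_Nwall k). Qed.

Variable T : nat -> H.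
Hypothesis T0 : T 0%N = Phi A0 + Phi B0 + PhiE G0.
Hypothesis T1 : T 1%N = c (lt 1) * T 0%N + Phi e1.
Hypothesis T2 : T 2%N = c (lt 2) * T 1%N + Phi e2.
Hypothesis T3 : T 3%N = c (lt 3) * T 2%N + Phi e3.
Hypothesis TS : forall n, T n.+4 =
  c (lt n.+4) * T n.+3 - c (lt n.+3) * T n.+1 + T n.

Let F n := Phi (wal n) + Phi (wbe n) + PhiE (wga n).

Let cF n : c (lt n.+1) * F n =
  PhiE (wal n) + Phi (wbe n) *+ 2 + (Phi (wga n) + Phi (Ue d (wga n))).
Proof.
have [n1 n2 n3] := dir_neq (lt n) d0.
rewrite !mulrDr (c_asc (ty_wal n)) (c_des _ (ty_wbe n)); last first.
  by rewrite (ltS d l0) (ltSS d l0).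
by rewrite -(c_Ue d0 (ty_wga n)) (ltS d l0).
Qed.

Let cF2 n : c (lt n.+2) * F n =
  Phi (wal n) *+ 2 + PhiE (wbe n) + (Phi (wga n) + Phi (Ue (- d) (wga n))).
Proof.
have [n1 n2 n3] := dir_neq (lt n) d0.
rewrite !mulrDr (c_asc (ty_wbe n)) (c_des _ (ty_wal n)); last first.
  by rewrite (ltSS d l0) (ltS d l0) eq_sym.
by rewrite -(c_Ue (dir_opp d0) (ty_wga n)) opprK (ltSS d l0).
Qed.

(** Sums of this form, with [wbe] and [wga] the delayed copies of [wal] by two and by one, are
    preserved: the three parts miss different descents, so each product with a generator is known,
    and the recursion for T becomes that of [alp] for [wal]. *)
Lemma wall_seqE n : T n = Phi (wal n) + Phi (wbe n) + PhiE (wga n).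
Proof.
have e k : (k <= 5)%N -> alp d Nwall k = [::].
  by case: k => [|[|[|[|[|[|k]]]]]].
have Ue0 q : Phi (Ue q [::]) = 0 by apply: Phi_nil.
have r0 : Phi (wal 0) = Phi A0.
  by have := rec 0; rewrite (e 0%N) // (e 2%N) // (e 4%N) // !Ue0 ?Phi_nil !addr0.
have r1 : Phi (wal 1) = Phi B0 + (Phi B0 + (Phi (Ue d G0) + Phi e1)).
  have := rec 1%N; rewrite (e 1%N) // (e 3%N) // (e 5%N) // !Ue0 ?Phi_nil !addr0 [Nwall _]/=.
  by rewrite (Phi_cat B0) (Phi_cat B0) (Phi_cat (Ue d G0)).
have r2 : Phi (wal 2) = Phi G0 + (Phi G0 + Phi e2) + Phi (Ue d (wal 0)).
  have := rec 2%N; rewrite (e 2%N) // (e 4%N) // !Ue0 ?Phi_nil !addr0 [Nwall _]/=.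
  by rewrite (Phi_cat G0) (Phi_cat G0).
have r3 : Phi (wal 3) = Phi A0 + (Phi A0 + Phi e3) + Phi (Ue d (wal 1)).
  have := rec 3%N; rewrite (e 3%N) // (e 5%N) // !Ue0 ?Phi_nil !addr0 [Nwall _]/=.
  by rewrite (Phi_cat A0) (Phi_cat A0).
have rS k : Phi (wal k.+4) = Phi (Ue d (wal k.+2)) + Phi (wbe k) - Phi (Ue (- d) (wal k)).
  have E := rec k.+4; apply/eqP; rewrite eq_sym subr_eq eq_sym; apply/eqP.
  apply: etrans E _; case: k => [|[|k]]; rewrite -/(wal _).
  - by rewrite (e 4%N) // Phi_nil [Nwall _]/= [wbe _]/=; zmod.
  - by rewrite (e 5%N) // Phi_nil [Nwall _]/= [wbe _]/=; zmod.
  - by rewrite [Phi (Nwall _)]Phi_nil -/(wal _) [wbe _]/=; zmod.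
have F0 : T 0%N = F 0 by rewrite T0 /F r0.
have F1 : T 1%N = F 1%N.
  by rewrite T1 F0 cF /F r1 /=; zmod.
have F2 : T 2%N = F 2%N.
  by rewrite T2 F1 cF /F r2 /=; zmod.
have F3 : T 3%N = F 3%N.
  by rewrite T3 F2 cF /F r3 /= r0; zmod.
suff [//] : [/\ T n = F n, T n.+1 = F n.+1, T n.+2 = F n.+2 & T n.+3 = F n.+3].
elim: n => [|n [h0 h1 h2 h3]]; split=> //.
by rewrite TS h3 h1 h0 cF cF2 /F rS /= -/(wga n); zmod.
Qed.

(** Sizes grow within each parity class, as [U1] drops nothing. A single element in G0 contributes
    three terms: this is the growth rate 3. *)
Lemma wall_seq_size n : (1 < n)%N ->
  (2 * size A0 + 2 * size B0 + 3 * size G0 + size e1 <=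
   size (wal n) + size (wbe n) + size (wga n))%N.
Proof.
have sa k := size_alp d Nwall k.
have s0 : (size A0 <= size (wal 0))%N by have := sa 4%N; rewrite [Nwall _]/= /wal; lia.
have s1 : (2 * size B0 + size G0 + size e1 <= size (wal 1))%N.
  have := sa 5%N; rewrite [Nwall _]/= !size_cat /U1 (size_map (u1 d) G0).
  by rewrite /wal; lia.
have s2 : (size (wal 0) + 2 * size G0 <= size (wal 2))%N.
  by have := sa 6%N; rewrite [Nwall _]/= !size_cat /wal; lia.
have s3 : (size (wal 1) + 2 * size A0 <= size (wal 3))%N.
  by have := sa 7%N; rewrite [Nwall _]/= !size_cat /wal; lia.
have mono k : (size (wal k) <= size (wal k.+2))%N.
  by have := sa k.+4.+2; rewrite /wal; lia.
have big k : (size (wal 2) + size (wal 3) <= size (wal k.+2) + size (wal k.+3))%N.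
  by elim: k => // k IH; have := mono k.+2; lia.
case: n => [|[|[|n]]] // _; rewrite [wbe _]/= [wga _]/=; first lia.
by have := big n; lia.
Qed.

End WallSequence.

(** * Left multiplication by a word in cyclic order *)

Section Positive.
Variable K : klRing.
Local Notation H := (kl_ring K).
Local Notation c := (@kl_c K).
Local Notation b := (@kl_b K).
Local Notation Phi := (sumB K).
Local Notation PhiE := (sumE K).

(* The sum of [n] basis elements from the lowest two-sided cell. *)
Definition pos (n : nat) (h : H) : Prop := exists x y,
  [/\ all theta x, all theta y, h = Phi x + PhiE y & (size x + size y)%N = n].

Lemma pos0 : pos 0 0.
Proof. by exists [::], [::]; rewrite /sumB /sumE !big_nil addr0. Qed.

Lemma posD m n g h : pos m g -> pos n h -> pos (m + n) (g + h).
Proof.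
move=> [x [y [tx ty -> <-]]] [x' [y' [tx' ty' -> <-]]].
exists (x ++ x'), (y ++ y'); rewrite !all_cat tx ty tx' ty' !size_cat.
by split=> //; [rewrite Phi_cat PhiE_cat addrACA | rewrite addnACA].
Qed.

Lemma posMn m h k : pos m h -> pos (k * m) (h *+ k).
Proof.
by move=> hm; elim: k => [|k IH]; rewrite ?mulr0n ?mulrS; [exact: pos0 | exact: posD].
Qed.

Lemma pos_Phi x : all theta x -> pos (size x) (Phi x).
Proof. by move=> tx; exists x, [::]; rewrite /sumE big_nil addr0 addn0. Qed.

Lemma pos_PhiE x : all theta x -> pos (size x) (PhiE x).
Proof. by move=> tx; exists [::], x; rewrite /sumB big_nil add0r add0n. Qed.

Lemma pos_map r n h g : pos n h ->
  (forall w, theta w -> exists2 n', (r <= n')%N & pos n' (g * b w)) ->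
  (forall w, theta w -> exists2 n', (r <= n')%N & pos n' (g * (c (asc w) * b w))) ->
  exists2 n', (r * n <= n')%N & pos n' (g * h).
Proof.
move=> [x [y [tx ty -> <-]]] Hb HE; rewrite mulrDr mulnDr.
suff [n1 le1 p1] : exists2 n', (r * size x <= n')%N & pos n' (g * Phi x).
  suff [n2 le2 p2] : exists2 n', (r * size y <= n')%N & pos n' (g * PhiE y).
    by exists (n1 + n2)%N; [apply: leq_add | apply: posD].
  elim: y ty => [|w y IH] /=; first by exists 0%N; rewrite ?muln0 // /sumE big_nil mulr0; exact: pos0.
  move=> /andP[/HE[n2 le2 p2] /IH[n3 le3 p3]]; exists (n2 + n3)%N; first by rewrite mulnS leq_add.
  by rewrite /sumE big_cons mulrDr; apply: posD.
elim: x tx => [|w x IH] /=; first by exists 0%N; rewrite ?muln0 // /sumB big_nil mulr0; exact: pos0.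
move=> /andP[/Hb[n2 le2 p2] /IH[n3 le3 p3]]; exists (n2 + n3)%N; first by rewrite mulnS leq_add.
by rewrite /sumB big_cons mulrDr; apply: posD.
Qed.

Section WallAction.
Variable d : 'I_3.
Hypothesis d0 : d != 0.
Variable l0 : 'I_3.
Local Notation lt := (letter d l0).

Let T v n := b (wall d (lt n) n.+1) * v.

Let ltK n : lt n.+1 + d = lt n.
Proof. by rewrite ltS dir_subK. Qed.

Let T0 v : T v 0 = c (lt 0) * v.
Proof. by rewrite /T /= mulg1 -b_gen kl_b1 mulr1. Qed.

Let T_short v n : (n < 3)%N -> T v n.+1 = c (lt n.+1) * T v n.
Proof.
by move=> n3; rewrite /T mulrA -(wall_up_short d0) // -(ltK n).
Qed.

Let T_rec v n : T v n.+4 = c (lt n.+4) * T v n.+3 - c (lt n.+3) * T v n.+1 + T v n.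
Proof.
have := wall_up_long (K := K) d0 (lt n.+4) (ltn0Sn n).
rewrite ltK (lt3 _ _ n.+1) (lt3 _ _ n) => E.
rewrite /T !mulrA (lt3 _ _ n.+1) (lt3 _ _ n) E !mulrDl mulNr.
by rewrite (addrAC (_ + _)) subrK addrK.
Qed.

(** The products with v and the elements b of the lengthened word obey the same recursion from index
    4 on, so their difference falls under [wall_seqE]. The first three steps differ by remainders of
    [kappaP], which become the sources e1, e2, e3. *)
Lemma wall_T v (C q : nat) A0 B0 G0 n : (0 < q)%N -> (1 < n)%N ->
  ty (lt 1) A0 -> ty (lt 2) B0 -> ty (lt 0) G0 ->
  c (lt 0) * v = b (wall d (lt 0) q) *+ C + (Phi A0 + Phi B0 + PhiE G0) ->
  exists n' h, [/\ pos n' h, b (wall d (lt n) n.+1) * v = b (wall d (lt n) (q + n)) *+ C + h &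
    (2 * size A0 + 2 * size B0 + 3 * size G0 +
       C * size (alp d (Nkappa d (l0 + d *+ q)%R) q.+2) <= n')%N].
Proof.
move=> q_gt0 n_gt1 tA tB tG Ev.
(* With this origin, letter q + k of the lengthened word is letter k of the original one. *)
set l1 := l0 + d *+ q; set a := alp d _.
have ltq k : letter d l1 (q + k) = lt k.
  by rewrite /letter mulrnDr opprD addrA addrK.
have ta k : ty (lt k) (a (q + k)%N) by rewrite -ltq; apply: ty_kappa.
have tF s x : ty s x -> ty s (flatten (nseq C x)).
  by move=> tx; elim: (C) => //= k IH; rewrite ty_cat tx.
have PF x : Phi (flatten (nseq C x)) = Phi x *+ C.
  by elim: (C) => [|k IH] /=; rewrite ?mulr0n ?Phi_nil // mulrS Phi_cat IH.
have sF (x : seq W) : size (flatten (nseq C x)) = (C * size x)%N.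
  by elim: (C) => //= k IH; rewrite size_cat IH mulSn.
pose e k := flatten (nseq C (a (q + k)%N)).
have te k : ty (lt k) (e k) by apply: tF.
pose X k := b (wall d (lt k) (q + k)).
have XS k : c (lt k.+1) * X k = X k.+1 + Phi (a (q + k.+2)%N).
  have qk : (0 < q + k)%N by lia.
  by have := (kappaP (K := K) d0 l1 (q + k)).1 qk; rewrite -!addnS !ltq -ltS.
have Xrec k : X k.+4 = c (lt k.+4) * X k.+3 - c (lt k.+3) * X k.+1 + X k.
  have qk : (0 < q + k)%N by lia.
  have := wall_up_long (K := K) d0 (lt k.+4) qk.
  rewrite ltK (lt3 _ _ k.+1) (lt3 _ _ k) => E.
  rewrite /X (lt3 _ _ k.+1) (lt3 _ _ k) !addnS E.
  by rewrite (addrAC (_ + _)) subrK addrK.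
pose S k := T v k - X k *+ C.
have S0 : S 0%N = Phi A0 + Phi B0 + PhiE G0.
  by rewrite /S T0 Ev /X addn0 addrAC subrr add0r.
have SS k : (k < 3)%N -> S k.+1 = c (lt k.+1) * S k + Phi (e k.+2).
  by move=> k3; rewrite /S T_short // mulrBr mulrnAr XS mulrnDl PF opprD addrA subrK.
have SR k : S k.+4 = c (lt k.+4) * S k.+3 - c (lt k.+3) * S k.+1 + S k.
  by rewrite /S T_rec Xrec !mulrBr !mulrnAr !mulrnDl mulNrn !opprD [LHS]addrACA
    [X in X + _ = _]addrACA.
have E := wall_seqE d0 tA tB tG (te 2%N) (te 3%N) (te 4%N) S0 (SS 0%N isT) (SS 1%N isT)
  (SS 2%N isT) SR n.
have Z := wall_seq_size d0 tA tB tG (te 2%N) (te 3%N) (te 4%N) n_gt1.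
have t1 := ty_wal d0 tA tB tG (te 2%N) (te 3%N) (te 4%N) n.
have t2 := ty_wbe d0 tA tB tG (te 2%N) (te 3%N) (te 4%N) n.
have t3 := ty_wga d0 tA tB tG (te 2%N) (te 3%N) (te 4%N) n.
exists (size (wal d A0 B0 G0 (e 2) (e 3) (e 4) n) +
  size (wbe d A0 B0 G0 (e 2) (e 3) (e 4) n) +
  size (wga d A0 B0 G0 (e 2) (e 3) (e 4) n))%N, (S n); split.
- rewrite E; apply: posD; first apply: posD.
  + exact/pos_Phi/(tyW t1).
  + exact/pos_Phi/(tyW t2).
  + exact/pos_PhiE/(tyW t3).
- by rewrite /S addrC subrK.
by rewrite -(addn2 q) -sF; apply: Z.
Qed.

End WallAction.

End Positive.

(** * Products with the basis element of a cyclic word *)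

Section WallProducts.
Variable K : klRing.
Local Notation H := (kl_ring K).
Local Notation c := (@kl_c K).
Local Notation b := (@kl_b K).
Local Notation Phi := (sumB K).
Local Notation PhiE := (sumE K).
Variable d : 'I_3.
Hypothesis d0 : d != 0.

Lemma lt_wall i n : letter d (i + d *+ n) n = i.
Proof. by rewrite /letter addrK. Qed.

Lemma ord3_mod n : d *+ n = d *+ (n %% 3).
Proof.
have d3 : d *+ 3 = 0 by apply/val_inj; elim/ord3_ind: (d).
by rewrite {1}(divn_eq n 3) mulrnDr mulnC mulrnA d3 mul0rn add0r.
Qed.

Let Phi1 w : Phi [:: w] = b w. Proof. exact: big_seq1. Qed.
Let Phi2 w : Phi [:: w; w] = b w *+ 2.
Proof. by rewrite /sumB big_cons big_seq1 mulr2n. Qed.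
Let PhiE1 w : PhiE [:: w] = c (asc w) * b w. Proof. exact: big_seq1. Qed.
Let PhiE2 w : PhiE [:: w; w] = c (asc w) * b w *+ 2.
Proof. by rewrite /sumE big_cons big_seq1 mulr2n. Qed.

(** The rightmost letter l0 acts first. Its product with a basis element of the cell always splits
    into lists with 2|A0| + 2|B0| + 3|G0| >= 3, with equality when b_w itself is met by its missing
    descent. *)
Lemma wall_pos i m n h : (2 < m)%N -> pos n h ->
  exists2 n', (3 * n <= n')%N & pos n' (b (wall d i m) * h).
Proof.
case: m => // m m_gt1 hn; set l0 := i + d *+ m.
have lm : letter d l0 m = i := lt_wall i m.
have n1 := dir_neq l0 d0.
have act v A0 B0 G0 : ty (letter d l0 1) A0 -> ty (letter d l0 2) B0 -> ty (letter d l0 0) G0 ->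
    c (letter d l0 0) * v = Phi A0 + Phi B0 + PhiE G0 ->
    (3 <= 2 * size A0 + 2 * size B0 + 3 * size G0)%N ->
    exists2 n', (3 <= n')%N & pos n' (b (wall d i m.+1) * v).
  move=> tA tB tG E le3; have E' : c (letter d l0 0) * v =
      b (wall d (letter d l0 0) 1) *+ 0 + (Phi A0 + Phi B0 + PhiE G0).
    by rewrite mulr0n add0r.
  have [n' [h' [p' E2 le']]] := wall_T d0 (ltn0Sn 0) m_gt1 tA tB tG E'.
  by exists n'; [lia | rewrite lm mulr0n add0r in E2; rewrite E2].
have l0E : letter d l0 0 = l0 by rewrite /letter mulr0n subr0.
have l1E : letter d l0 1 = l0 - d by rewrite ltS l0E.
have l2E : letter d l0 2 = l0 + d by rewrite ltSS l0E.
rewrite l0E l1E l2E in act.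
have tyl w : theta w -> ty (asc w) [:: w] by move=> tw; rewrite /= tw eqxx.
have tyl2 w : theta w -> ty (asc w) [:: w; w] by move=> tw; rewrite /= tw eqxx.
apply: (pos_map hn) => w tw; have [n2 n3 n4] := n1.
- have [aw|na] := eqVneq (asc w) l0.
    by apply: (act _ [::] [::] [:: w]); rewrite -?aw ?tyl // !Phi_nil PhiE1 !add0r.
  have cw : c l0 * b w = b w *+ 2 by apply: b_desc; rewrite theta_desc // eq_sym.
  have [aw|na'] := eqVneq (asc w) (l0 - d).
    apply: (act _ [:: w; w] [::] [::]); rewrite -?aw ?tyl2 // cw Phi2 Phi_nil.
    by rewrite /sumE big_nil !addr0.
  have aw := dir_cases d0 na na'.
  apply: (act _ [::] [:: w; w] [::]); rewrite -?aw ?tyl2 // cw Phi2 Phi_nil.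
  by rewrite /sumE big_nil add0r addr0.
have [aw|na] := eqVneq (asc w) l0.
  apply: (act _ [::] [::] [:: w; w]); rewrite -?aw ?tyl2 // !Phi_nil PhiE2 !add0r.
  by rewrite mulrA c_sq mulrnAl.
have szU (d' : 'I_3) : (0 < size (Ue d' [:: w]))%N by [].
have [aw|na'] := eqVneq (asc w) (l0 - d).
  have al : l0 = asc w + d by rewrite aw dir_subK.
  apply: (act _ [:: w] (Ue (- d) [:: w]) [::]).
  - by rewrite -aw; apply: tyl.
  - have -> : l0 + d = asc w - d by rewrite aw dir_subK.
    exact/(ty_Ue (dir_opp d0))/tyl.
  - by [].
  - have := c_Ue (K := K) (dir_opp d0) (tyl _ tw); rewrite opprK -al PhiE1 => ->.
    by rewrite /sumE big_nil addr0.
  - by have := szU (- d); rewrite [size [:: w]]/=; lia.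
have aw := dir_cases d0 na na'.
have al : l0 = asc w - d by rewrite aw dir_subK.
apply: (act _ (Ue d [:: w]) [:: w] [::]).
- have -> : l0 - d = asc w + d by rewrite aw dir_subK.
  exact/(ty_Ue d0)/tyl.
- by rewrite -aw; apply: tyl.
- by [].
- have := c_Ue (K := K) d0 (tyl _ tw); rewrite -al PhiE1 => ->.
  by rewrite /sumE big_nil addr0 addrC.
- by have := szU d; rewrite [size [:: w]]/=; lia.
Qed.

(** By the length modulo 3, the last letter of the first word is i - d, i or i + d, so it lengthens
    the second word, doubles its basis element (the case C = 2), or shortens it. The word q so
    obtained has q > 3, hence a nonempty remainder in [kappaP]. *)
Lemma wall_mul i m p : (2 < m <= p)%N -> exists C p' n h,
  [/\ (C <= 2)%N, (p <= p')%N, (0 < n)%N, pos n h &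
    b (wall d i m) * b (wall d i p) = b (wall d i p') *+ C + h].
Proof.
case: m => // m /andP[m_gt1 le_mp]; rewrite ltnS in m_gt1.
set l0 := i + d *+ m.
have lm : letter d l0 m = i := lt_wall i m.
have l0E : letter d l0 0 = l0 by rewrite /letter mulr0n subr0.
have l1E : letter d l0 1 = l0 - d by rewrite ltS l0E.
have l2E : letter d l0 2 = l0 + d by rewrite ltSS l0E.
have act C q A0 B0 : (C <= 2)%N -> (0 < q)%N -> (p <= q + m)%N ->
    ty (l0 - d) A0 -> ty (l0 + d) B0 ->
    c l0 * b (wall d i p) = b (wall d l0 q) *+ C + (Phi A0 + Phi B0) ->
    (0 < size A0 + size B0)%N || (0 < C)%N && (3 < q)%N ->
    exists C' p' n h, [/\ (C' <= 2)%N, (p <= p')%N, (0 < n)%N, pos n h &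
      b (wall d i m.+1) * b (wall d i p) = b (wall d i p') *+ C' + h].
  move=> C2 q0 le_p tA tB E gt0; rewrite -{1}l0E in E.
  have E' : c (letter d l0 0) * b (wall d i p) =
      b (wall d (letter d l0 0) q) *+ C + (Phi A0 + Phi B0 + PhiE [::]).
    by rewrite /sumE big_nil addr0 E l0E.
  rewrite -l1E in tA; rewrite -l2E in tB.
  have [n' [h' [p' E2 le']]] := wall_T d0 q0 m_gt1 tA tB (isT : ty _ [::]) E'.
  exists C, (q + m)%N, n', h'; rewrite lm in E2; split => //.
  case/orP: gt0 => [|/andP[C0 q4]]; first by lia.
  have : (0 < size (alp d (Nkappa d (l0 + d *+ q)%R) q.+2))%N.
    by case: q q4 {E E' E2 le' q0 le_p} => [|[|[|[|q]]]] // _; apply: size_kappa.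
  by nia.
have [m3|m3|m3] : [\/ (m %% 3 = 2)%N, (m %% 3 = 0)%N | (m %% 3 = 1)%N].
- have : (m %% 3 < 3)%N by rewrite ltn_mod.
  by case: (m %% 3)%N => [|[|[|]]] // _; [constructor 2|constructor 3|constructor 1].
- have l0i : l0 = i - d.
    by rewrite /l0 ord3_mod m3 mulr2n addrA dir_subK.
  have ip : letter d (i + d *+ p) p = i := lt_wall i p.
  have := (kappaP (K := K) d0 (i + d *+ p) p).1; rewrite ltS ip -l0i => E.
  apply: (act 1%N p.+1 (alp d (Nkappa d (i + d *+ p)) p.+2) [::]) => //; try lia.
  + by have := ty_kappa d0 (i + d *+ p) p.+2; rewrite !ltS ip -l0i.
  + by rewrite mulr1n Phi_nil addr0; apply: E; lia.
- have l0i : l0 = i by rewrite /l0 ord3_mod m3 mulr0n addr0.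
  apply: (act 2%N p [::] [::]) => //; try lia.
  by rewrite l0i b_desc ?Phi_nil ?addr0 // wall_desc // eqxx andbT; lia.
have l0i : l0 = i + d by rewrite /l0 ord3_mod m3 mulr1n.
have ip : letter d (i + d *+ p) p = i := lt_wall i p.
have ip1 : letter d (i + d *+ p) p.-1 = l0.
  have := ltS d (i + d *+ p) p.-1; rewrite (ltn_predK le_mp) ip => e.
  by rewrite l0i [in RHS]e dir_subK.
have := (kappaP (K := K) d0 (i + d *+ p) p).2; rewrite ip ip1 => E.
apply: (act 1%N p.-1 [::] (alp d (Nkappa d (i + d *+ p)) p.+4)) => //; try lia.
- have := ty_kappa d0 (i + d *+ p) p.+4; rewrite lt3 ltS ip l0i.
  by rewrite (dir_subK d i).2.
- by rewrite mulr1n Phi_nil add0r [in LHS]l0i; apply: E; lia.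
Qed.

End WallProducts.

(** * Symmetric functions of the operators *)

Lemma nat_ind2 (P : nat -> Prop) : P 0%N -> P 1%N -> (forall m, P m -> P m.+2) ->
  forall m, P m.
Proof.
move=> P0 P1 PS m; suff: P m /\ P m.+1 by case.
by elim: m => [|m [IH1 IH2]]; split => //; apply: PS.
Qed.

Section SymmetricFunctions.
Variable d : 'I_3.

(** Only the factors of U2 and U1: with source [sig] this recovers [alp], and with a source in one
    degree it gives symmetric functions in two of the operators. *)
Fixpoint rhoA (N : nat -> seq W) (m : nat) : seq W :=
  N m ++ (if m is m'.+2 then U2 d (rhoA N m') else [::]).

Fixpoint alpA (N : nat -> seq W) (m : nat) : seq W :=
  rhoA N m ++ (if m is m'.+2 then U1 d (alpA N m') else [::]).

Lemma rho_rhoA N m : rho d N m = rhoA (sig d N) m.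
Proof.
elim/nat_ind2: m => // m IH.
by rewrite -[LHS]/(sig d N m.+2 ++ U2 d (rho d N m)) IH.
Qed.

Lemma alp_alpA N m : alp d N m = alpA (sig d N) m.
Proof.
elim/nat_ind2: m => // m IH.
by rewrite -[LHS]/(rho d N m.+2 ++ U1 d (alp d N m)) IH rho_rhoA.
Qed.

Lemma U1_perm x y : perm_eq x y -> perm_eq (U1 d x) (U1 d y).
Proof. exact: perm_map. Qed.

Lemma U2_perm x y : perm_eq x y -> perm_eq (U2 d x) (U2 d y).
Proof. by move=> xy; apply/perm_map/perm_filter. Qed.

Lemma U3_perm x y : perm_eq x y -> perm_eq (U3 d x) (U3 d y).
Proof. by move=> xy; apply/perm_map/perm_filter. Qed.

Lemma alpA_perm N N1 N2 : (forall m, perm_eq (N m) (N1 m ++ N2 m)) ->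
  forall m, perm_eq (alpA N m) (alpA N1 m ++ alpA N2 m).
Proof.
move=> NE; have rE m : perm_eq (rhoA N m) (rhoA N1 m ++ rhoA N2 m).
  elim/nat_ind2: m => [||m IH]; rewrite /= ?cats0 //.
  apply: perm_trans (perm_cat (NE _) (U2_perm IH)) _.
  by rewrite U2_cat perm_catACA.
elim/nat_ind2 => [||m IH]; rewrite /alpA -/alpA ?cats0 //.
apply: perm_trans (perm_cat (rE _) (U1_perm IH)) _.
by rewrite U1_cat perm_catACA.
Qed.

Lemma sig_perm N N1 N2 : (forall m, perm_eq (N m) (N1 m ++ N2 m)) ->
  forall m, perm_eq (sig d N m) (sig d N1 m ++ sig d N2 m).
Proof.
move=> NE; elim/nat_ind2 => [||m IH]; rewrite /= ?cats0 //.
apply: perm_trans (perm_cat (NE _) (U3_perm IH)) _.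
by rewrite U3_cat perm_catACA.
Qed.

Lemma alp_perm N N1 N2 : (forall m, perm_eq (N m) (N1 m ++ N2 m)) ->
  forall m, perm_eq (alp d N m) (alp d N1 m ++ alp d N2 m).
Proof. by move=> NE m; rewrite !alp_alpA; apply/alpA_perm/sig_perm. Qed.

Definition shift2 (N : nat -> seq W) (m : nat) : seq W :=
  if m is m'.+2 then N m' else [::].

Lemma alpA_shift N m : alpA (shift2 N) m.+2 = alpA N m.
Proof.
have rE : forall m, rhoA (shift2 N) m.+2 = rhoA N m.
  elim/nat_ind2 => [||k IH]; [by rewrite /= !cats0|by rewrite /= !cats0|].
  by rewrite -[LHS]/(N k.+2 ++ U2 d (rhoA (shift2 N) k.+2)) IH.
elim/nat_ind2: m => [||m IH]; [by rewrite /= !cats0|by rewrite /= !cats0|].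
by rewrite -[LHS]/(rhoA (shift2 N) m.+4 ++ U1 d (alpA (shift2 N) m.+2)) IH rE.
Qed.

(** Degree 0 sits at index 6, so that the recursion finds empty lists at 4 and 2, as h_(-1) = h_(-2)
    = 0. *)
Definition at6 (v : seq W) (m : nat) : seq W := if m == 6 then v else [::].

(* The complete symmetric function of degree [m] in the three operators. *)
Definition hsym (v : seq W) (m : nat) : seq W := alp d (at6 v) m.*2.+4.+2.

Lemma hsym_cat x y m : perm_eq (hsym (x ++ y) m) (hsym x m ++ hsym y m).
Proof. by apply: alp_perm => k; rewrite /at6; case: ifP. Qed.

Lemma size_hsym v m : (size v <= size (hsym v m))%N.
Proof.
elim: m => [|m IH]; first exact: leq_trans (leq_addl _ _) (size_alp d (at6 v) 4).
apply: leq_trans IH _; exact: leq_trans (leq_addr _ _) (size_alp d (at6 v) m.*2.+4.+2).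
Qed.

Lemma hsym_rec (V : nmodType) (f : W -> V) v m : d != 0 -> all theta v ->
  \sum_(w <- hsym v m.+3) f w + \sum_(w <- Ue (- d) (hsym v m.+1)) f w =
  \sum_(w <- Ue d (hsym v m.+2)) f w + \sum_(w <- hsym v m) f w.
Proof.
move=> d0 tv; have := alp_rec d0 (N := at6 v) _ f m.*2.+4.+2.
rewrite /hsym !doubleS => ->; last by move=> k; rewrite /at6; case: ifP.
by rewrite [at6 _ _]/= big_nil add0r.
Qed.

Lemma hsym0 v : hsym v 0 = v.
Proof. by rewrite /hsym /= !cats0. Qed.

Lemma hsym1 (V : nmodType) (f : W -> V) v : d != 0 -> all theta v ->
  \sum_(w <- hsym v 1) f w = \sum_(w <- Ue d v) f w.
Proof.
move=> d0 tv; have t6 k : all theta (at6 v k) by rewrite /at6; case: ifP.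
have := alp_rec d0 t6 f 2; rewrite (hsym0 v : alp d (at6 v) 6 = v) => E.
have e4 : alp d (at6 v) 4 = [::] by [].
have e2 : alp d (at6 v) 2 = [::] by [].
by move: E; rewrite e4 e2 [Ue _ [::]]/= [at6 _ _]/= !big_nil !addr0 add0r.
Qed.

Lemma hsym2 (V : nmodType) (f : W -> V) v : d != 0 -> all theta v ->
  \sum_(w <- hsym v 2) f w + \sum_(w <- Ue (- d) v) f w =
  \sum_(w <- Ue d (hsym v 1)) f w.
Proof.
move=> d0 tv; have t6 k : all theta (at6 v k) by rewrite /at6; case: ifP.
have := alp_rec d0 t6 f 4; rewrite (hsym0 v : alp d (at6 v) 6 = v) => E.
have e4 : alp d (at6 v) 4 = [::] by [].
by move: E; rewrite e4 [at6 _ _]/= !big_nil addr0 add0r.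
Qed.

Lemma ty_hsym s v m : d != 0 -> ty s v -> ty (s + d *+ m) (hsym v m).
Proof.
move=> d0 tv; have d3 : d *+ 3 = 0 by apply/val_inj; elim/ord3_ind: (d).
have := ty_alp d0 (N := at6 v) (s := fun k => s + d *+ k./2) _ _ m.*2.+4.+2.
rewrite /= doubleK 3!(mulrSr _ _) -!addrA (_ : d + (d + d) = 0) ?addr0; last first.
  by rewrite -d3 !mulrS addr0.
apply=> k; first by rewrite /= mulrSr addrA.
by rewrite /at6; case: eqP => // ->; rewrite /= d3 addr0.
Qed.

Definition hA (v : seq W) (m : nat) : seq W := alpA (at6 v) m.*2.+4.+2.

Lemma size_hA v m : (size v <= size (hA v m))%N.
Proof.
elim: m => [|m IH]; first by rewrite /hA /= !cats0.
apply: leq_trans IH _; rewrite /hA doubleS.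
rewrite -[alpA _ m.+1.*2.+4.+2]/(rhoA _ _ ++ U1 d (alpA (at6 v) m.*2.+4.+2)).
by rewrite (size_cat (rhoA _ _)) /U1 (size_map (u1 d)) leq_addl.
Qed.

(** The counterpart of the irreducibility of symmetric powers of the fundamental representation. *)
Lemma hsym_single z m : ~~ ok2 d z -> ~~ ok3 d z -> hsym [:: z] m = [:: iter m (u1 d) z].
Proof.
move=> n2 n3; elim: m => [|m IH]; first exact: hsym0.
have s6 : forall k, sig d (at6 [:: z]) k = at6 [:: z] k.
  elim/nat_ind2 => // k IHk; rewrite -[LHS]/(at6 [:: z] k.+2 ++ U3 d (sig d (at6 [:: z]) k)) IHk.
  by rewrite /at6 /U3; case: (k == 6); rewrite /= ?(negbTE n3) cats0.
have r6 : forall k, rho d (at6 [:: z]) k = at6 [:: z] k.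
  elim/nat_ind2 => // k IHk.
  rewrite -[LHS]/(sig d (at6 [:: z]) k.+2 ++ U2 d (rho d (at6 [:: z]) k)) IHk s6.
  by rewrite /at6 /U2; case: (k == 6); rewrite /= ?(negbTE n2) cats0.
rewrite /hsym doubleS.
rewrite -[LHS]/(rho d (at6 [:: z]) m.*2.+4.+4 ++ U1 d (hsym [:: z] m)) r6 IH //.
Qed.

End SymmetricFunctions.

Lemma u1_u3N (d : 'I_3) w : d != 0 -> theta w -> ok2 d w ->
  theta (u3 (- d) w) /\ u1 d (u3 (- d) w) = w.
Proof.
move=> d0 tw ok; rewrite -(ok3N d0 tw) in ok.
have [th1 as1] := ok_theta (dir_opp d0) ok; split => //.
by rewrite /u1 as1 /u3 opprK !dir_subK !genK.
Qed.

Lemma length_u1 (d : 'I_3) w : d != 0 -> theta w -> length (u1 d w) = (length w).+2.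
Proof.
move=> d0 tw; have [n1 n2 n3] := dir_neq (asc w) d0.
have [nd dt du] := theta_cases d0 tw.
by rewrite /u1 length_up ?(pair_up n1 n2 n3) // length_up.
Qed.

Section Schur.
Variable d : 'I_3.
Hypothesis d0 : d != 0.

Let dn0 : - d != 0. Proof. exact: dir_opp. Qed.

Lemma hA_single z m : ~~ ok2 d z -> hA d [:: z] m = [:: iter m (u1 d) z].
Proof.
move=> n2; elim: m => [|m IH]; first by [].
have r6 : forall k, rhoA d (at6 [:: z]) k = at6 [:: z] k.
  elim/nat_ind2 => // k IHk.
  rewrite -[LHS]/(at6 [:: z] k.+2 ++ U2 d (rhoA d (at6 [:: z]) k)) IHk.
  by rewrite /at6 /U2; case: (k == 6); rewrite /= ?(negbTE n2) cats0.
rewrite /hA doubleS.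
by rewrite -[LHS]/(rhoA d (at6 [:: z]) m.*2.+4.+4 ++ U1 d (hA d [:: z] m)) r6 IH.
Qed.

Lemma hsym_nil m : hsym d [::] m = [::].
Proof.
have n6 k : at6 [::] k = [::] by rewrite /at6 if_same.
have s6 : forall k, sig d (at6 [::]) k = [::].
  by elim/nat_ind2 => // k IHk; rewrite /= -/(sig d) IHk n6.
have r6 : forall k, rho d (at6 [::]) k = [::].
  by elim/nat_ind2 => // k IHk; rewrite /rho -/(rho d) IHk s6.
rewrite /hsym; elim/nat_ind2: (_.+4.+2) => // k IHk.
by rewrite /alp -/(alp d) IHk r6.
Qed.

(** Since [U3 d] undoes [U1 (- d)], the terms that contain U3 together form h_n of x, and the others
    form [hA]. *)
Lemma hsym_U1 x n : all theta x ->
  perm_eq (hsym d (U1 (- d) x) n.+1) (hA d (U1 (- d) x) n.+1 ++ hsym d x n).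
Proof.
move=> tx; set y := U1 _ x; rewrite /hsym doubleS.
have s6 : forall k, sig d (at6 y) k.+2 = at6 y k.+2 ++ sig d (at6 x) k.
  elim/nat_ind2 => // k IH.
  rewrite -[LHS]/(at6 y k.+4 ++ U3 d (sig d (at6 y) k.+2)) IH U3_cat; congr (_ ++ _).
  rewrite -[RHS]/(at6 x k.+2 ++ U3 d (sig d (at6 x) k)); congr (_ ++ _).
  by rewrite /at6; case: ifP => // _; rewrite U3U1N.
rewrite !alp_alpA.
rewrite -(alpA_shift d (sig d (at6 x))); apply: alpA_perm => -[|[|k]] //.
by rewrite s6.
Qed.

(** The terms of degree m + 1 for direction -d in which U1 does not occur. *)
Definition hR (v : seq W) (m : nat) : seq W := rho (- d) (at6 v) m.*2.+4.+4.

(* The Schur function of shape (m + n + 2, n + 1), as h_m h*_n - h_(m-1) h*_(n-1). *)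
Definition schur (v : seq W) (m n : nat) : seq W :=
  hA d (U1 (- d) (hsym (- d) v m)) n.+1 ++ hsym d (hR v m) n.+1.

(** The subtracted product is found as a sublist, so the Schur function is a list and not merely a
    difference. *)
Lemma hsym_hsym s v m n : ty s v ->
  perm_eq (hsym d (hsym (- d) v m.+1) n.+1)
          (schur v m n ++ hsym d (hsym (- d) v m) n).
Proof.
move=> tv; have th := tyW (ty_hsym m dn0 tv).
rewrite /hsym -/(hsym d) doubleS.
rewrite -[alp (- d) _ m.*2.+4.+4]/(hR v m ++ U1 (- d) (hsym (- d) v m)).
apply: perm_trans (hsym_cat _ _ _ _) _; rewrite perm_catC perm_sym /schur perm_catAC perm_sym.
by rewrite perm_cat2r hsym_U1.
Qed.

Lemma size_schur v m n : (size v <= size (schur v m n))%N.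
Proof.
apply: leq_trans (size_hsym (- d) v m) _.
rewrite /schur (size_cat (hA _ _ _)); apply: leq_trans (leq_addr _ _).
by apply: leq_trans (size_hA _ _ _); rewrite size_map.
Qed.

Lemma ok2_u1N w : theta w -> ok2 d (u1 (- d) w) = ok2 d w.
Proof.
move=> tw; have [th1 _] := u1P dn0 tw.
by rewrite -[LHS](ok3N d0) // (ok3_u1 dn0) // opprK.
Qed.

Lemma iter_u1N w n : theta w ->
  theta (iter n (u1 (- d)) w) /\ ok2 d (iter n (u1 (- d)) w) = ok2 d w.
Proof.
move=> tw; elim: n => //= n [th <-]; split; last exact: ok2_u1N.
by have [] := u1P dn0 th.
Qed.

Lemma schur_single z m n : theta z -> ~~ ok2 d z -> ~~ ok3 d z ->
  schur [:: z] m n = [:: iter n.+1 (u1 d) (iter m.+1 (u1 (- d)) z)].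
Proof.
move=> tz n2 n3; have [tm okm] := iter_u1N m tz.
have n2N : ~~ ok2 (- d) z by rewrite -(ok3N dn0) // opprK.
have n3N : ~~ ok3 (- d) z by rewrite ok3N.
rewrite /schur hsym_single // [U1 _ _]/= -iterS hA_single; last first.
  by have [_ ->] := iter_u1N m.+1 tz.
suff -> : hR [:: z] m = [::] by rewrite hsym_nil.
have := hsym_single m.+1 n2N n3N; rewrite /hsym doubleS.
rewrite -[alp (- d) _ _]/(hR [:: z] m ++ U1 (- d) (hsym (- d) [:: z] m)).
by rewrite hsym_single //=; case: (hR _ _) => //= a [].
Qed.

Lemma theta_base w : theta w -> exists n m w0,
  [/\ theta w0, ~~ ok2 d w0, ~~ ok3 d w0 &
    w = iter n (u1 d) (iter m (u1 (- d)) w0)].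
Proof.
have base2 x : theta x -> ~~ ok2 d x -> exists m w0,
    [/\ theta w0, ~~ ok2 d w0, ~~ ok3 d w0 & x = iter m (u1 (- d)) w0].
  have [k] := ubnP (length x); elim: k => // k IH in x *; rewrite ltnS => le_k tx n2.
  have [ok|n3] := boolP (ok3 d x); last by exists 0%N, x.
  have [t3 E] := u1_u3N dn0 tx
    (etrans (esym (ok3N dn0 tx)) (etrans (congr1 (ok3^~ x) (opprK d)) ok)).
  rewrite opprK in t3 E.
  have [||m [w0 [t0 n2' n3 E0]]] := IH (u3 d x) _ t3.
  - by rewrite -E length_u1 // in le_k; lia.
  - by rewrite -(ok2_u1N t3) E.
  by exists m.+1, w0; rewrite iterS -E0.
have [k] := ubnP (length w); elim: k => // k IH in w *; rewrite ltnS => le_k tw.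
have [ok|nok] := boolP (ok2 d w).
  have [t3 E] := u1_u3N d0 tw ok.
  have [|n [m [w0 [t0 n2 n3 E0]]]] := IH (u3 (- d) w) _ t3.
    by rewrite -E length_u1 // in le_k; lia.
  by exists n.+1, m, w0; rewrite iterS -E0.
by have [m [w0 [t0 n2 n3 E0]]] := base2 w tw nok; exists 0%N, m, w0.
Qed.

End Schur.

(* [w0] is the longest element of the parabolic subgroup of its two left
   descents, or that element times the third generator. *)
Lemma base_word (d : 'I_3) w : d != 0 -> theta w -> ~~ ok2 d w -> ~~ ok3 d w ->
  exists2 x, w = (gen (asc w + d) * (gen (asc w - d) * (gen (asc w + d) * x)))%g &
    x = 1%g \/ x = gen (asc w).
Proof.
move=> d0 tw; have [] := theta_cases d0 tw; rewrite /ok2 /ok3 /u2 /u3; set s := asc w.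
move=> n1 n2 n3 n4 n5.
pose x := (gen (s + d) * (gen (s - d) * (gen (s + d) * w)))%g.
exists x; first by rewrite !genK.
have [ds|nds] := boolP (desc s x).
  right; suff E : (gen s * x)%g = 1%g by rewrite -[x](genK s) E mulg1.
  apply: no_desc => i.
  move: d0 ds n1 n2 n3 n4 n5; rewrite {}/x; move: (s) => s'; win_cases w.
  by elim/ord3_ind: s'; elim/ord3_ind: (d); elim/ord3_ind: i => //= *; lia.
left; apply: no_desc => i; move: d0 nds n1 n2 n3 n4 n5; rewrite {}/x; move: (s) => s'.
win_cases w; by elim/ord3_ind: s'; elim/ord3_ind: (d); elim/ord3_ind: i => //= *; lia.
Qed.

Section Transfer.
Variable K : klRing.
Local Notation H := (kl_ring K).
Local Notation c := (@kl_c K).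
Local Notation b := (@kl_b K).
Local Notation Phi := (sumB K).
Local Notation PhiE := (sumE K).

Lemma Phi_perm x y : perm_eq x y -> Phi x = Phi y.
Proof. by move=> xy; apply: perm_big. Qed.

Lemma Phi1 w : Phi [:: w] = b w.
Proof. exact: big_seq1. Qed.

Lemma Phi_Ue (d s : 'I_3) x : d != 0 -> ty s x ->
  Phi (Ue d x) = c (s - d) * (c s * Phi x) - Phi x.
Proof. by move=> d0 tx; rewrite (c_asc tx) (c_Ue d0 tx) addrC addKr. Qed.

Definition transfer (h : H) (s : 'I_3) (x v : seq W) : Prop :=
  [/\ ty s x, ty s v & Phi x * h = Phi v].

(** On lists of one type [Ue d] is left multiplication by c_(s-d) c_s - 1, so it commutes with right
    multiplication by h. *)
Lemma transfer_Ue h (d s : 'I_3) x v : d != 0 -> transfer h s x v ->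
  Phi (Ue d x) * h = Phi (Ue d v).
Proof.
by move=> d0 [tx tv E]; rewrite !(Phi_Ue d0 (s := s)) // mulrBl -!mulrA E.
Qed.

Lemma transfer_hsym h (d s : 'I_3) x v m : d != 0 -> transfer h s x v ->
  transfer h (s + d *+ m) (hsym d x m) (hsym d v m).
Proof.
move=> d0 R; have [tx tv E] := R.
pose Q k := Phi (hsym d x k) * h = Phi (hsym d v k).
have trQ k : Q k -> transfer h (s + d *+ k) (hsym d x k) (hsym d v k).
  by move=> Ek; split => //; apply: ty_hsym.
suff [Q0 _ _] : [/\ Q m, Q m.+1 & Q m.+2] by exact: trQ.
have thx := tyW tx; have thv := tyW tv.
have Q0 : Q 0%N by rewrite /Q !hsym0.
have Q1 : Q 1%N.
  have hx : Phi (hsym d x 1) = Phi (Ue d x) := hsym1 b d0 thx.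
  have hv : Phi (hsym d v 1) = Phi (Ue d v) := hsym1 b d0 thv.
  by rewrite /Q hx hv (transfer_Ue d0 R).
have Q2 : Q 2%N.
  have hx : Phi (hsym d x 2) + Phi (Ue (- d) x) = Phi (Ue d (hsym d x 1)) :=
    hsym2 b d0 thx.
  have hv : Phi (hsym d v 2) + Phi (Ue (- d) v) = Phi (Ue d (hsym d v 1)) :=
    hsym2 b d0 thv.
  have := transfer_Ue d0 (trQ _ Q1); rewrite -hx -hv mulrDl (transfer_Ue (dir_opp d0) R).
  exact: addIr.
elim: m => [|m [h0 h1 h2]]; split => //.
have hx : Phi (hsym d x m.+3) + Phi (Ue (- d) (hsym d x m.+1)) =
  Phi (Ue d (hsym d x m.+2)) + Phi (hsym d x m) := hsym_rec b m d0 thx.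
have hv : Phi (hsym d v m.+3) + Phi (Ue (- d) (hsym d v m.+1)) =
  Phi (Ue d (hsym d v m.+2)) + Phi (hsym d v m) := hsym_rec b m d0 thv.
apply: (addIr (Phi (Ue (- d) (hsym d v m.+1)))); rewrite hv -(transfer_Ue d0 (trQ _ h2)) -h0.
by rewrite -(transfer_Ue (dir_opp d0) (trQ _ h1)) -!mulrDl hx.
Qed.

(** b_w is a Schur function applied to b_(w0); as this commutes with right multiplication by h, b_w
    h is the same Schur function applied to v, a list at least as long as v. *)
Lemma theta_mul (d : 'I_3) w : d != 0 -> theta w -> exists w0,
  [/\ theta w0, ~~ ok2 d w0, ~~ ok3 d w0 &
    forall h v, ty (asc w0) v -> b w0 * h = Phi v ->
    exists v', [/\ all theta v', (size v <= size v')%N & b w * h = Phi v']].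
Proof.
move=> d0 tw; have dn0 := dir_opp d0.
have [n [m [w0 [t0 n2 n3 wE]]]] := theta_base d0 tw; exists w0; split=> // h v tv E.
have R : transfer h (asc w0) [:: w0] v by split; rewrite ?Phi1 //= t0 eqxx.
have n2N : ~~ ok2 (- d) w0 by rewrite -(ok3N dn0) // opprK.
have n3N : ~~ ok3 (- d) w0 by rewrite ok3N.
rewrite -Phi1 {w tw}wE; have Rm k := transfer_hsym k dn0 R.
have Rnm k l := transfer_hsym l d0 (Rm k).
case: m => [|m].
  have := transfer_hsym n d0 R; rewrite hsym_single // => -[_ tv' E'].
  by exists (hsym d v n); rewrite E' size_hsym (tyW tv').
case: n => [|n].
  have := Rm m.+1; rewrite hsym_single // => -[_ tv' E'].
  by exists (hsym (- d) v m.+1); rewrite E' size_hsym (tyW tv').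
exists (schur d v m n); rewrite size_schur -schur_single //.
have [_ t1 E1] := Rnm m.+1 n.+1; have [_ _ E0] := Rnm m n.
have t0' : ty (asc w0) [:: w0] by rewrite /= t0 eqxx.
have P0 := hsym_hsym d0 m n t0'; have P1 := hsym_hsym d0 m n tv.
split => //.
  by move: (tyW t1); rewrite (perm_all _ P1) all_cat => /andP[].
move: E1; rewrite (Phi_perm P0) (Phi_perm P1) (Phi_cat (schur d [:: w0] m n)) (Phi_cat (schur d v m n))
  mulrDl E0.
exact: addIr.
Qed.

End Transfer.

(** * Left multiplication by the smallest basis elements of the cell *)

Section Projective.
Variable K : klRing.
Local Notation H := (kl_ring K).
Local Notation c := (@kl_c K).
Local Notation b := (@kl_b K).
Local Notation Phi := (sumB K).
Local Notation PhiE := (sumE K).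
Variables d s : 'I_3.
Hypothesis d0 : d != 0.
Local Notation t := (s + d).
Local Notation u := (s - d).

Let dn0 : - d != 0. Proof. exact: dir_opp. Qed.

(* Left multiplication by the basis element of the word [t u t]. *)
Definition tut (h : H) : H := c t * (c u * (c t * h)) - c t * h.

(** With both forms available, the generator applied first can be chosen to be the missing descent
    of the argument when that is t or u. *)
Lemma tut_braid h : tut h = c u * (c t * (c u * h)) - c u * h.
Proof.
have [_ _ n3] := dir_neq s d0; rewrite /tut !mulrA -!mulrBl; congr (_ * _).
by apply: c_braid; rewrite eq_sym.
Qed.

Lemma tutD g h : tut (g + h) = tut g + tut h.
Proof. by rewrite /tut !mulrDr opprD addrACA. Qed.

Lemma size_Ue e x : (size x <= size (Ue e x))%N.
Proof. by rewrite /Ue size_cat size_map leq_addr. Qed.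

Lemma tut_Phi a x : ty a x ->
  exists v, [/\ ty s v, (size x <= size v)%N & tut (Phi x) = Phi v].
Proof.
have [n1 n2 n3] := dir_neq s d0; move=> tx.
have [aE|na] := eqVneq a s.
  have ct : c t * Phi x = Phi x *+ 2 by apply: c_des tx; rewrite aE eq_sym.
  have cu : c u * Phi x = Phi x *+ 2 by apply: c_des tx; rewrite aE eq_sym.
  exists (x ++ x ++ x ++ x ++ x ++ x); rewrite -aE !ty_cat tx !size_cat leq_addr.
  by split=> //; rewrite !Phi_cat /tut ct mulrnAr cu !mulrnAr ct; zmod.
have [aE|na'] := eqVneq a u.
  have tU : ty s (Ue d x) by rewrite -(dir_subK d s).1.1.2 -aE; apply: ty_Ue.
  have ct : c t * PhiE x = Phi x + Phi (Ue d x).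
    by rewrite -(c_Ue d0 tx) aE dir_subK.
  have cu : c u * Phi (Ue d x) = Phi (Ue d x) *+ 2 by apply: c_des tU; rewrite eq_sym.
  exists (Ue d x ++ Ue d x); rewrite ty_cat tU size_cat; split=> //.
    exact: leq_trans (size_Ue d x) (leq_addr _ _).
  rewrite tut_braid -aE (c_asc tx) ct mulrDr [in c a * Phi (Ue d x)]aE cu (c_asc tx).
  by rewrite Phi_cat; zmod.
have aE := dir_cases d0 na na'.
have tU : ty s (Ue (- d) x) by rewrite -(dir_subK d s).1.1.1 -aE; apply: ty_Ue.
have cu : c u * PhiE x = Phi x + Phi (Ue (- d) x).
  by rewrite -(c_Ue dn0 tx) opprK aE dir_subK.
have ct : c t * Phi (Ue (- d) x) = Phi (Ue (- d) x) *+ 2.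
  by apply: c_des tU; rewrite eq_sym.
exists (Ue (- d) x ++ Ue (- d) x); rewrite ty_cat tU size_cat; split=> //.
  exact: leq_trans (size_Ue (- d) x) (leq_addr _ _).
rewrite /tut -aE (c_asc tx) cu mulrDr [in c a * Phi (Ue _ x)]aE ct (c_asc tx).
by rewrite Phi_cat; zmod.
Qed.

Lemma tut_PhiE a x : ty a x ->
  exists v, [/\ ty s v, (size x <= size v)%N & tut (PhiE x) = Phi v].
Proof.
have [n1 n2 n3] := dir_neq s d0; move=> tx.
have [aE|na] := eqVneq a s.
  set y := Ue (- d) x; have ty_y : ty u y by rewrite -aE; apply: ty_Ue.
  have tU : ty s (Ue d y) by rewrite -{1}(dir_subK d s).1.1.2; apply: ty_Ue.
  have ct : c t * PhiE x = Phi x + Phi y by rewrite -(c_Ue dn0 tx) opprK aE.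
  have cu : c u * Phi x = Phi x *+ 2 by apply: c_des tx; rewrite aE eq_sym.
  have ct2 : c t * Phi x = Phi x *+ 2 by apply: c_des tx; rewrite aE eq_sym.
  have ct3 : c t * PhiE y = Phi y + Phi (Ue d y).
    by rewrite -(c_Ue d0 ty_y) dir_subK.
  exists (x ++ x ++ x ++ Ue d y); rewrite !(ty_cat _ x) tU -aE tx !size_cat leq_addr.
  split=> //; rewrite !(Phi_cat x) /tut ct mulrDr cu (c_asc ty_y) mulrDr mulrnAr ct2 ct3.
  zmod.
have [aE|na'] := eqVneq a u.
  have [v [tv sv Ev]] := tut_Phi tx; exists (v ++ v).
  rewrite ty_cat tv size_cat Phi_cat -Ev; split => //; first exact: leq_trans sv (leq_addr _ _).
  by rewrite !tut_braid -aE (c_ascE tx) (c_asc tx) !mulrnAr -mulrnBl mulr2n.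
have aE := dir_cases d0 na na'.
have [v [tv sv Ev]] := tut_Phi tx; exists (v ++ v).
rewrite ty_cat tv size_cat Phi_cat -Ev; split => //; first exact: leq_trans sv (leq_addr _ _).
by rewrite /tut -aE (c_ascE tx) (c_asc tx) !mulrnAr; zmod.
Qed.

Lemma tut_pos n h : pos n h ->
  exists v, [/\ ty s v, (n <= size v)%N & tut h = Phi v].
Proof.
have t1 w : theta w -> ty (asc w) [:: w] by move=> tw; rewrite /= tw eqxx.
have HP x : all theta x -> exists v, [/\ ty s v, (size x <= size v)%N & tut (Phi x) = Phi v].
  elim: x => [_|w x IH /andP[/t1/tut_Phi[v' [tv' sv' Ev']] /IH[v [tv sv Ev]]]].
    by exists [::]; rewrite !Phi_nil /tut !mulr0 subr0.
  exists (v' ++ v); rewrite ty_cat tv' tv size_cat Phi_cat -Ev -Ev' -tutD -Phi_cat.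
  by split=> //; exact: leq_add sv' sv.
have HE x : all theta x -> exists v, [/\ ty s v, (size x <= size v)%N & tut (PhiE x) = Phi v].
  elim: x => [_|w x IH /andP[/t1/tut_PhiE[v' [tv' sv' Ev']] /IH[v [tv sv Ev]]]].
    by exists [::]; rewrite /sumE big_nil Phi_nil /tut !mulr0 subr0.
  exists (v' ++ v); rewrite ty_cat tv' tv size_cat Phi_cat -Ev -Ev' -tutD -PhiE_cat.
  by split=> //; exact: leq_add sv' sv.
move=> [x [y [/HP[v [tv sv Ev]] /HE[v' [tv' sv' Ev']] -> <-]]].
exists (v ++ v'); rewrite ty_cat tv tv' size_cat Phi_cat -Ev -Ev' tutD.
by split=> //; exact: leq_add sv sv'.
Qed.

Lemma c_pos (i : 'I_3) n h : pos n h -> exists2 n', (n <= n')%N & pos n' (c i * h).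
Proof.
move=> hn; suff [n' le_n hn'] : exists2 n', (1 * n <= n')%N & pos n' (c i * h).
  by exists n'; rewrite // -[n]mul1n.
have p1 w : theta w -> all theta [:: w] by rewrite /= andbT.
apply: (pos_map hn) => w tw.
  have [->|ni] := eqVneq i (asc w).
    by exists 1%N => //; have := pos_PhiE K (p1 _ tw); rewrite /sumE big_seq1.
  exists (2 * 1)%N => //; rewrite b_desc ?theta_desc //; apply: posMn.
  by rewrite -Phi1; apply: (pos_Phi K (p1 _ tw)).
have [->|ni] := eqVneq i (asc w).
  exists (2 * 1)%N => //; rewrite mulrA c_sq mulrnAl; apply: posMn.
  by have := pos_PhiE K (p1 _ tw); rewrite /sumE big_seq1.
have [e [e0 ie]] : exists e : 'I_3, e != 0 /\ i = asc w - e.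
  by exists (asc w - i); rewrite subr_eq0 eq_sym ni opprB addrC subrK.
have tw1 : ty (asc w) [:: w] by rewrite /= tw eqxx.
have := c_Ue (K := K) e0 tw1; rewrite -ie /sumE big_seq1 => ->.
exists (1 + size (Ue e [:: w]))%N => //; apply: posD.
  by apply: (pos_Phi K (p1 _ tw)).
exact/pos_Phi/(tyW (ty_Ue e0 tw1)).
Qed.

Lemma b_tut x h : x = 1%g \/ x = gen s ->
  b (gen t * (gen u * (gen t * x)))%g * h = tut (b x * h).
Proof.
have [n1 n2 n3] := dir_neq s d0; move=> xE.
have n4 : t != s by rewrite eq_sym.
have n5 : u != s by rewrite eq_sym.
have n6 : t != u by rewrite eq_sym.
have ds k : k != s -> ~~ desc k (gen s).
  move=> nk; have nks : s != k by rewrite eq_sym.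
  by have [+ _ _] := desc_min nks (desc1 s) (desc1 k); rewrite mulg1 => ->.
have dx k : k != s -> ~~ desc k x by case: xE => ->; [move=> _; apply: desc1 | apply: ds].
have lx : (length x <= 1)%N.
  case: xE => ->; rewrite ?length1 // -[gen s]mulg1 length_up ?length1 //; exact: desc1.
have ntx := dx _ n4; have nux := dx _ n5.
have [nd1 nd2 _] := desc_min n6 ntx nux.
have l1 : length (gen t * x)%g = (length x).+1 by rewrite length_up.
have e1 : c t * b x = b (gen t * x)%g.
  case: xE => xE; first by rewrite xE b_gen mulg1.
  have dsx : desc s x by rewrite xE -[gen s]mulg1 desc_gen desc1.
  have lx3 : (length x <= 3)%N by apply: leq_trans lx _.
  rewrite (b_short n4 ntx dsx lx3) xE -[X in desc _ (_ * X)%g]mulg1 genK.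
  by rewrite (negbTE (desc1 t)) addr0.
have e2 : c u * b (gen t * x)%g = b (gen u * (gen t * x))%g.
  have dt : desc t (gen t * x)%g by rewrite desc_gen.
  have l3 : (length (gen t * x)%g <= 3)%N by rewrite l1 ltnS; apply: leq_trans lx _.
  by rewrite (b_short n3 (negbT nd1) dt l3) genK (negbTE nux) addr0.
have e3 : c t * b (gen u * (gen t * x))%g =
    b (gen t * (gen u * (gen t * x)))%g + b (gen t * x)%g.
  have du : desc u (gen u * (gen t * x))%g by rewrite desc_gen nd1.
  have l3 : (length (gen u * (gen t * x))%g <= 3)%N by rewrite length_up ?nd1 // l1 !ltnS.
  by rewrite (b_short n6 (negbT nd2) du l3) genK desc_gen ntx.
by rewrite /tut !mulrA -mulrBl -!mulrA e1 e2 e3 addrK.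
Qed.

Lemma base_pos x n h : x = 1%g \/ x = gen s -> pos n h ->
  exists v, [/\ ty s v, (n <= size v)%N &
    b (gen t * (gen u * (gen t * x)))%g * h = Phi v].
Proof.
move=> xE hn; rewrite (b_tut h xE); case: xE => ->.
  by rewrite kl_b1 mul1r; apply: tut_pos.
rewrite -b_gen kl_b1 mulr1; have [n' le_n /tut_pos[v [tv sv ->]]] := c_pos s hn.
by exists v; split => //; apply: leq_trans sv.
Qed.

End Projective.

Lemma theta_pos (K : klRing) w n h : theta w -> pos n h ->
  exists2 n', (n <= n')%N & pos n' (@kl_b K w * h).
Proof.
have d0 : (1 : 'I_3) != 0 by [].
move=> tw hn; have [w0 [t0 n2 n3 E]] := theta_mul K d0 tw.
have [x w0E xE] := base_word d0 t0 n2 n3.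
have [v [tv sv Ev]] := base_pos d0 xE hn; rewrite -w0E in Ev.
have [v' [tv' sv' ->]] := E h v tv Ev.
by exists (size v'); [apply: leq_trans sv' | apply: pos_Phi].
Qed.

(** * Specialisation at v = 1 *)

Lemma laurent_at1D a a' : laurent_at1 (a + a') = laurent_at1 a + laurent_at1 a'.
Proof. exact: (supp_sumD (F := fun (_ : vexp) (x : int) => x)). Qed.

Lemma laurent_at1U x (k : vexp) : laurent_at1 << x *g k >> = x.
Proof. exact: (supp_sumU (F := fun (_ : vexp) (x : int) => x)). Qed.

Lemma laurent_at1_vpow j a : laurent_at1 (vpow j * a) = laurent_at1 a.
Proof.
have at10 : laurent_at1 0 = 0 by apply: (addrI (laurent_at1 0)); rewrite -laurent_at1D !addr0.
rewrite (monalgE a) mulr_sumr !(big_morph laurent_at1 laurent_at1D at10).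
by apply: eq_bigr => k _; rewrite /vpow laurentUU !laurent_at1U mul1r.
Qed.

Lemma one_add_sq (A : nzRingType) (p : A) : p * p = 1 -> (1 + p) * (1 + p) = (1 + p) *+ 2.
Proof. by move=> pp; rewrite mulrDl mul1r mulrDr mulr1 pp [X in _ + X]addrC mulr2n. Qed.

Lemma one_add_braid (A : nzRingType) (p q : A) : p * p = 1 -> q * q = 1 ->
  p * q * p = q * p * q ->
  (1 + p) * (1 + q) * (1 + p) - (1 + p) = (1 + q) * (1 + p) * (1 + q) - (1 + q).
Proof.
move=> pp qq pqp; rewrite !mulrDl !mulrDr !mul1r !mulr1 !mulrDl !mul1r pp qq pqp; zmod.
Qed.

Section Specialisation.
Variable R : realType.

Local Notation sp := (specialize R).

Lemma spD g h : sp (g + h) = sp g + sp h.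
Proof.
apply: (supp_sumD (F := fun w (a : laurent) => (laurent_at1 a)%:~R *: gdelta R w)).
  move=> w; have -> : laurent_at1 0 = 0; last by rewrite scale0r.
  by apply: (addrI (laurent_at1 0)); rewrite -laurent_at1D !addr0.
by move=> w a b; rewrite laurent_at1D intrD scalerDl.
Qed.

Lemma spU a w : sp << a *g w >> = (laurent_at1 a)%:~R *: gdelta R w.
Proof.
apply: (supp_sumU (F := fun w (a : laurent) => (laurent_at1 a)%:~R *: gdelta R w)).
move=> y; have -> : laurent_at1 0 = 0; last by rewrite scale0r.
by apply: (addrI (laurent_at1 0)); rewrite -laurent_at1D !addr0.
Qed.

Definition hc (i : 'I_3) : hecke R := 1 + gdelta R (gen i).

Lemma gdeltaM x y : (gdelta R x : hecke R) * gdelta R y = gdelta R (x * y)%g.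
Proof. by apply: etrans (gmulUU _ _ _ _) _; rewrite mulr1. Qed.

Lemma gdeltaZ (a : R) x : a *: (gdelta R x : hecke R) = << a *g x >>.
Proof. by apply/malgP => y; rewrite mcoeffZ !mcoeffU mulrnAr mulr1. Qed.

Lemma gdeltaMZ x (a : R) y :
  (gdelta R x : hecke R) * (a *: gdelta R y) = a *: gdelta R (x * y)%g.
Proof. by rewrite !gdeltaZ; apply: etrans (gmulUU _ _ _ _) _; rewrite mul1r. Qed.

Lemma gdelta_gg i : (gdelta R (gen i) : hecke R) * gdelta R (gen i) = 1.
Proof. by rewrite gdeltaM -{2}[gen i]mulg1 genK. Qed.

Lemma hc_sq i : hc i * hc i = hc i *+ 2.
Proof. exact/one_add_sq/gdelta_gg. Qed.

Lemma hc_braid i j : i != j -> hc i * hc j * hc i - hc i = hc j * hc i * hc j - hc j.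
Proof.
move=> nij; apply: one_add_braid; try exact: gdelta_gg.
rewrite !gdeltaM -!mulgA; congr (gdelta R _).
by have := gen_braid i j 1%g; rewrite !mulg1.
Qed.

Lemma sp_cmul i h : sp (cmul i h) = hc i * sp h.
Proof.
have sp0 : sp 0 = 0 by apply: (addrI (sp 0)); rewrite -spD !addr0.
elim/genHecke_ind: h => [|g h IHg IHh|a w].
- have -> : cmul i 0 = 0 by apply: (addrI (cmul i 0)); rewrite -cmulD !addr0.
  by rewrite sp0 mulr0.
- apply: etrans (congr1 sp (cmulD i g h)) _.
  apply: etrans (spD (cmul i g) (cmul i h)) _.
  apply: etrans (congr2 +%R IHg IHh) _.
  apply: etrans (esym (mulrDr (hc i) (sp g) (sp h))) _.
  by congr (_ * _); exact: esym (spD g h).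
have spv j : sp (vshift j << a *g w >>) = sp << a *g w >>.
  by rewrite (vshiftU j a w) (spU (vpow j * a) w) (laurent_at1_vpow j a) (spU a w).
pose y : genHecke := if desc i w then vshift (-1) << a *g w >> - vshift 1 << a *g w >> else 0.
have sy : sp y = 0.
  rewrite /y; case: (desc i w); last exact: sp0.
  apply: (addIr (sp (vshift 1 << a *g w >>))); rewrite -(spD _ (vshift 1 << a *g w >>)).
  by rewrite add0r (spv 1) -(spv (-1)); congr sp; exact: subrK.
have -> : cmul i << a *g w >> = << a *g (gen i * w)%g >> + y + vshift 1 << a *g w >>.
  by congr (_ + _); exact: lmul_genU.
rewrite (spD (_ + y)) (spD _ y) sy addr0 (spv 1) (spU a (gen i * w)%g) (spU a w).
apply: esym; apply: etrans (mulrDl _ _ _) _; rewrite mul1r [RHS]addrC.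
by congr (_ + _); apply: gdeltaMZ.
Qed.

End Specialisation.

Section Basis.
Variable R : realType.
Local Notation sp := (specialize R).

Variable B : W -> genHecke.
Hypothesis hB : is_KL_basis B.

Let cfB1 w k : cf (B w) w k = (k == 0)%:R.
Proof.
have [_ E _] := hB w; rewrite /cf E -vpow0 /vpow /gdelta mcoeffU eq_sym.
by case: eqP.
Qed.

Let cfB0 w y k : y != w -> k <= 0 -> cf (B w) y k = 0.
Proof. by have [_ _ E] := hB w => nyw k0; apply: E. Qed.

Let barB w : bar (B w) = B w.
Proof. by have [] := hB w. Qed.

Let supp (h : genHecke) : seq W := enum_fset (msupp h).

Let supp_uniq h : uniq (supp h).
Proof. exact: fset_uniq. Qed.

Let sp_B1 : sp (B 1%g) = 1.
Proof.
have -> : B 1%g = delta 1%g.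
  apply: cfP => y k; rewrite cf_delta.
  have [<-|ne] := eqVneq 1%g y; first by rewrite cfB1.
  apply/eqP; apply: contraT => /(B_supp supp_cf bar_lead barB cfB0)[/esym/eqP|].
    by rewrite (negbTE ne).
  by rewrite length1.
by rewrite spU laurent_at1U scale1r.
Qed.

Definition KL_at1 : klRing := @KLRing (hecke R) (@hc R) (fun x => sp (B x))
  (@hc_sq R) (@hc_braid R) sp_B1
  (spB_desc cfP cfD supp_uniq supp_cf cf_cmul barD bar_cmul bar_lead barB cfB1 cfB0
     (@hc_sq R) (@spD R) (@sp_cmul R))
  (spB_gen cfP cfD supp_uniq supp_cf cf_cmul barD bar_cmul bar_lead barB cfB1 cfB0
     (@spD R) (@sp_cmul R))
  (spB_theta cfP cfD supp_uniq supp_cf cf_cmul barD bar_cmul bar_lead barB cfB1 cfB0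
     (@spD R) (@sp_cmul R))
  (spB_E cfP cfD supp_uniq supp_cf cf_cmul barD bar_cmul bar_lead barB cfB1 cfB0
     (@spD R) (@sp_cmul R))
  (spB_short cfP cfD supp_uniq supp_cf cf_cmul barD bar_cmul bar_lead barB cfB1 cfB0
     (@spD R) (@sp_cmul R))
  (spB_wall cfP cfD supp_uniq supp_cf cf_cmul barD bar_cmul bar_lead barB cfB1 cfB0
     (@spD R) (@sp_cmul R)).

End Basis.

(** * Two-sided cells *)

(** Prepending an ascent continues a cyclic word or turns it into an element with two descents; an
    element with two descents has only the ascent [asc], and a further generator then gives some
    [u1]. *)
Lemma W_cases w : [\/ w = 1%g, exists d i m, [/\ d != 0, (0 < m)%N & w = wall d i m],
  theta w | exists2 v, theta v & w = (gen (asc v) * v)%g].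
Proof.
elim/W_ind: w => [|i w ndi [w1|[d [j [m [d0 m0 wE]]]]|tw|[v tv wE]]]; first by constructor 1.
- by constructor 2; exists 1, i, 1%N; rewrite w1.
- have nij : i != j by apply: contraNneq ndi => ->; rewrite wE wall_desc // m0 eqxx.
  have [ji|nji] := eqVneq j (i + d).
    by constructor 2; exists d, i, m.+1; rewrite wE ji.
  have iE : i = j + d.
    apply: (dir_cases d0 nij); apply: contraNneq nji => ->.
    by rewrite (dir_subK d j).1.1.2.
  case: m m0 wE => [|[|m]] // _ wE.
    (* A word of one letter is cyclic in both directions, so here the direction is reversed. *)
    constructor 2; exists (- d), i, 2%N; split; [exact: dir_opp|by []|].
    by rewrite wE iE /= addrK.
  by constructor 3; rewrite wE iE; case: (top_theta d0 j (ltn0Sn m.+1 : (1 < m.+2)%N)).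
- constructor 4; exists w => //; congr (gen _ * _)%g; apply/eqP.
  by move: ndi; rewrite theta_desc // negbK.
have dv : desc (asc v) w by rewrite wE desc_gen theta_desc // eqxx.
have nia : i != asc v by apply: contraNneq ndi => ->.
constructor 3; have [e [e0 iE]] : exists e : 'I_3, e != 0 /\ i = asc v - e.
  by exists (asc v - i); rewrite subr_eq0 eq_sym nia opprB addrC subrK.
by rewrite wE iE -/(u1 e v); case: (u1P e0 tv).
Qed.

Lemma cyclic_cellP w : cyclic_cell w <-> exists d i m, d != 0 /\ w = wall d i m.+1.
Proof.
have walk (d : 'I_3) (e : rel 'I_3) (eE : forall i j, e i j = (j == i + d)) s i :
    path e i s -> of_word (i :: s) = wall d i (size s).+1.
  elim: s i => [|j s IH] i /=; first by rewrite -gen_word.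
  rewrite eE => /andP[/eqP jE /IH sE]; rewrite -gen_word sE jE //.
have walkV (d : 'I_3) (e : rel 'I_3) (eE : forall i j, e i j = (j == i + d)) m i :
    exists2 s, path e i s & of_word (i :: s) = wall d i m.+1.
  elim: m i => [|m IH] i; first by exists [::]; rewrite -?gen_word.
  have [s ps sE] := IH (i + d); exists (i + d :: s); first by rewrite /= eE eqxx.
  by rewrite -gen_word sE.
have e1 (i j : 'I_3) : (j == i + 1) = (j == i + 1) by [].
have e2 (i j : 'I_3) : (i == j + 1) = (j == i + (-1)).
  by apply/eqP/eqP => ->; rewrite ?addrK ?subrK.
split=> [[i [s [<- [p|p]]]]|[d [i [m [d0 ->]]]]].
- by exists 1, i, (size s); split; last exact: walk e1 _ _ p.
- by exists (-1), i, (size s); split; last exact: walk e2 _ _ p.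
have [->|->] : d = 1 \/ d = -1.
  by move: d0; elim/ord3_ind: d => // _; [left|right]; apply/val_inj.
- by have [s ps sE] := walkV 1 _ e1 m i; exists i, s; split; [|left].
- by have [s ps sE] := walkV (-1) _ e2 m i; exists i, s; split; [|right].
Qed.

Lemma wall_not_theta (d i : 'I_3) m : d != 0 -> ~~ theta (wall d i m).
Proof.
move=> d0; apply/negP => tw; have [_] := theta_cases d0 tw.
rewrite !wall_desc // => /andP[_ /eqP E1] /andP[_ /eqP E2].
by have [_ _] := dir_neq (asc (wall d i m)) d0; rewrite E1 E2 eqxx.
Qed.

Lemma proj_theta w : theta w -> proj_cell w /\ proj_cell (gen (asc w) * w)%g.
Proof.
move=> tw; have dw : ~~ desc (asc w) w by rewrite theta_desc // eqxx.
split; split.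
- by move=> w1; have := wall_not_theta 0 0 (isT : (1 : 'I_3) != 0); rewrite /= -w1 tw.
- by move/cyclic_cellP => [d [i [m [d0 wE]]]]; have := wall_not_theta i m.+1 d0; rewrite -wE tw.
- by move=> w1; have := desc_gen (asc w) w; rewrite w1 dw (negbTE (desc1 _)).
move/cyclic_cellP => [d [i [m [d0 wE]]]].
have ai : asc w = i.
  by have := desc_gen (asc w) w; rewrite dw wE wall_desc // => /eqP.
move: wE => /= /(congr1 (fun x => (gen i * x)%g)); rewrite ai !genK => wE.
by have := wall_not_theta (i + d) m d0; rewrite -wE tw.
Qed.

Lemma wall_cyclic (d i : 'I_3) m : d != 0 -> (0 < m)%N -> ~ proj_cell (wall d i m).
Proof.
by case: m => // m d0 _ [_]; apply; apply/cyclic_cellP; exists d, i, m.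
Qed.

Lemma wall_parabolic (d i : 'I_3) m : (m <= 2)%N ->
  parabolic [set j | (j == i) || (j == i + d)]%SET (wall d i m).
Proof.
move=> m2; have mem1 : all (mem [set j | (j == i) || (j == i + d)]%SET) [:: i; i + d].
  by rewrite /= !inE !eqxx orbT.
case: m m2 => [|[|[|m]]] // _.
- by exists [::].
- by exists [:: i]; move: mem1 => /= /andP[-> _]; rewrite -gen_word.
- by exists [:: i; i + d]; rewrite mem1 -!gen_word.
Qed.

(** * Growth of powers and the limit *)

Section Asymptotics.
Variable R : realType.
Local Open Scope classical_set_scope.

Lemma cvg_ratio (f : nat -> R) : (forall n, exists C s : nat,
    [/\ (C <= 2 ^ n.+1)%N, (3 ^ n <= s)%N & f n.+2 = (C + s)%:R / s%:R]) ->
  f @ \oo --> (1 : R).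
Proof.
move=> Hf; rewrite -(cvg_shiftn 2).
apply: (@squeeze_cvgr _ _ _ _ (fun=> 1) (fun n => 1 + 2 * (2 / 3 : R) ^+ n)).
- apply: nearW => n; have [C [s [C2 s3]]] := Hf n; rewrite /= addn2 => ->.
  have s0 : (0 : R) < s%:R by rewrite ltr0n; apply: leq_trans s3; rewrite expn_gt0.
  rewrite natrD mulrDl divff ?gt_eqF // addrC lerDl divr_ge0 //= lerD2l.
  rewrite ler_pdivrMr //; apply: (@le_trans _ _ (2 ^ n.+1)%:R); first by rewrite ler_nat.
  have -> : (2 ^ n.+1)%:R = 2 * (2 / 3) ^+ n * (3 ^ n)%:R :> R.
    rewrite -mulrA !natrX expr_div_n mulfVK ?exprS //.
    by rewrite expf_neq0 // pnatr_eq0.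
  by rewrite ler_wpM2l ?ler_nat // mulr_ge0 // exprn_ge0 // divr_ge0.
- exact: cvg_cst.
rewrite -[X in _ --> X]addr0 -[X in _ --> _ + X](mulr0 2).
apply: cvgD; first exact: cvg_cst.
apply: cvgM; first exact: cvg_cst.
by apply: cvg_expr; rewrite ger0_norm; lra.
Qed.
End Asymptotics.

Section Powers.
Variable K : klRing.
Local Notation b := (@kl_b K).

(** The second power is the first to have a projective part. Afterwards [wall_mul] at most doubles C
    and never shortens the word below m, so it applies again, while [wall_pos] at least triples the
    projective part. *)
Lemma wall_power (d i : 'I_3) m n : d != 0 -> (2 < m)%N -> exists C p s h,
  [/\ (m <= p)%N, (C <= 2 ^ n.+1)%N, (3 ^ n <= s)%N, pos s h &
    b (wall d i m) ^+ n.+2 = b (wall d i p) *+ C + h].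
Proof.
move=> d0 m3; elim: n => [|n [C [p [s [h [le_mp C2 s3 hs E]]]]]].
  have [|C [p [s [h [C2 le_p s0 hs E]]]]] := wall_mul K d0 i (m := m) (p := m).
    by rewrite m3 /=.
  by exists C, p, s, h; split; rewrite // ?expn1.
have mp : (2 < m <= p)%N by rewrite m3.
have [C' [p' [s' [h' [C2' le_p s0' hs' E']]]]] := wall_mul K d0 i mp.
have [s'' le_s hs''] := wall_pos d0 i m3 hs.
exists (C' * C)%N, p', (C * s' + s'')%N, (h' *+ C + b (wall d i m) * h); split.
- exact: leq_trans le_p.
- by rewrite (expnS 2 n.+1) leq_mul.
- rewrite expnS; apply: leq_trans (leq_addl _ _); apply: leq_trans le_s.
  by rewrite leq_mul2l s3.
- by apply: posD => //; apply: posMn.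
by rewrite exprS E mulrDr mulrnAr E' mulrnDl mulrnA addrA.
Qed.

Lemma pos_power (g : kl_ring K) n : (exists s, (0 < s)%N /\ pos s g) ->
  (forall s h, pos s h -> exists2 s', (s <= s')%N & pos s' (g * h)) ->
  exists2 s, (0 < s)%N & pos s (g ^+ n.+1).
Proof.
move=> [s [s0 gs]] Hg; elim: n => [|n [s1 s10 gn]]; first by exists s.
have [s2 le_s gs2] := Hg _ _ gn; exists s2; first exact: leq_trans le_s.
by rewrite exprS.
Qed.

End Powers.

Local Open Scope classical_set_scope.
Local Open Scope ring_scope.

Theorem lemma5p4p6 (R : realType) (w : W)
    (hw : forall I : {set 'I_3}, I != finset.setT -> ~ parabolic I w)
    (B : W -> genHecke) (hB : is_KL_basis B)
    (b : W -> hecke R) (hb : forall x, b x = specialize R (B x))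
    (nu : {scalar hecke R}) (hnu : forall x, nu (b x) = 1)
    (pi_proj : {linear hecke R -> hecke R})
    (hpi_in : forall x, proj_cell x -> pi_proj (b x) = b x)
    (hpi_out : forall x, ~ proj_cell x -> pi_proj (b x) = 0) :
  (fun n : nat => nu (b w ^+ n) / nu (pi_proj (b w ^+ n))) @ \oo --> (1 : R).
Proof.
pose K := KL_at1 R hB.
have kb x : @kl_b K x = b x by rewrite hb.
have nu_pos s (h : hecke R) : pos (K := K) s h -> nu h = s%:R.
  move=> [x [y [tx ty -> <-]]]; rewrite linearD natrD; congr (_ + _).
    rewrite linear_sum; elim: x tx => [_|v x' IH /andP[_ /IH{}IH]].
      by rewrite big_nil.
    by rewrite big_cons IH kb hnu /= -natr1 addrC.
  rewrite linear_sum; elim: y ty => [_|v x' IH /andP[tv /IH{}IH]].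
    by rewrite big_nil.
  by rewrite big_cons IH (b_asc (d := 1)) // kb hnu /= -natr1 addrC.
have pi_pos s (h : hecke R) : pos (K := K) s h -> pi_proj h = h.
  move=> [x [y [tx ty -> _]]]; rewrite linearD; congr (_ + _).
    rewrite linear_sum; apply: eq_big_seq => v /(allP tx)/proj_theta[pv _].
    by rewrite kb hpi_in.
  rewrite linear_sum; apply: eq_big_seq => v vy; have tv := allP ty v vy.
  by rewrite (b_asc (d := 1)) // kb hpi_in //; have [] := proj_theta tv.
have proj_case : (exists s, (0 < s)%N /\ pos (K := K) s (b w)) ->
  (forall s h, pos (K := K) s h -> exists2 s', (s <= s')%N & pos (K := K) s' (b w * h)) ->
  (fun n : nat => nu (b w ^+ n) / nu (pi_proj (b w ^+ n))) @ \oo --> (1 : R).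
  move=> H1 H2; rewrite -(cvg_shiftn 1); apply: cvg_near_cst; apply: nearW => n /=.
  have [s s0 hs] := pos_power n H1 H2.
  by rewrite addn1 (pi_pos s) // (nu_pos s) // divff // pnatr_eq0 -lt0n.
have [w1|[d [i [m [d0 m0 wE]]]]|tw|[v tv wE]] := W_cases w.
- case: (hw finset.set0); first by rewrite eq_sym -card_gt0 cardsT card_ord.
  by exists [::]; rewrite w1.
(* A cyclic word of at most two letters avoids the generator i - d, so it lies in a proper parabolic
   subgroup. *)
- have [m2|m3] := leqP m 2.
    case: (hw [set j | (j == i) || (j == i + d)]%SET); last first.
      by rewrite wE; apply: wall_parabolic.
    have [n1 n2 n3] := dir_neq i d0.
    apply/negP => /eqP/finset.setP/(_ (i - d)); rewrite !inE (eq_sym _ i).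
    by rewrite (negbTE n1) (negbTE n3).
  apply: cvg_ratio => n; have [C [p [s [h [mp C2 s3 hs E]]]]] := wall_power K i n d0 m3.
  exists C, s; split=> //.
  have -> : b w ^+ n.+2 = b (wall d i p) *+ C + h by rewrite wE -!kb.
  have piE : pi_proj (b (wall d i p) *+ C + h) = h.
    rewrite raddfD raddfMn /= hpi_out ?mul0rn ?add0r ?(pi_pos s h hs) //.
    by apply: wall_cyclic => //; apply: leq_trans mp; apply: ltnW (ltnW m3).
  by rewrite piE raddfD raddfMn /= hnu (nu_pos s h hs) natrD.
- apply: proj_case; last by move=> s h hs; rewrite -kb; apply: theta_pos.
  exists 1%N; split=> //; rewrite -kb -(Phi1 K w).
  by apply: (@pos_Phi K [:: w]); rewrite /= tw.
apply: proj_case.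
  exists 1%N; split=> //; rewrite -kb wE -(b_asc (d := 1)) //.
  have := @pos_PhiE K [:: v]; rewrite /sumE big_seq1; apply.
  by rewrite /= tv.
move=> s h hs; rewrite -kb wE -(b_asc (d := 1)) // -mulrA.
have [s1 le1 p1] := theta_pos tv hs; have [s2 le2 p2] := c_pos (asc v) p1.
by exists s2; first exact: leq_trans le2.
Qed.
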